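(* Let $\mathcal{G}$ and $\mathcal{G}'$ be totally disconnected étale groupoids and let $\pi:\mathcal{G}\to\mathcal{G}'$ be a continuous, surjective, proper homomorphism such that for every $x\in\mathcal{G}^{(0)}$, $\pi$ induces a bijection from $r^{-1}(x)$ to $r^{-1}(\pi(x))$. Suppose that $\pi$ is regular. Let $A$ be a discrete abelian group, and for $n\ge 0$ let $\Pi_n$ be the reduction map arising from $\pi^{(n)}:\mathcal{G}^{(n)}\to\mathcal{G}'^{(n)}$. Then: (1) $\Pi_n$ is an isomorphism from $C_c(\mathcal{G}^{(n)},A)/C_c(\mathcal{G}'^{(n)},A)$ to $C_c(\mathcal{G}_\pi^{(n)},A)/C_c((\mathcal{G}'_\pi)^{(n)},A)$. (2) The family $\Pi_*=(\Pi_n)_n$ of reduction maps gives an isomorphism between the chain complexes $\mathcal{C}(\mathcal{G},A)/\mathcal{C}(\mathcal{G}',A)$ and $\mathcal{C}(\mathcal{G}_\pi,A)/\mathcal{C}(\mathcal{G}'_\pi,A)$. Thus there are short exact sequences of chain complexes $$0\to\mathcal{C}(\mathcal{G}',A)\xrightarrow{\pi^*}\mathcal{C}(\mathcal{G},A)\to\mathcal{C}(\mathcal{G},A)/\mathcal{C}(\mathcal{G}',A)\to0,$$ $$0\to\mathcal{C}(\mathcal{G}'_\pi,A)\xrightarrow{\pi^*}\mathcal{C}(\mathcal{G}_\pi,A)\to\mathcal{C}(\mathcal{G}_\pi,A)/\mathcal{C}(\mathcal{G}'_\pi,A)\to0$$ whose quotient terms are isomorphic via $\Pi_*$.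
   Context: An étale groupoid means a second countable locally compact Hausdorff topological groupoid whose range map is a local homeomorphism. $\mathcal{G}^{(0)}$ is the unit space, $s(g)=g^{-1}g$, $r(g)=gg^{-1}$. Totally disconnected: connected components are singletons. For $n\ge1$, $\mathcal{G}^{(n)}$ is the space of $(g_1,\dots,g_n)\in\mathcal{G}^n$ with $s(g_i)=r(g_{i+1})$. Put $\pi^{(n)}(g_1,\dots,g_n)=(\pi(g_1),\dots,\pi(g_n))$ for $n\geq1$ and $\pi^{(0)}=\pi|_{\mathcal{G}^{(0)}}$. Chain complexes. $C_c(X,A)$: continuous compactly supported functions $X\to A$. For a local homeomorphism $\phi:X\to Y$, $\phi_*(f)(y)=\sum_{\phi(x)=y}f(x)$. For $n\ge2$, $d_0(g_1,\dots,g_n)=(g_2,\dots,g_n)$, $d_i(g_1,\dots,g_n)=(g_1,\dots,g_ig_{i+1},\dots,g_n)$ for $1\le i\le n-1$, $d_n(g_1,\dots,g_n)=(g_1,\dots,g_{n-1})$; for $n=1$, $d_0=s$, $d_1=r$. $\partial_n=\sum_{i=0}^n(-1)^id_{i*}$ and $\mathcal{C}(\mathcal{G},A)=(C_c(\mathcal{G}^{(n)},A),\partial_n)_{n\ge0}$. The homomorphism $\pi^*:\mathcal{C}(\mathcal{G}',A)\to\mathcal{C}(\mathcal{G},A)$ is $f\mapsto f\circ\pi^{(n)}$ in degree $n$; via it $\mathcal{C}(\mathcal{G}',A)$ is regarded as a subcomplex. Likewise for the restriction $\pi:\mathcal{G}_\pi\to\mathcal{G}'_\pi$. Regular maps. Let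 $(X,d),(X',d')$ be locally compact metric spaces and $\pi:X\to X'$ a continuous proper surjection. Write $\operatorname{diam}(K)$ for diameter and $d_{\mathrm H}$ for the Hausdorff metric on non-empty compact subsets of $X$. $\pi$ is regular if for every $x'\in X'$ and $\varepsilon>0$ there is an open neighborhood $U'$ of $x'$ such that for every $y'\in U'$ either $d_{\mathrm H}(\pi^{-1}(x'),\pi^{-1}(y'))<\varepsilon$ or $\operatorname{diam}\pi^{-1}(y')<\varepsilon$. Put $X'_\pi=\{x'\in X':\#\pi^{-1}(x')>1\}$ and $X_\pi=\pi^{-1}(X'_\pi)$, with metrics $d'_\pi(x',y')=d_{\mathrm H}(\pi^{-1}(x'),\pi^{-1}(y'))$ on $X'_\pi$ and $d_\pi(x,y)=d(x,y)+d'_\pi(\pi(x),\pi(y))$ on $X_\pi$. If $\pi$ is regular these are locally compact and $\pi:X_\pi\to X'_\pi$ is continuous, proper and open. Regularity and the resulting topologies depend only on the topologies of $X,X'$. Groupoid case. Fix metrics compatible with the topologies of $\mathcal{G}$ and $\mathcal{G}'$, and use restrictions of the $\ell^1$-product metrics on $\mathcal{G}^{(n)},\mathcal{G}'^{(n)}$ and restricted metrics on unit spaces. If $\pi:\mathcal{G}\to\mathcal{G}'$ is regular, then so is each $\pi^{(n)}$; $\mathcal{G}_\pi$ and $\mathcal{G}'_\pi$ (subgroupoids of $\mathcal{G},\mathcal{G}'$ with the topologies of $d_\pi,d'_\pi$) are étale groupoids, and $\mathcal{G}_\pi^{(n)}:=(\mathcal{G}_\pi)^{(n)}=(\mathcal{G}^{(n)})_{\pi^{(n)}}$,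 $(\mathcal{G}'_\pi)^{(n)}=(\mathcal{G}'^{(n)})_{\pi^{(n)}}$ as topological spaces. Reduction map. For $\pi:X\to X'$ regular with $X,X'$ totally disconnected, view $C_c(X',A)\subset C_c(X,A)$ and $C_c(X'_\pi,A)\subset C_c(X_\pi,A)$ via composition with $\pi$. For $f\in C_c(X,A)$ and compact open $K'\subset X'_\pi$ let $f_{K'}\in C_c(X_\pi,A)$ equal $f$ on $\pi^{-1}(K')$ and $0$ elsewhere. For all sufficiently large compact open $K'$ the class of $f_{K'}$ in $C_c(X_\pi,A)/C_c(X'_\pi,A)$ is independent of $K'$; it is denoted $\Pi(f)$. The homomorphism $\Pi:C_c(X,A)\to C_c(X_\pi,A)/C_c(X'_\pi,A)$ vanishes on $C_c(X',A)$ and is also regarded as a map on $C_c(X,A)/C_c(X',A)$. *)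

(* Defs.v *)
From HB Require Import structures.
From mathcomp Require Import all_boot all_order all_algebra.
From mathcomp Require Import ring_quotient.
From mathcomp Require Import all_classical all_reals.
From mathcomp Require Import topology normedtype.

Set Implicit Arguments.
Unset Strict Implicit.
Unset Printing Implicit Defensive.

Import Order.TTheory GRing.Theory Num.Theory.
Local Open Scope classical_set_scope.
Local Open Scope ring_scope.
Local Open Scope quotient_scope.

Definition proper_map (X Y : topologicalType) (f : X -> Y) : Prop :=
  forall K : set Y, compact K -> compact (f @^-1` K).

Definition local_homeomorphism (X Y : topologicalType) (f : X -> Y) : Prop :=
  continuous f /\
  forall x, exists U : set X, [/\ open U, U x, set_inj U f &
    forall V : set X, open V -> V `<=` U -> open (f @` V)].

(* The topology whose open sets are the unions of open balls of a distance
   function [d]; no property of [d] is needed to define it. *)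
Definition dist_topology {R : realType} {T : Type} (d : T -> T -> R) : Type := T.

Section DistTopology.
Variables (R : realType) (T : choiceType) (d : T -> T -> R).
Local Notation W := (dist_topology d).

HB.instance Definition _ := Choice.on W.

Definition dist_open : set_system W :=
  [set U | forall x, U x -> exists2 e : R, 0 < e & [set y | d x y < e] `<=` U].

Local Lemma dist_openT : dist_open [set: W].
Proof. by move=> x _; exists 1. Qed.

Local Lemma dist_openI : setI_closed dist_open.
Proof.
move=> U V oU oV x [/oU[e e0 eU] /oV[e' e'0 eV]].
exists (Num.min e e'); first by rewrite lt_min e0.
by move=> y /=; rewrite lt_min => /andP[? ?]; split; [exact: eU|exact: eV].
Qed.

Local Lemma dist_open_bigU (I : Type) (f : I -> set W) :
  (forall i, dist_open (f i)) -> dist_open (\bigcup_i f i).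
Proof.
move=> of_ x [i _ /(of_ i)[e e0 ef]].
by exists e => // y /ef ?; exists i.
Qed.

HB.instance Definition _ :=
  isOpenTopological.Build W dist_openT dist_openI dist_open_bigU.
End DistTopology.

Section CompactSupport.
Variables (X : topologicalType) (A : zmodType).

Definition Cc_pred : {pred X -> A} := fun f =>
  `[< continuous (f : X -> discrete_topology A) /\
      compact (closure [set x | f x != 0]) >].

Lemma Cc_predP f : reflect
  (continuous (f : X -> discrete_topology A) /\
   compact (closure [set x | f x != 0])) (f \in Cc_pred).
Proof. exact: asboolP. Qed.

Lemma continuous_discreteP (f : X -> A) :
  continuous (f : X -> discrete_topology A) <->
  forall x, \forall y \near x, f y = f x.
Proof.
split=> [cf x|cf x U].
  exact: (cf x [set f x] (discrete_set1 (f x : discrete_topology A))).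
move=> /nbhs_singleton Ufx; have := cf x.
by apply: filterS => y /= ->.
Qed.

Lemma Cc_zmod_closed : zmod_closed Cc_pred.
Proof.
split.
  apply/Cc_predP; split.
    by apply/continuous_discreteP => x; exact: filterE.
  rewrite (_ : [set _ | _] = set0) ?closure0; first exact: compact0.
  by apply/seteqP; split=> x //=; rewrite eqxx.
move=> f g /Cc_predP[cf kf] /Cc_predP[cg kg]; apply/Cc_predP; split.
  move: cf cg => /continuous_discreteP cf /continuous_discreteP cg.
  apply/continuous_discreteP => x.
  by apply: filterS2 (cf x) (cg x) => y /= e1 e2; rewrite !fctE e1 e2.
apply: (subclosed_compact _ (compactU kf kg)); first exact: closed_closure.
rewrite -closureU; apply: closureS => x /=; rewrite !fctE.
by have [->|] := eqVneq (f x) 0; [rewrite sub0r oppr_eq0; right|left].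
Qed.

HB.instance Definition _ := GRing.isZmodClosed.Build _ Cc_pred Cc_zmod_closed.

Record Cc := MkCc { Cc_fun :> X -> A; _ : Cc_fun \in Cc_pred }.

HB.instance Definition _ := [isSub for Cc_fun].
HB.instance Definition _ := [Choice of Cc by <:].
HB.instance Definition _ := [SubChoice_isSubZmodule of Cc by <:].

End CompactSupport.

(* The element of [Cc X A] given by [f], and 0 when [f] is not in it. *)
Definition to_Cc {X : topologicalType} {A : zmodType} (f : X -> A) : Cc X A :=
  insubd 0 f.

Section Pullback.
Variables (X Y : topologicalType) (p : X -> Y) (A : zmodType).

Definition pullback (f : Cc Y A) : Cc X A := to_Cc (f \o p).

(* [C_c(Y, A)] as a subgroup of [C_c(X, A)]. *)
Definition pullback_sub : {pred Cc X A} := fun f =>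
  `[< exists g : Cc Y A, (f : X -> A) = g \o p >].

Lemma pullback_sub_zmod_closed : zmod_closed pullback_sub.
Proof.
split; first by apply/asboolP; exists 0.
move=> f g /asboolP[f' ff'] /asboolP[g' gg']; apply/asboolP; exists (f' - g').
have Cc_funB Z (u v : Cc Z A) : Cc_fun (u - v) = Cc_fun u - Cc_fun v.
  exact: (raddfB (\val : Cc Z A -> (Z -> A))).
by rewrite !Cc_funB ff' gg'.
Qed.

HB.instance Definition _ :=
  GRing.isZmodClosed.Build _ pullback_sub pullback_sub_zmod_closed.

Definition Cc_quot : zmodType := Quotient.quot pullback_sub.

Definition Cc_proj (f : Cc X A) : Cc_quot := \pi_(Quotient.quot pullback_sub) f.
Definition Cc_repr (q : Cc_quot) : Cc X A := repr (q : Quotient.quot pullback_sub).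

End Pullback.

(* Computed on a chosen representative: this is the induced map when [F] sends
   [I] to [J], and is only used in that case. *)
Definition quot_map (U V : zmodType) (I : zmodClosed U) (J : zmodClosed V)
    (F : U -> V) (q : Quotient.quot I) : Quotient.quot J :=
  \pi_(Quotient.quot J) (F (repr q)).
Arguments quot_map {U V I J} F q.

Section Metric.
Variables (R : realType) (X : Type) (d : X -> X -> R).

Definition diam (K : set X) : R :=
  sup [set d z.1 z.2 | z in K `*` K].

Definition hausdorff_dist (K L : set X) : R :=
  Num.max (sup [set inf [set d x y | y in L] | x in K])
          (sup [set inf [set d x y | x in K] | y in L]).

End Metric.

Definition compact_open (Y : topologicalType) (K : set Y) : Prop :=
  compact K /\ open K.

Section Reduction.
(* [d] is a metric inducing the topology of [X]; a metric on [X'] would play no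
   role below. *)
Variables (R : realType) (X X' : topologicalType) (d : X -> X -> R).
Variable p : X -> X'.

Definition fibre (x' : X') : set X := p @^-1` [set x'].

Definition regular_map : Prop :=
  forall (x' : X') (e : R), 0 < e -> exists U' : set X', [/\ open U', U' x' &
    forall y', U' y' ->
      hausdorff_dist d (fibre x') (fibre y') < e \/ diam d (fibre y') < e].

(* The points of [X'] with at least two preimages, and their preimages: the
   sets [X'_p] and [X_p]. They carry the topologies of [dist_multi'] and
   [dist_multi] (as [red'] and [red]), not the subspace topologies. *)
Definition multi' : set X' :=
  [set x' | exists x y, [/\ fibre x' x, fibre x' y & x <> y]].
Definition multi : set X := p @^-1` multi'.

Definition multi_map (x : multi) : multi' :=
  exist _ (p (val x)) (mem_set (set_mem (valP x))).

Definition dist_multi' (x' y' : multi') : R :=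
  hausdorff_dist d (fibre (val x')) (fibre (val y')).
Definition dist_multi (x y : multi) : R :=
  d (val x) (val y) + dist_multi' (multi_map x) (multi_map y).

Definition red' : topologicalType := dist_topology dist_multi'.
Definition red : topologicalType := dist_topology dist_multi.

Definition red_val (x : red) : X := val (x : set_type multi).
Definition red_map : red -> red' := multi_map.

Variable A : zmodType.

Definition cutoff (f : Cc X A) (K' : set red') (x : red) : A :=
  if red_map x \in K' then f (red_val x) else 0.

(* The eventual value of the class of [cutoff f K'], as [K'] grows among the
   compact open sets; it is unique because those sets are directed under
   inclusion. *)
Definition reduction (f : Cc X A) : Cc_quot red_map A :=
  xget 0 [set q | exists K0 : set red', compact_open K0 /\
    forall K' : set red', compact_open K' -> K0 `<=` K' ->
      Cc_proj red_map (to_Cc (cutoff f K')) = q].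

End Reduction.

(* The product [gmul g h] is only meaningful for composable pairs, i.e., when
   [gsrc g = grng h]; the axioms do not constrain its other values. *)
Record groupoid (T : Type) := Groupoid {
  gmul : T -> T -> T;
  ginv : T -> T;
  gsrc : T -> T := fun g => gmul (ginv g) g;
  grng : T -> T := fun g => gmul g (ginv g);
  ginvK : forall g, ginv (ginv g) = g;
  gmulA : forall g h k, gsrc g = grng h -> gsrc h = grng k ->
    [/\ gsrc (gmul g h) = grng k, gsrc g = grng (gmul h k) &
        gmul (gmul g h) k = gmul g (gmul h k)];
  gmulKl : forall g h, gsrc g = grng h -> gmul (ginv g) (gmul g h) = h;
  gmulKr : forall g h, gsrc g = grng h -> gmul (gmul g h) (ginv h) = g
}.

Record groupoid_hom (T T' : Type) (G : groupoid T) (G' : groupoid T') :=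
  GroupoidHom {
    hom_fun :> T -> T';
    hom_comp : forall g h, gsrc G g = grng G h ->
      gsrc G' (hom_fun g) = grng G' (hom_fun h);
    homM : forall g h, gsrc G g = grng G h ->
      hom_fun (gmul G g h) = gmul G' (hom_fun g) (hom_fun h)
  }.

Definition gunits (T : Type) (G : groupoid T) : set T := range (grng G).

Definition fibrewise_bijective (T T' : Type) (G : groupoid T)
    (G' : groupoid T') (p : groupoid_hom G G') : Prop :=
  forall x, gunits G x ->
    set_bij (grng G @^-1` [set x]) (grng G' @^-1` [set p x]) p.

Section GroupoidTheory.
Variables (T : Type) (G : groupoid T).

Lemma gsrcV g : gsrc G (ginv G g) = grng G g.
Proof. by rewrite /gsrc /grng ginvK. Qed.

Lemma grngV g : grng G (ginv G g) = gsrc G g.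
Proof. by rewrite /gsrc /grng ginvK. Qed.

Lemma gsrcM g h : gsrc G g = grng G h -> gsrc G (gmul G g h) = gsrc G h.
Proof.
by move=> gh; have [] := gmulA gh (esym (grngV h)); rewrite grngV.
Qed.

Lemma grngM g h : gsrc G g = grng G h -> grng G (gmul G g h) = grng G g.
Proof. by move=> gh; have [] := gmulA (gsrcV g) gh; rewrite gsrcV. Qed.

Lemma gsrc_rng g : gsrc G (grng G g) = grng G g.
Proof. by rewrite /grng gsrcM ?gsrcV ?grngV. Qed.

Lemma grng_rng g : grng G (grng G g) = grng G g.
Proof. by rewrite {2}/grng grngM ?grngV. Qed.

Lemma gsrc_unit g : gunits G (gsrc G g).
Proof. by exists (ginv G g) => //; rewrite grngV. Qed.

Lemma gmul1g g : gmul G (grng G g) g = g.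
Proof. by have := @gmulKr T G g (ginv G g); rewrite ginvK grngV; exact. Qed.

End GroupoidTheory.

Section HomTheory.
Variables (T T' : Type) (G : groupoid T) (G' : groupoid T').
Variable p : groupoid_hom G G'.

Lemma homV g : p (ginv G g) = ginv G' (p g).
Proof.
have ba : gsrc G' (p (ginv G g)) = grng G' (p g).
  by apply: hom_comp; rewrite gsrcV.
have ab : gsrc G' (p g) = grng G' (p (ginv G g)).
  by apply: hom_comp; rewrite grngV.
have aba : gmul G' (gmul G' (p g) (p (ginv G g))) (p g) = p g.
  rewrite -homM ?grngV// -homM ?gmul1g//.
  by rewrite gsrcM ?gsrcV ?grngV.
have e : gmul G' (p g) (p (ginv G g)) = grng G' (p g).
  by rewrite -[LHS](@gmulKr _ G' _ (p g)) ?aba// gsrcM.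
by rewrite -[LHS](gmulKl ab) e gmulKl// grngV.
Qed.

Lemma hom_rng g : p (grng G g) = grng G' (p g).
Proof. by rewrite /grng homM ?homV// grngV. Qed.

Lemma hom_src g : p (gsrc G g) = gsrc G' (p g).
Proof. by rewrite /gsrc homM ?homV// gsrcV. Qed.

End HomTheory.

Section Subgroupoid.
Variables (T : Type) (G : groupoid T) (S : set T).

Definition subgroupoid_closed : Prop :=
  (forall g, S g -> S (ginv G g)) /\
  (forall g h, S g -> S h -> gsrc G g = grng G h -> S (gmul G g h)).

Hypothesis SG : subgroupoid_closed.

Definition sub_mul (g h : S) : S := insubd g (gmul G (val g) (val h)).
Definition sub_inv (g : S) : S :=
  exist _ (ginv G (val g)) (mem_set (SG.1 _ (set_valP g))).

Lemma val_sub_mul g h : gsrc G (val g) = grng G (val h) ->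
  val (sub_mul g h) = gmul G (val g) (val h).
Proof.
move=> gh; rewrite insubdK//; apply: mem_set.
exact: (SG.2 _ _ (set_valP g) (set_valP h)).
Qed.

Lemma val_sub_src g : val (sub_mul (sub_inv g) g) = gsrc G (val g).
Proof. by rewrite val_sub_mul//= gsrcV. Qed.

Lemma val_sub_rng g : val (sub_mul g (sub_inv g)) = grng G (val g).
Proof. by rewrite val_sub_mul//= grngV. Qed.

Lemma sub_compP g h :
  sub_mul (sub_inv g) g = sub_mul h (sub_inv h) <->
  gsrc G (val g) = grng G (val h).
Proof.
by rewrite -val_sub_src -val_sub_rng; split=> [->//|/val_inj].
Qed.

Program Definition subgroupoid : groupoid S :=
  @Groupoid S sub_mul sub_inv _ _ _ _.
Next Obligation. by move=> g; apply: val_inj; rewrite /= ginvK. Qed.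
Next Obligation.
move=> g h k /sub_compP gh /sub_compP hk; have [ghk ghk' e] := gmulA gh hk.
split; first by apply/sub_compP; rewrite val_sub_mul.
  by apply/sub_compP; rewrite val_sub_mul.
by apply: val_inj; rewrite !val_sub_mul//; rewrite val_sub_mul.
Qed.
Next Obligation.
move=> g h /sub_compP gh; apply: val_inj.
by rewrite val_sub_mul /= val_sub_mul// ?gmulKl// gsrcV grngM.
Qed.
Next Obligation.
move=> g h /sub_compP gh; apply: val_inj.
by rewrite val_sub_mul /= val_sub_mul// ?gmulKr// grngV gsrcM.
Qed.

End Subgroupoid.

Section Etale.
Variables (T : topologicalType) (G : groupoid T).

Definition grng_unit (g : T) : gunits G :=
  exist _ (grng G g) (mem_set (imageT (grng G) g)).

Record etale_groupoid : Prop := EtaleGroupoid {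
  etale_second_countable : @second_countable T;
  etale_locally_compact : locally_compact [set: T];
  etale_hausdorff : hausdorff_space T;
  etale_inv_continuous : continuous (ginv G);
  etale_mul_continuous :
    {within [set gh : T * T | gsrc G gh.1 = grng G gh.2],
      continuous (fun gh => gmul G gh.1 gh.2)};
  etale_rng_local_homeomorphism : local_homeomorphism grng_unit
}.

End Etale.

Section Nerve.
Variables (T : topologicalType) (G : groupoid T).

(* Tuples are indexed from 0. The unit space is encoded as a space of
   1-tuples, so that the [n]-th space consists of tuples of length [max n 1]. *)
Definition nerve_tuple (n : nat) := prod_topology (fun _ : 'I_n.-1.+1 => T).

Definition nerve_set (n : nat) : set (nerve_tuple n) :=
  [set t | if n is 0%N then gunits G (t ord0)
           else forall i j : 'I_n.-1.+1, j = i.+1 :> nat ->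
             gsrc G (t i) = grng G (t j)].

Arguments nerve_set n t : clear implicits.

Definition nerve (n : nat) : topologicalType := set_type (nerve_set n).

Definition nerve_val n (t : nerve n) : nerve_tuple n :=
  val (t : set_type (nerve_set n)).

(* Entry [j] of [d_i (t_0, ..., t_n)], for [0 < n], is [t_j] if [j + 1 < i],
   [t_j t_(j+1)] if [j + 1 = i] and [t_(j+1)] if [i < j + 1]. *)
Definition face n (i : 'I_n.+2) (t : nerve n.+1) : nerve_tuple n :=
  let t := nerve_val t in
  if n is 0%N then fun=> if i == 0 :> nat then gsrc G (t ord0) else grng G (t ord0)
  else fun j =>
    if (j.+1 < i)%N then t (inord j)
    else if j.+1 == i :> nat then gmul G (t (inord j)) (t (inord j.+1))
    else t (inord j.+1).

Variable A : zmodType.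

(* Faces take values in the ambient space of tuples, and their direct images are
   only evaluated at composable tuples. *)
Definition push (X : choiceType) (Y : Type) (phi : X -> Y) (f : X -> A) (y : Y) : A :=
  \sum_(x \in phi @^-1` [set y]) f x.

Definition boundary_fun n (f : nerve n.+1 -> A) (y : nerve n) : A :=
  \sum_(i < n.+2) push (face i) f (nerve_val y) *~ (-1) ^+ i.

Definition boundary n (f : Cc (nerve n.+1) A) : Cc (nerve n) A :=
  to_Cc (boundary_fun f).

End Nerve.

Arguments nerve_set {T} G n t.

Section NerveMap.
Variables (T T' : topologicalType) (G : groupoid T) (G' : groupoid T').
Variable p : groupoid_hom G G'.

Lemma nerve_mapP n (t : nerve G n) :
  nerve_set G' n (fun i => p (nerve_val t i)).
Proof.
case: n t => [|n] t; have := set_valP t; rewrite /nerve_set/=.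
  by case=> g _ e; exists (p g) => //; rewrite -hom_rng e.
by move=> tP i j ij; apply: hom_comp; exact: tP.
Qed.

Definition nerve_map n (t : nerve G n) : nerve G' n :=
  exist _ (fun i => p (nerve_val t i)) (mem_set (nerve_mapP t)).

End NerveMap.

Arguments nerve_map {T T' G G'} p n t.

Definition nerve_dist {R : realType} (T : topologicalType) (d : T -> T -> R)
    (G : groupoid T) n (t u : nerve G n) : R :=
  \sum_(i < n.-1.+1) d (nerve_val t i) (nerve_val u i).

Arguments nerve_dist {R T} d G n t u.

Section ReductionGroupoid.
Variables (R : realType) (T T' : topologicalType) (d : T -> T -> R).
Variables (G : groupoid T) (G' : groupoid T') (p : groupoid_hom G G').
Hypothesis pb : fibrewise_bijective p.

Lemma fibrewise_lift (g : T) (h' : T') : gsrc G' (p g) = grng G' h' ->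
  exists h, gsrc G g = grng G h /\ p h = h'.
Proof.
move=> gh; have [_ _ /(_ h')] := pb (gsrc_unit G g).
case=> [|h /= <- <-]; last by exists h.
by rewrite /= hom_src.
Qed.

Lemma fibrewise_inj (g h : T) : grng G g = grng G h -> p g = p h -> g = h.
Proof.
move=> gh; have [_ /(_ g h) pinj _] := pb (imageT (grng G) g).
by apply: pinj; rewrite inE/=.
Qed.

Lemma multi'_closed : subgroupoid_closed G' (multi' p).
Proof.
split=> [g' [g [h [/= gg' hg' gh]]]|].
  exists (ginv G g), (ginv G h); split; rewrite /fibre/= ?homV ?gg' ?hg'//.
  by move=> /(congr1 (ginv G)); rewrite !ginvK.
move=> g' k' [g [h [/= gg' hg' gh]]] _ gk.
have [|k [gk1 kk']] := @fibrewise_lift g k'; first by rewrite gg'.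
have [|l [hl lk']] := @fibrewise_lift h k'; first by rewrite hg'.
exists (gmul G g k), (gmul G h l); split; rewrite /fibre/=.
- by rewrite homM// gg' kk'.
- by rewrite homM// hg' lk'.
move=> e; apply: gh; apply: fibrewise_inj; last by rewrite gg'.
by rewrite -(grngM gk1) -(grngM hl) e.
Qed.

Lemma multi_closed : subgroupoid_closed G (multi p).
Proof.
have [Vcl Mcl] := multi'_closed.
split=> [g|g h]; rewrite /multi/= ?homV; first exact: Vcl.
by move=> mg mh gh; rewrite homM//; apply: Mcl => //; exact: hom_comp.
Qed.

Definition red_groupoid' : groupoid (red' d p) := subgroupoid multi'_closed.
Definition red_groupoid : groupoid (red d p) := subgroupoid multi_closed.

Lemma red_compP (g h : red d p) :
  gsrc red_groupoid g = grng red_groupoid h ->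
  gsrc G (red_val g) = grng G (red_val h).
Proof. by move=> gh; exact/(sub_compP multi_closed g h). Qed.

Program Definition red_incl : groupoid_hom red_groupoid G :=
  @GroupoidHom _ _ red_groupoid G (@red_val _ _ _ d p) _ _.
Next Obligation. by move=> g h /red_compP. Qed.
Next Obligation.
by move=> g h /red_compP gh; exact: (val_sub_mul multi_closed).
Qed.

Program Definition red_hom : groupoid_hom red_groupoid red_groupoid' :=
  @GroupoidHom _ _ red_groupoid red_groupoid' (@red_map _ _ _ d p) _ _.
Next Obligation.
move=> g h /red_compP/(hom_comp p) gh.
exact/(sub_compP multi'_closed (red_map g) (red_map h)).
Qed.
Next Obligation.
move=> g h /red_compP gh; apply: val_inj.
apply: etrans (esym (@val_sub_mul _ _ _ multi'_closed
  (red_map g) (red_map h) (hom_comp p gh))).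
rewrite /= -homM//; apply: (congr1 p).
exact: (val_sub_mul multi_closed gh).
Qed.

Lemma nerve_red_multi n (t : nerve red_groupoid n) :
  multi (nerve_map p n) (nerve_map red_incl n t).
Proof.
set u := nerve_map red_incl n t.
suff [v pv vu] : exists2 v : nerve G n, nerve_map p n v = nerve_map p n u & v <> u.
  by exists u, v; split => //; exact: nesym.
have [h0 ph0 h0u] : exists2 h, p h = p (nerve_val u ord0) & h <> nerve_val u ord0.
  have := set_valP (nerve_val t ord0 : set_type (multi p)).
  case=> a [b [/= pa pb' ab]].
  have [au|au] := pselect (a = nerve_val u ord0); last by exists a.
  by exists b => // bu; apply: ab; rewrite au bu.
have valI (v w : nerve G n) : (nerve_val v = nerve_val w) -> v = w.
  exact: val_inj.
have valI' (v w : nerve G' n) : (nerve_val v = nerve_val w) -> v = w.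
  exact: val_inj.
clearbody u; clear t.
case: n u h0 valI valI' ph0 h0u => [|n] u h0 valI valI' ph0 h0u.
  have [k _ ku] := set_valP u.
  have h0r : h0 = grng G h0.
    apply: fibrewise_inj; first by rewrite grng_rng.
    by rewrite hom_rng ph0 -[nerve_val u ord0]ku !hom_rng grng_rng.
  have h0P : nerve_set G 0 (fun=> h0) by exists h0.
  exists (exist _ (fun=> h0) (mem_set h0P) : nerve G 0).
    by apply: valI'; apply/funext => i; rewrite /= (ord1 i).
  by move=> e; apply: h0u; rewrite -e.
have uP : forall i j : 'I_n.+1, j = i.+1 :> nat ->
  gsrc G (nerve_val u i) = grng G (nerve_val u j) := set_valP u.
have /choice[lift liftP] : forall gk : T * T', exists h,
    gsrc G' (p gk.1) = grng G' gk.2 -> gsrc G gk.1 = grng G h /\ p h = gk.2.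
  move=> [g k]; have [e|ne] := pselect (gsrc G' (p g) = grng G' k).
    by have [h] := fibrewise_lift e; exists h.
  by exists g.
pose w := fix w k := if k is k'.+1
  then lift (w k', p (nerve_val u (inord k))) else h0.
have wP k : (k <= n)%N -> p (w k) = p (nerve_val u (inord k)) /\
    ((k < n)%N -> gsrc G (w k) = grng G (w k.+1)).
  elim: k => [|k IH] kn.
    have pw0 : p (w 0%N) = p (nerve_val u (inord 0)).
      by rewrite /= ph0; congr (p (nerve_val u _)); apply: val_inj; rewrite /= inordK.
    split=> // n0.
    apply: (liftP (w 0%N, p (nerve_val u (inord 1))) _).1; rewrite pw0.
    by apply: hom_comp; apply: uP; rewrite !inordK.
  have [pwk _] := IH (ltnW kn).
  have pwk1 : p (w k.+1) = p (nerve_val u (inord k.+1)).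
    apply: (liftP (w k, p (nerve_val u (inord k.+1))) _).2; rewrite pwk.
    by apply: hom_comp; apply: uP; rewrite !inordK// ltnW.
  split=> // k1n.
  apply: (liftP (w k.+1, p (nerve_val u (inord k.+2))) _).1; rewrite pwk1.
  by apply: hom_comp; apply: uP; rewrite !inordK.
have vP : nerve_set G n.+1 (fun i => w i).
  move=> i j /= ji; rewrite ji; apply: (wP i _).2; first by rewrite -ltnS.
  by rewrite -ltnS -ji.
exists (exist _ (fun i : 'I_n.+1 => w i) (mem_set vP) : nerve G n.+1).
  apply: valI'; apply/funext => i; have [|e _] := wP i; first by rewrite -ltnS.
  by rewrite inord_val in e.
by move=> e; apply: h0u; rewrite -e.
Qed.

(* The identification of [(G_p)^(n)] with [(G^(n))_(p^(n))]. *)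
Definition nerve_red n (t : nerve red_groupoid n) :
    red (nerve_dist d G n) (nerve_map p n) :=
  exist _ (nerve_map red_incl n t) (mem_set (nerve_red_multi t)).

End ReductionGroupoid.

Arguments nerve_red {R T T'} d {G G' p} pb n t.

Record chain := Chain {
  chain_obj :> nat -> zmodType;
  chain_bd : forall n, chain_obj n.+1 -> chain_obj n
}.

Definition is_complex (C : chain) : Prop :=
  (forall n, zmod_morphism (@chain_bd C n)) /\
  (forall n (x : C n.+2), chain_bd (chain_bd x) = 0).

Definition chain_map (C D : chain) (f : forall n, C n -> D n) : Prop :=
  (forall n, zmod_morphism (f n)) /\
  (forall n (x : C n.+1), f n (chain_bd x) = chain_bd (f n.+1 x)).

Definition chain_iso (C D : chain) (f : forall n, C n -> D n) : Prop :=
  chain_map f /\ forall n, bijective (f n).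

Definition short_exact (C D E : chain) (f : forall n, C n -> D n)
    (g : forall n, D n -> E n) : Prop :=
  [/\ chain_map f, chain_map g &
    forall n, [/\ injective (f n), range (f n) = g n @^-1` [set 0] &
      set_surj setT setT (g n)]].

Definition groupoid_chain (T : topologicalType) (G : groupoid T)
    (A : zmodType) : chain :=
  @Chain (fun n => Cc (nerve G n) A) (@boundary T G A).

(* [boundary] and [pullback] return 0 on functions whose image is not
   continuous with compact support; these two conditions say that it does not
   happen. *)
Definition boundary_defined (T : topologicalType) (G : groupoid T)
    (A : zmodType) : Prop :=
  forall n (f : Cc (nerve G n.+1) A), (boundary f : _ -> A) = boundary_fun f.

Definition pullback_defined (X Y : topologicalType) (p : X -> Y)
    (A : zmodType) : Prop :=
  forall f : Cc Y A, (pullback p f : X -> A) = f \o p.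

Section PullbackChain.
Variables (T T' : topologicalType) (G : groupoid T) (G' : groupoid T').
Variables (p : groupoid_hom G G') (A : zmodType).

Definition pullback_chain n :
    groupoid_chain G' A n -> groupoid_chain G A n :=
  pullback (nerve_map p n) (A := A).

(* The quotient complex, with [pullback_chain] regarded as an inclusion. *)
Definition quot_chain : chain :=
  @Chain (fun n => Cc_quot (nerve_map p n) A)
         (fun n => quot_map (@boundary T G A n)).

Definition quot_chain_proj n : groupoid_chain G A n -> quot_chain n :=
  @Cc_proj _ _ (nerve_map p n) A.

End PullbackChain.

Section GroupoidReduction.
Variables (R : realType) (T : metricType R) (T' : topologicalType).
Variables (G : groupoid T) (G' : groupoid T') (p : groupoid_hom G G').
Hypothesis pb : fibrewise_bijective p.
Variable A : zmodType.

Local Notation d := (@mdist R T).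
Local Notation Gp := (red_groupoid d pb).
Local Notation p_p := (red_hom d pb).

(* The reduction map of [p^(n)], its values being transported along the
   identification [nerve_red]. *)
Definition groupoid_reduction n (f : groupoid_chain G A n) :
    quot_chain p_p A n :=
  quot_map (@pullback _ _ (nerve_red d pb n) A)
    (reduction (nerve_dist d G n) (nerve_map p n) f).

Definition groupoid_reduction_quot n (q : quot_chain p A n) :
    quot_chain p_p A n :=
  groupoid_reduction (Cc_repr q).

End GroupoidReduction.

(* Main.v *)
Require Import Defs.
From HB Require Import structures.
From mathcomp Require Import all_boot all_order all_algebra.
From mathcomp Require Import ring_quotient.
From mathcomp Require Import all_classical all_reals.
From mathcomp Require Import topology normedtype.
From mathcomp Require Import zify.

(* In [X'_p], [y'] tends to [x'] if and only if the fibre of [y'] eventually meets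
   every open set that meets the fibre of [x']; this no longer mentions a metric,
   and compactness arguments can be carried out with ultrafilters. Regularity says that
   along an ultrafilter the fibres either converge in this sense or shrink to a
   point. Hence, for [f] in [C_c(X, A)], the set of the points of [X'] on whose
   fibre [f] is not constant is compact and open in [X'_p], and a function [g] in
   [C_c(X_p, A)] represents the reduction of [f] if and only if [f - g] is
   constant on the fibres of [X_p -> X'_p]. With this description additivity and
   injectivity are immediate; for surjectivity one extends [g] from a single
   fibre to [X], observes that the extension still agrees with [g] on nearby
   fibres, cuts it off by compact open sets of [X'], and glues.
   For groupoids, the [i]-th face and one further arrow, whose range is
   prescribed, determine a composable tuple. So faces are local homeomorphisms
   and, since [p] is bijective on range fibres, [p] maps the fibres of each face
   bijectively onto those of the corresponding face; sums over these fibres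
   therefore respect the description of the reduction above. *)

Set Implicit Arguments.
Unset Strict Implicit.
Unset Printing Implicit Defensive.

Import Order.TTheory GRing.Theory Num.Theory.
Local Open Scope classical_set_scope.
Local Open Scope ring_scope.

(* [topology] also defines a [compact_open]. *)
Local Notation compact_open := Defs.compact_open.

(** * Filters, locally constant functions and perfect maps *)

(** The obstacle is that the reduced spaces occur in two guises: [reduction] for a map of nerves
    lives on [red] for the distance [nerve_dist], whereas the chain complexes live on the nerves of
    [red_groupoid], which is another type with another description of the topology.
    [reduction_model] records what both have in common. Reductions are studied for an arbitrary
    model, and two models of the same map turn out to be homeomorphic. The same device takes the
    place of a direct proof that the reduced groupoids are étale: what the complexes require of a
    groupoid is that its nerves be Hausdorff with a basis of compact open sets and that its faces be
    étale, and this is transferred from the original groupoids. Maps into [Cc] are total with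
    default value 0, and induced maps on quotients use chosen representatives; hence membership in
    [Cc] and independence of representatives must be settled before any computation. *)

Section Ultrafilters.

Lemma ultraN T (F : set_system T) (A : set T) :
  UltraFilter F -> ~ F A -> F (~` A).
Proof. by move=> UF nFA; have [] := in_ultra_setVsetC A UF. Qed.

Lemma fmap_ultra T U (f : T -> U) (F : set_system T) :
  UltraFilter F -> UltraFilter (f @ F).
Proof.
move=> UF; split=> [|G PG FG]; first exact: fmap_proper_filter.
apply/seteqP; split=> [A GA|]; last exact: FG.
apply: contrapT => /(ultraN UF) nFA.
have /(filterI GA) : G (~` A) by apply: FG.
by rewrite setICr => /filter_not_empty.
Qed.

Lemma ultra_not T (F : set_system T) (A : set T) : Filter F -> ~ F A ->
  exists G, [/\ UltraFilter G, F `<=` G & G (~` A)].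
Proof.
move=> FF nFA.
have PW : ProperFilter (within (~` A) F).
  split; last exact: within_filter.
  by rewrite /within/= => F0; apply: nFA; apply: filterS F0 => x /contrapT.
have [G [UG WG]] := ultraFilterLemma PW; exists G; split=> //.
- by move=> B FB; apply: WG; rewrite /within/=; apply: filterS FB.
- by apply: WG; rewrite /within/=; exact: filterE.
Qed.

Lemma filter_ultraP T (F : set_system T) (A : set T) : Filter F ->
  (forall G, UltraFilter G -> F `<=` G -> G A) -> F A.
Proof.
move=> FF FA; apply: contrapT => /(ultra_not FF)[G [UG FG]].
by move=> /(filterI (FA _ UG FG)); rewrite setICr => /filter_not_empty.
Qed.

Lemma compact_ultraP (T : topologicalType) (K : set T) : compact K <->
  forall F : set_system T, UltraFilter F -> F K -> exists2 x, K x & F --> x.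
Proof.
rewrite compact_ultra; split=> cK F UF FK.
  by have [x [Kx Fx]] := cK F UF FK; exists x.
by have [x Kx Fx] := cK F UF FK; exists x.
Qed.

(** If [P K] fails, the sets whose complement in [K] satisfies [P] form a proper filter, and a
    cluster point of it in [K] contradicts the local hypothesis. This replaces extracting finite
    subcovers. *)
Lemma compact_ind (T : topologicalType) (K : set T) (P : set T -> Prop) :
  compact K -> P set0 -> (forall A B, A `<=` B -> P B -> P A) ->
  (forall A B, P A -> P B -> P (A `|` B)) ->
  (forall x, K x -> exists2 U, nbhs x U & P U) -> P K.
Proof.
move=> cK P0 PS PU Pnbhs; apply: contrapT => nPK.
pose F : set_system T := [set S | P (K `\` S)].
have PF : ProperFilter F.
  split; first by rewrite /F/= setD0.
  split; rewrite /F/=.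
  - by rewrite setDT.
  - by move=> A B PA PB /=; rewrite setDIr; exact: PU.
  - by move=> A B AB /=; apply: PS => x [Kx nB]; split=> // /AB.
have [|x [Kx Fx]] := cK F PF; first by rewrite /F/= setDv.
have [U xU PU'] := Pnbhs _ Kx.
have [|y [nUy Uy]] := Fx (~` U) U _ xU; last exact: nUy.
by rewrite /F/= setDE setCK; apply: PS PU'; exact: subIsetr.
Qed.

Lemma hausdorff_cvg_unique (T : topologicalType) (F : set_system T) (x y : T) :
  hausdorff_space T -> ProperFilter F -> F --> x -> F --> y -> x = y.
Proof. by move=> hT PF Fx Fy; exact: (cvg_unique hT Fx Fy). Qed.

End Ultrafilters.

(** Continuity into a discrete space, for a codomain that is a mere type; it thus applies to boolean
    membership as well. *)
Definition locally_constant (X : topologicalType) (B : Type) (f : X -> B) :=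
  forall x, \forall y \near x, f y = f x.

Definition compact_open_basis (X : topologicalType) : Prop :=
  forall (x : X) (U : set X), nbhs x U ->
    exists C, [/\ compact_open C, C x & C `<=` U].

Section LocallyConstant.
Variables (X : topologicalType) (B : Type).

Lemma locally_constant_open (f : X -> B) (P : set B) :
  locally_constant f -> open (f @^-1` P).
Proof.
move=> cf; rewrite openE => x /= Px.
by apply: filterS (cf x) => y /= ->.
Qed.

Lemma locally_constant_closed (f : X -> B) (P : set B) :
  locally_constant f -> closed (f @^-1` P).
Proof.
move=> cf; rewrite -(setCK (f @^-1` P)); apply: open_closedC.
by rewrite preimage_setC; exact: locally_constant_open.
Qed.

Lemma locally_constant_comp (Y : topologicalType) (g : Y -> X) (f : X -> B) :
  continuous g -> locally_constant f -> locally_constant (f \o g).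
Proof. by move=> cg cf y; exact: cg y _ (cf (g y)). Qed.

Lemma locally_constant_mem (C : set X) : open C -> closed C ->
  locally_constant (fun x => x \in C).
Proof.
move=> oC cC x; case: (boolP (x \in C)) => [/set_mem|/negP] xC.
  by apply: filterS (open_nbhs_nbhs (conj oC xC)) => y /mem_set ->.
have nxC : (~` C) x by move=> /mem_set.
have oC' := closed_openC cC.
apply: filterS (open_nbhs_nbhs (conj oC' nxC)) => y /= nCy.
by apply/negbTE/negP => /set_mem.
Qed.

End LocallyConstant.

Section CcBasics.
Variables (X : topologicalType) (A : zmodType).

(** The set where a locally constant function is nonzero is already closed, so the closure in the
    definition of the support disappears. *)
Lemma CcP (f : X -> A) : f \in @Cc_pred X A <->
  locally_constant f /\ exists2 K, compact K & forall x, f x != 0 -> K x.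
Proof.
split=> [/Cc_predP[/continuous_discreteP cf kf]|[cf [K cK fK]]].
  split=> //; exists (closure [set x | f x != 0]) => // x fx.
  exact: subset_closure.
apply/Cc_predP; split; first exact/continuous_discreteP.
have cl : closed [set x | f x != 0].
  exact: (@locally_constant_closed X A f [set a | a != 0] cf).
by rewrite -((closure_id _).1 cl); exact: subclosed_compact cK _.
Qed.

Lemma Cc_locally_constant (f : Cc X A) : locally_constant f.
Proof. by have /CcP[] := valP f. Qed.

Lemma Cc_supp (f : Cc X A) : exists2 K, compact K & forall x, f x != 0 -> K x.
Proof. by have /CcP[] := valP f. Qed.

Lemma Cc_eqP (f g : Cc X A) : (f : X -> A) =1 g -> f = g.
Proof. by move=> fg; apply/val_inj/funext. Qed.

Lemma to_CcE (f : X -> A) : f \in @Cc_pred X A -> (to_Cc f : X -> A) = f.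
Proof. by move=> fC; rewrite /to_Cc insubdK. Qed.

Lemma Cc0E : ((0 : Cc X A) : X -> A) = (fun=> 0).
Proof. exact: (raddf0 (\val : Cc X A -> (X -> A))). Qed.

Lemma CcBE (f g : Cc X A) x : (f - g) x = f x - g x.
Proof.
have -> // : Cc_fun (f - g) = Cc_fun f - Cc_fun g.
exact: (raddfB (\val : Cc X A -> (X -> A))).
Qed.

Lemma CcDE (f g : Cc X A) x : (f + g) x = f x + g x.
Proof.
have -> // : Cc_fun (f + g) = Cc_fun f + Cc_fun g.
exact: (raddfD (\val : Cc X A -> (X -> A))).
Qed.

Lemma Cc_if (C : set X) (f g : Cc X A) : open C -> closed C ->
  (fun x => if x \in C then f x else g x) \in @Cc_pred X A.
Proof.
move=> oC cC; have [K cK fK] := Cc_supp f; have [L cL gL] := Cc_supp g.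
apply/CcP; split.
  move=> x; have Cx := locally_constant_mem oC cC x.
  apply: filterS3 (Cc_locally_constant f x) (Cc_locally_constant g x) Cx.
  by move=> y fy gy ->; rewrite fy gy.
exists (K `|` L); first exact: compactU.
by move=> x; case: ifP => _; [move/fK; left|move/gL; right].
Qed.

Lemma Cc_indic (C : set X) (a : A) : hausdorff_space X -> compact_open C ->
  (fun x => if x \in C then a else 0) \in @Cc_pred X A.
Proof.
move=> hX [cC oC]; apply/CcP; split.
  move=> x; apply: filterS (locally_constant_mem oC (compact_closed hX cC) x).
  by move=> y ->.
by exists C => // x; case: ifP => [/set_mem//|]; rewrite eqxx.
Qed.

End CcBasics.

(* The ultrafilter form of "continuous, surjective and proper". *)
Definition perfect_map (X X' : topologicalType) (p : X -> X') : Prop :=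
  [/\ continuous p, forall x', exists x, p x = x' &
   forall (F : set_system X) (x' : X'), UltraFilter F -> p @ F --> x' ->
     exists2 x, p x = x' & F --> x].

Section PerfectMap.
Variables (X X' : topologicalType) (p : X -> X').

(** The limit has a compact neighborhood, whose preimage is compact and belongs to the ultrafilter;
    continuity and uniqueness of limits place the limit upstairs in the right fibre. *)
Lemma proper_perfect : hausdorff_space X' -> locally_compact [set: X'] ->
  continuous p -> (forall x', exists x, p x = x') -> proper_map p ->
  perfect_map p.
Proof.
move=> hX' lX' cp sp pp; split=> // F x' UF Fx'.
have [C x'C [cC _]] := lX' x' I.
have /compact_ultraP/(_ F UF)[|x _ Fx] := pp C cC.
  by apply: Fx'; move: x'C; rewrite withinET.
exists x => //; have UpF := fmap_ultra p UF.
apply: (hausdorff_cvg_unique hX' _ _ Fx').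
by apply: cvg_trans (cp x); exact: cvg_app.
Qed.

Hypothesis pp : perfect_map p.

Lemma perfect_continuous : continuous p. Proof. by case: pp. Qed.

Lemma perfect_compact (K : set X') : compact K -> compact (p @^-1` K).
Proof.
case: pp => cp sp up /compact_ultraP cK; apply/compact_ultraP => F UF FK.
have [x' Kx' Fx'] := cK _ (fmap_ultra p UF) FK.
by have [x px Fx] := up F x' UF Fx'; exists x; rewrite //= px.
Qed.

(** Upper semicontinuity of the fibres, that is, closedness of [p]. *)
Lemma perfect_fibre_near (x' : X') (W : set X) :
  (forall x, p x = x' -> nbhs x W) -> \forall y' \near x', fibre p y' `<=` W.
Proof.
case: pp => cp sp up xW; apply: filter_ultraP => G UG xG.
apply: contrapT => /(ultraN UG) nG.
(* A section that avoids [W] whenever the fibre is not contained in [W]; along a bad ultrafilter it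
   would converge to a point of the fibre of [x'], where [W] is a neighborhood. *)
have /choice[s sP] : forall y', exists y, p y = y' /\ (~ fibre p y' `<=` W -> ~ W y).
  move=> y'; have [yW|nyW] := pselect (fibre p y' `<=` W).
    by have [y py] := sp y'; exists y.
  by have /existsNP[y /not_implyP[py nWy]] := nyW; exists y.
have sK y' : p (s y') = y' := (sP y').1.
have Us := fmap_ultra s UG.
have [|x px sx] := up (s @ G) x' Us.
  rewrite -fmap_comp; apply: cvg_trans xG => S GS; rewrite /= /nbhs/=.
  by apply: filterS GS => y' /=; rewrite sK.
have GW : G (s @^-1` W) := sx _ (xW x px).
have [y' [nyW Wy]] := filter_ex (filterI nG GW).
exact: (sP y').2 nyW Wy.
Qed.

Variable A : zmodType.

Lemma perfect_pullback (g : Cc X' A) : (g \o p) \in @Cc_pred X A.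
Proof.
have [K cK gK] := Cc_supp g; apply/CcP; split.
  exact: locally_constant_comp perfect_continuous (Cc_locally_constant g).
by exists (p @^-1` K) => [|x /gK//]; exact: perfect_compact.
Qed.

Lemma perfect_descend (f : Cc X A) :
  (forall x y, p x = p y -> f x = f y) -> f \in @pullback_sub X X' p A.
Proof.
case: (pp) => cp sp _ fp; apply/asboolP.
have /choice[s sK] := sp.
pose g x' := f (s x').
have gp x : g (p x) = f x by apply: fp; rewrite sK.
have gC : g \in @Cc_pred X' A.
  have [K cK fK] := Cc_supp f; apply/CcP; split.
    move=> x'.
    have : \forall y' \near x', fibre p y' `<=` [set y | f y = g x'].
      apply: perfect_fibre_near => x px.
      by apply: filterS (Cc_locally_constant f x) => y /= ->; rewrite -px gp.
    by apply: filterS => y'; apply; exact: sK.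
  exists (p @` K).
    by apply: continuous_compact cK; exact: continuous_subspaceT.
  by move=> x' gx'; exists (s x') => //; exact: fK.
exists (to_Cc g); rewrite to_CcE//; apply/funext => x /=.
by rewrite gp.
Qed.

Lemma pullback_subP (f : Cc X A) : f \in @pullback_sub X X' p A <->
  forall x y, p x = p y -> f x = f y.
Proof.
split=> [/asboolP[g fg] x y pxy|]; last exact: perfect_descend.
by rewrite fg/= pxy.
Qed.

Lemma perfect_pullback_defined : pullback_defined p A.
Proof. by move=> f; rewrite /pullback to_CcE//; exact: perfect_pullback. Qed.

End PerfectMap.

Section CompactOpenBasis.
Variables (Y Z : topologicalType) (i : Y -> Z).
Hypotheses (i_inj : injective i) (i_cont : continuous i).
Hypotheses (hZ : hausdorff_space Z) (bZ : compact_open_basis Z).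

Lemma inj_hausdorff : hausdorff_space Y.
Proof.
move=> x y xy; apply: i_inj; apply: hZ => U V xU yV.
have [z [Uz Vz]] := xy _ _ (i_cont xU) (i_cont yV).
by exists (i z).
Qed.

(** On a compact set, [Y] and [Z] induce the same topology: the image of the part of [C] outside the
    interior of [U] is compact, hence closed, and misses [i y]. *)
Lemma compact_nbhs_trace (C : set Y) (y : Y) (U : set Y) :
  compact C -> nbhs y U ->
  exists D, [/\ compact_open D, D (i y) & forall z, C z -> D (i z) -> U z].
Proof.
move=> cC yU; pose K := i @` (C `&` ~` U°).
have cK : compact K.
  apply: continuous_compact; first exact: continuous_subspaceT.
  apply: compact_closedI => //; apply: open_closedC; exact: open_interior.
have [|D [coD Dy DK]] := @bZ (i y) (~` K).
  apply: open_nbhs_nbhs; split.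
    by apply: closed_openC; exact: compact_closed.
  by move=> [z [_ nUz] /i_inj zy]; apply: nUz; rewrite zy; exact: yU.
exists D; split=> // z Cz Dz; apply: contrapT => nUz.
by apply: (DK _ Dz); exists z => //; split=> // /interior_subset.
Qed.

Lemma inj_compact_open_basis :
  (forall y, exists2 C : set Y, compact_open C & C y) -> compact_open_basis Y.
Proof.
move=> loc y U yU; have [C [cC oC] Cy] := loc y.
have [D [[cD oD] Dy DU]] := compact_nbhs_trace cC yU.
exists (C `&` i @^-1` D); split=> //; last by move=> z [Cz /(DU _ Cz)].
have ciD : closed (i @^-1` D).
  by move/continuous_closedP: i_cont; apply; exact: compact_closed.
have oiD : open (i @^-1` D) by move/continuousP: i_cont; apply.
by split; [exact: compact_closedI|exact: openI].
Qed.

(** This turns compact open sets of the finer space into compact open sets of the coarser one, at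
    the price of control over a compact set [V] only. With [j] for [i] it provides cutoffs on [X']
    for conditions stated on [Y']. *)
Lemma compact_open_trace (V D : set Y) :
  compact V -> open D -> compact D ->
  exists2 L, compact_open L & forall z, V z -> (L (i z) <-> D z).
Proof.
move=> cV oD cD.
suff [L coL [DL LD]] : exists2 L, compact_open L &
    D `<=` i @^-1` L /\ forall z, V z -> L (i z) -> D z.
  by exists L => // z Vz; split; [exact: LD|move=> Dz; exact: DL].
apply: (compact_ind (P := fun S => exists2 L, compact_open L &
    S `<=` i @^-1` L /\ forall z, V z -> L (i z) -> D z) cD).
- by exists set0; split=> //; [exact: compact0|exact: open0].
- by move=> A B AB [L coL [BL LD]]; exists L => //; split=> // x /AB /BL.
- move=> A B [L [cL oL] [AL LD]] [M [cM oM] [BM MD]].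
  exists (L `|` M); first by split; [exact: compactU|exact: openU].
  split; first by move=> x [/AL|/BM]; [left|right].
  by move=> z Vz [/(LD _ Vz)|/(MD _ Vz)].
- move=> x Dx; have [|L [coL Lx LD]] := @compact_nbhs_trace V x D cV.
    exact: open_nbhs_nbhs.
  exists (i @^-1` L); last by exists L; [|split].
  by apply: i_cont; apply: open_nbhs_nbhs; split=> //; case: coL.
Qed.

End CompactOpenBasis.

(** * Reductions in topological terms *)

(* A topological form of regularity: along an ultrafilter converging to [x'],
   the fibres either converge to the fibre of [x'] in the Vietoris topology, or
   shrink to a point. *)
Definition ultra_regular (X X' : topologicalType) (p : X -> X') : Prop :=
  forall (F : set_system X') (x' : X'), UltraFilter F -> F --> x' ->
    (forall x V, p x = x' -> nbhs x V -> F (p @` V)) \/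
    (exists2 a, p a = x' & forall V, nbhs a V -> F [set y' | fibre p y' `<=` V]).

(* The spaces [X_p] and [X'_p] up to homeomorphism: [i] and [j] are the
   inclusions, and convergence in [Y'] is Vietoris convergence of fibres
   ([p @` V] is the set of the points whose fibre meets [V]). *)
Record reduction_model (X X' Y Y' : topologicalType) (p : X -> X')
    (i : Y -> X) (j : Y' -> X') (q : Y -> Y') : Prop := ReductionModel {
  model_inj : injective i;
  model_inj' : injective j;
  model_comm : forall y, p (i y) = j (q y);
  model_multi : forall x', multi' p x' <-> exists y', j y' = x';
  model_lift : forall x y', p x = j y' -> exists2 y, i y = x & q y = y';
  model_cvg : forall (F : set_system Y) (y : Y), Filter F ->
    F --> y <-> i @ F --> i y /\ q @ F --> q y;
  model_cvg' : forall (F : set_system Y') (y' : Y'), Filter F ->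
    F --> y' <->
    forall x V, p x = j y' -> nbhs x V -> F (j @^-1` (p @` V))
}.

Section Model.
Variables (X X' Y Y' : topologicalType) (p : X -> X').
Variables (i : Y -> X) (j : Y' -> X') (q : Y -> Y').
Hypothesis M : reduction_model p i j q.
Hypothesis pp : perfect_map p.

Lemma model_continuous : continuous i.
Proof. by move=> y; have [] := (model_cvg M y (nbhs_filter y)).1 (@cvg_id _ (nbhs y)). Qed.

Lemma model_q_continuous : continuous q.
Proof. by move=> y; have [] := (model_cvg M y (nbhs_filter y)).1 (@cvg_id _ (nbhs y)). Qed.

Lemma model_near (y' : Y') (x : X) (V : set X) : p x = j y' -> nbhs x V ->
  nbhs y' (j @^-1` (p @` V)).
Proof. exact: (model_cvg' M y' (nbhs_filter y')).1 (@cvg_id _ (nbhs y')) x V. Qed.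

Lemma model_cvgW' (F : set_system Y') (y' : Y') : Filter F ->
  F --> y' -> j @ F --> j y'.
Proof.
move=> FF /(model_cvg' M) Fy U y'U.
have [cp sp _] := pp; have [x px] := sp (j y').
have /Fy : nbhs x (p @^-1` U) by apply: cp; rewrite px.
by move=> /(_ px); apply: filterS => z' [x0 /= Ux0 <-].
Qed.

Lemma model_continuous' : continuous j.
Proof. by move=> y'; exact: model_cvgW'. Qed.

(** Limits are found in [X], where [p] is perfect; they lie over a point of [Y'], hence come from
    [Y]. *)
Lemma model_perfect : perfect_map q.
Proof.
have [cp sp up] := pp; split; first exact: model_q_continuous.
  by move=> y'; have [x /(model_lift M)[y _ qy]] := sp (j y'); exists y.
move=> F y' UF qF; have Ui := fmap_ultra i UF.
have [|x pxy iF] := up (i @ F) (j y') Ui.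
  have e : p \o i = j \o q by apply/funext => y /=; exact: (model_comm M).
  by change ((p \o i) @ F --> j y'); rewrite e; exact: model_cvgW' qF.
have [y iy qy] := model_lift M pxy; exists y => //.
by apply/(model_cvg M); rewrite iy qy.
Qed.

Section Varies.
Variables (B : Type).

Definition varies (f : X -> B) : set Y' := [set y' | exists x1 x2,
  [/\ p x1 = j y', p x2 = j y' & f x1 <> f x2]].

Lemma variesN (f : X -> B) y z : ~ varies f (q y) -> q y = q z ->
  f (i y) = f (i z).
Proof.
move=> nv qyz; apply: contrapT => fyz; apply: nv; exists (i y), (i z).
by split=> //; rewrite (model_comm M)// qyz.
Qed.

Hypothesis pr : ultra_regular p.

(** Openness: two points of a fibre with different values persist in nearby fibres. Compactness: an
    ultrafilter of such points has a limit in the image of [K], over which [f] still varies by upper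
    semicontinuity. As [f] is constant near each point, the fibres cannot shrink to a point, and
    regularity leaves only convergence in [Y']. *)
Lemma compact_open_varies (f : X -> B) (b0 : B) (K : set X) :
  locally_constant f -> compact K -> (forall x, f x <> b0 -> K x) ->
  compact_open (varies f).
Proof.
move=> cf cK fK; have [cp sp up] := pp; split; last first.
  rewrite openE => y' [x1 [x2 [px1 px2 f12]]]; rewrite /interior/=.
  have V1 := model_near px1 (cf x1); have V2 := model_near px2 (cf x2).
  apply: filterS2 V1 V2 => z' [u1 /= fu1 pu1] [u2 /= fu2 pu2].
  by exists u1, u2; split=> //; rewrite fu1 fu2.
apply/compact_ultraP => F UF FN; have UjF := fmap_ultra j UF.
(* On [F]-almost every fibre [f] takes two values, so these fibres cannot lie in a set where [f] is
   constant. *)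
have nconst c W : locally_constant f -> F [set y' | fibre p (j y') `<=` W] ->
    W `<=` [set x | f x = c] -> False.
  move=> _ FW Wc; have [y' [[x1 [x2 [px1 px2 f12]]] /= fW]] := filter_ex (filterI FN FW).
  by apply: f12; rewrite (Wc _ (fW _ px1)) (Wc _ (fW _ px2)).
have [||x' _ Fx'] := (compact_ultraP (p @` K)).1 _ (j @ F) UjF.
- by apply: continuous_compact cK; exact: continuous_subspaceT.
- change (F (j @^-1` (p @` K))); apply: filterS FN => y' [x1 [x2 [px1 px2 f12]]] /=.
  (* At most one of the two values is [b0], so one of the two points lies in [K]. *)
  have [e|e] := pselect (f x1 = b0).
    by exists x2 => //; apply: fK; rewrite -e; exact: nesym.
  by exists x1 => //; exact: fK.
have [x1 [x2 [px1 px2 f12]]] : exists x1 x2, [/\ p x1 = x', p x2 = x' & f x1 <> f x2].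
  apply: contrapT => nf; have [x0 px0] := sp x'.
  apply: (nconst (f x0) [set x | f x = f x0] cf) => //.
  apply: (Fx' [set y' | fibre p y' `<=` [set x | f x = f x0]]).
  apply: perfect_fibre_near => // x px.
  have -> : f x0 = f x.
    by apply: contrapT => f0x; apply: nf; exists x0, x.
  exact: cf.
have [y' jy'] : exists y', j y' = x'.
  by apply/(model_multi M); exists x1, x2; split=> // x12; rewrite x12 in f12.
exists y'; first by exists x1, x2; rewrite jy'.
apply/(model_cvg' M); rewrite jy'.
have [//|[a pa Fa]] := pr UjF Fx'.
by have := nconst (f a) _ cf (Fa _ (cf a)) (@subset_refl _ _).
Qed.

End Varies.

Hypotheses (hX : hausdorff_space X) (hX' : hausdorff_space X').
Hypotheses (bX : compact_open_basis X) (bX' : compact_open_basis X').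
Hypothesis pr : ultra_regular p.

Lemma model_hausdorff : hausdorff_space Y.
Proof. exact: inj_hausdorff (model_inj M) model_continuous hX. Qed.

Lemma model_hausdorff' : hausdorff_space Y'.
Proof. exact: inj_hausdorff (model_inj' M) model_continuous' hX'. Qed.

(** Only one compact open set around each point is missing: take two points of its fibre and the set
    where the indicator of a compact open set separating them varies. *)
Lemma model_basis' : compact_open_basis Y'.
Proof.
apply: (inj_compact_open_basis (model_inj' M) model_continuous' hX' bX').
move=> y'; have [x1 [x2 [px1 px2 x12]]] : multi' p (j y').
  by apply/(model_multi M); exists y'.
have [|C [[cC oC] Cx1 Cx2]] := @bX x1 (~` [set x2]).
  apply: open_nbhs_nbhs; split; last exact: x12.
  by apply: closed_openC; apply: accessible_closed_set1; exact: hausdorff_accessible.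
exists (varies (fun x => x \in C)).
  apply: (compact_open_varies pr (b0 := false) _ cC).
    by apply: locally_constant_mem => //; exact: compact_closed.
  by move=> x; case E : (x \in C) => // _; exact: set_mem.
exists x1, x2; split=> //; rewrite mem_set//.
by move=> /esym /set_mem /Cx2; apply.
Qed.

Lemma model_basis : compact_open_basis Y.
Proof.
apply: (inj_compact_open_basis (model_inj M) model_continuous hX bX).
move=> y; have [C [[cC oC] Cy _]] := model_basis' (@filterT _ (nbhs (q y)) _).
exists (q @^-1` C) => //; split; first exact: perfect_compact model_perfect _ cC.
by move/continuousP: model_q_continuous; apply.
Qed.

End Model.

(** * Existence of reductions, and uniqueness modulo functions constant on fibres *)

Section ReductionRelation.
Variables (X X' Y Y' : topologicalType) (p : X -> X').
Variables (i : Y -> X) (j : Y' -> X') (q : Y -> Y').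
Hypothesis M : reduction_model p i j q.
Hypothesis pp : perfect_map p.
Hypotheses (hX : hausdorff_space X) (hX' : hausdorff_space X').
Hypotheses (bX : compact_open_basis X) (bX' : compact_open_basis X').
Hypothesis pr : ultra_regular p.
Variable A : zmodType.

(* [g] represents the reduction of [f]: this characterizes the values of
   [reduction] without mentioning the sets [K'] that define it. *)
Definition reduces (f : X -> A) (g : Y -> A) : Prop :=
  forall y z, q y = q z -> f (i y) - g y = f (i z) - g z.

Lemma reducesB (f f' : Cc X A) (g g' : Cc Y A) :
  reduces f g -> reduces f' g' -> reduces (f - f') (g - g').
Proof.
move=> fg fg' y z yz; rewrite !CcBE.
have E (a b c d : A) : a - c - (b - d) = a - b - (c - d).
  by rewrite !opprD addrACA.
by rewrite [LHS]E [RHS]E (fg y z yz) (fg' y z yz).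
Qed.

Lemma reduces_descend (f : X -> A) (g g' : Cc Y A) :
  reduces f g -> reduces f g' -> g - g' \in @pullback_sub Y Y' q A.
Proof.
move=> fg fg'; apply/(pullback_subP (model_perfect M pp)) => y z yz.
have gB (x : Y) : (g - g') x = (f (i x) - g' x) - (f (i x) - g x).
  by rewrite CcBE opprB [RHS]addrC addrA subrK.
by rewrite !gB (fg y z yz) (fg' y z yz).
Qed.

(** Two distinct points in one fibre of [p] both come from [Y], where constancy on fibres is
    assumed. *)
Lemma reduces0 (f : Cc X A) : reduces f (0 : Cc Y A) ->
  f \in @pullback_sub X X' p A.
Proof.
move=> f0; apply/(pullback_subP pp) => x x2 pxx.
have [->//|xx2] := pselect (x = x2).
have [y' jy'] : exists y', j y' = p x.
  by apply/(model_multi M); exists x, x2.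
have [y yx qy] := model_lift M (esym jy').
have [z zx qz] := model_lift M (etrans (esym pxx) (esym jy')).
have := f0 y z; rewrite qy qz => /(_ erefl).
by rewrite Cc0E !subr0 yx zx.
Qed.

Lemma compact_open_varies_Cc (f : Cc X A) : compact_open (varies p j f).
Proof.
have [K cK fK] := Cc_supp f.
apply: (compact_open_varies M pp pr (b0 := 0) (Cc_locally_constant f) cK).
by move=> x /eqP; exact: fK.
Qed.

Lemma Cc_cutoff (f : Cc X A) (K : set Y') : compact_open K ->
  (fun y => if q y \in K then f (i y) else 0) \in @Cc_pred Y A.
Proof.
move=> [cK oK]; have clK := compact_closed (model_hausdorff' M pp hX') cK.
apply/CcP; split.
  move=> y; have cm := locally_constant_mem oK clK.
  have qy := locally_constant_comp (model_q_continuous M) cm y.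
  have fy := locally_constant_comp (model_continuous M) (Cc_locally_constant f) y.
  by apply: filterS2 qy fy => z /= -> ->.
exists (q @^-1` K); first exact: perfect_compact (model_perfect M pp) _ cK.
by move=> y; case: ifP => [/set_mem//|]; rewrite eqxx.
Qed.

Lemma reduces_cutoff (f : Cc X A) (K : set Y') : varies p j f `<=` K ->
  reduces f (fun y => if q y \in K then f (i y) else 0).
Proof.
move=> fK y z yz; rewrite -yz; case: ifPn => [_|/negP qK]; first by rewrite !subrr.
rewrite !subr0; apply: (variesN M) yz => /fK Ky.
by apply: qK; exact: mem_set.
Qed.

Section Surjectivity.
Variable g : Cc Y A.

(** Near each point of the compact fibre a constant on a compact open set does; finitely many of
    these are glued. *)
Lemma extend_fibre (y' : Y') :
  exists f : Cc X A, forall z, q z = y' -> f (i z) = g z.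
Proof.
have cF : compact (p @^-1` [set j y']).
  by apply: perfect_compact => //; exact: compact_set1.
suff [C [f coC [FC fC]]] : exists C, exists2 f : Cc X A, compact_open C &
    p @^-1` [set j y'] `<=` C /\
    forall z, q z = y' -> C (i z) -> f (i z) = g z.
  exists f => z qz; apply: fC => //; apply: FC.
  by rewrite /= (model_comm M) qz.
apply: (compact_ind (P := fun S => exists C, exists2 f : Cc X A,
    compact_open C & S `<=` C /\
    forall z, q z = y' -> C (i z) -> f (i z) = g z) cF).
- exists set0, 0; last by split.
  by split; [exact: compact0|exact: open0].
- move=> S S' SS' [C [f coC [S'C fC]]]; exists C, f => //.
  by split=> // x /SS' /S'C.
- move=> S S' [C [f [cC oC] [SC fC]]] [C' [f' [cC' oC'] [SC' fC']]].
  exists (C `|` C'), (to_Cc (fun x => if x \in C then f x else f' x)).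
    by split; [exact: compactU|exact: openU].
  split=> [x [/SC|/SC']|z qz CCz]; [by left|by right|].
  rewrite to_CcE; last by apply: Cc_if => //; exact: compact_closed.
  case: ifPn => [/set_mem Cz|/negP nCz]; first exact: fC.
  by case: CCz => [/mem_set//|Cz]; exact: fC'.
- move=> x /= px; have [y iy qy] := model_lift M px.
  (* The neighborhoods of [x] traced on the fibre of [y']. Along [F] the map [q] is constant, so
     convergence in [X] is enough for convergence in [Y]: within one fibre the two topologies
     agree. *)
  pose F : set_system Y := [set S | exists2 U, nbhs x U &
    forall z, q z = y' -> U (i z) -> S z].
  have FF : Filter F.
    split; first by exists setT => //; exact: filterT.
      move=> S S' [U xU US] [U' xU' US']; exists (U `&` U'); first exact: filterI.
      by move=> z qz [Uz U'z]; split; [exact: US|exact: US'].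
    by move=> S S' SS' [U xU US]; exists U => // z qz /(US _ qz)/SS'.
  have Fy : F --> y.
    apply/(model_cvg M); split; rewrite ?iy ?qy => U xU; first by exists U.
    exists setT; first exact: filterT.
    by move=> z /= -> _; exact: nbhs_singleton.
  have [U xU Ug] := Fy _ (Cc_locally_constant g y).
  have [C [[cC oC] Cx CU]] := bX xU.
  exists C; first exact: open_nbhs_nbhs.
  exists C, (to_Cc (fun x => if x \in C then g y else 0)) => //.
  split=> // z qz Cz; rewrite to_CcE; last exact: Cc_indic.
  by rewrite mem_set// Ug//; exact: CU.
Qed.

Lemma extend_near_fibre (y' : Y') : (exists y z, [/\ q y = y', q z = y' & g y <> g z]) ->
  exists f : Cc X A, varies p j f y' /\
    forall z, varies p j f (q z) -> f (i z) = g z.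
Proof.
move=> [y [z [qy qz gyz]]]; have [f fg] := extend_fibre y'.
have fy : varies p j f y'.
  by exists (i y), (i z); rewrite !(model_comm M) qy qz !fg.
have near_fg : \forall z' \near y', fibre q z' `<=` [set z | f (i z) = g z].
  apply: perfect_fibre_near => [|z0 qz0]; first exact: model_perfect M pp.
  have f0 := locally_constant_comp (model_continuous M) (Cc_locally_constant f) z0.
  apply: filterS2 f0 (Cc_locally_constant g z0) => z1 /= -> ->.
  exact: fg.
have [cV oV] := compact_open_varies_Cc f.
(* The neighborhood on which [f] and [g] agree is open in the topology of [Y'] only. On the compact
   set where [f] varies it contains the trace of a compact open set of [X'], by which [f] can be cut
   off. *)
have [L [[cL oL] Ly LV]] := compact_nbhs_trace (model_inj' M)
  (model_continuous' M pp) hX' bX' cV near_fg.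
have clL : closed (p @^-1` L).
  have /continuous_closedP := perfect_continuous pp; apply.
  exact: compact_closed.
have opL : open (p @^-1` L).
  by have /continuousP := perfect_continuous pp; apply.
pose f1 := to_Cc (fun x => if x \in p @^-1` L then f x else (0 : Cc X A) x).
have f1E x : f1 x = if x \in p @^-1` L then f x else 0.
  by rewrite to_CcE; [rewrite Cc0E|exact: Cc_if].
exists f1; split.
  case: fy => x1 [x2 [px1 px2 f12]]; exists x1, x2; split=> //.
  by rewrite !f1E !mem_set//= ?px1 ?px2.
have memL x z0 : p x = j (q z0) -> (x \in p @^-1` L) = (j (q z0) \in L).
  by move=> e; rewrite -e; apply/idP/idP => /set_mem Lx; exact: mem_set.
move=> z0 [x1 [x2 [px1 px2]]]; rewrite !f1E.
rewrite (memL x1 z0)// (memL x2 z0)// (memL (i z0) z0) ?(model_comm M)//.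
case: ifPn => [/set_mem Lz f12|_]; last by [].
by apply: (LV (q z0)) => //; exists x1, x2.
Qed.

Lemma reduces_surj : exists f : Cc X A, reduces f g.
Proof.
have hY' := model_hausdorff' M pp hX'.
have bY' := model_basis' M pp hX hX' bX bX' pr.
have pq := model_perfect M pp.
have [K cK gK] := Cc_supp g.
(* Over [C] the function [f] reduces to [g]; off [C] it is constant on fibres, which is what allows
   local solutions to be added. *)
pose P (S : set Y') := exists C (f : Cc X A), [/\ open C, closed C, S `<=` C &
  forall y z, q y = q z -> (C (q y) -> f (i y) - g y = f (i z) - g z) /\
    (~ C (q y) -> f (i y) = f (i z))].
have : P (q @` K).
  apply: compact_ind.
  - apply: continuous_compact cK; apply: continuous_subspaceT.
    exact: model_q_continuous M.
  - exists set0, 0; split; [exact: open0|exact: closed0|by []|].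
    by move=> y z _; rewrite Cc0E.
  - move=> S S' SS' [C [f [oC cC S'C fC]]]; exists C, f; split=> //.
    by move=> x /SS' /S'C.
  - move=> S S' [C [f [oC cC SC fC]]] [C' [f' [oC' cC' SC' fC']]].
    have [cV oV] := compact_open_varies_Cc f'.
    (* On the set where [f'] varies, [L] is the complement of [C]. So [f'] cut off by [L] is
       constant on the fibres over [C], where it does not disturb [f], and off [C] it differs from
       [f'] by a function constant on fibres. *)
    have [||L [cL oL] LV] := @compact_open_trace _ _ j (model_inj' M)
      (model_continuous' M pp) hX' bX' (varies p j f') (varies p j f' `&` ~` C) cV.
    + by apply: openI => //; exact: closed_openC.
    + by apply: compact_closedI => //; exact: open_closedC.
    have clL : closed (p @^-1` L).
      have /continuous_closedP := perfect_continuous pp; apply.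
      exact: compact_closed.
    have opL : open (p @^-1` L).
      by have /continuousP := perfect_continuous pp; apply.
    pose f'' := to_Cc (fun x => if x \in p @^-1` L then f' x else (0 : Cc X A) x).
    have f''E x : f'' x = if x \in p @^-1` L then f' x else 0.
      by rewrite to_CcE; [rewrite Cc0E|exact: Cc_if].
    have memL x : (x \in p @^-1` L) = (p x \in L).
      by apply/idP/idP => /set_mem Lx; exact: mem_set.
    have f''c y z : q y = q z -> ~ varies p j f' (q y) -> f'' (i y) = f'' (i z).
      move=> yz nv; rewrite !f''E !memL !(model_comm M) -yz.
      by rewrite (variesN M nv yz).
    have f''1 y : varies p j f' (q y) -> ~ C (q y) -> f'' (i y) = f' (i y).
      move=> v nC; rewrite f''E mem_set//= (model_comm M).
      by apply/LV.
    have f''0 y : varies p j f' (q y) -> C (q y) -> f'' (i y) = 0.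
      move=> v Cy; rewrite f''E; case: ifPn => // /set_mem/=.
      by rewrite (model_comm M) => /(LV _ v)[].
    exists (C `|` C'), (f + f''); split; [exact: openU|exact: closedU| |].
      by move=> x [/SC|/SC']; [left|right].
    move=> y z yz; have [fC1 fC2] := fC y z yz; have [fC'1 fC'2] := fC' y z yz.
    have f''C : C (q y) -> f'' (i y) = f'' (i z).
      move=> Cy; have [v|nv] := pselect (varies p j f' (q y)); last exact: f''c.
      by rewrite !f''0// -yz.
    rewrite !CcDE; split=> [CC'|/not_orP[nC nC']].
      have [Cy|nC] := pselect (C (q y)).
        by rewrite -(f''C Cy) [LHS]addrAC [RHS]addrAC fC1.
      have C'y : C' (q y) by case: CC'.
      rewrite (fC2 nC) -!addrA; congr (_ + _).
      have [v|nv] := pselect (varies p j f' (q y)).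
        by rewrite !f''1 -?yz//; exact: fC'1.
      rewrite (f''c _ _ yz nv).
      have := fC'1 C'y; rewrite (variesN M nv yz).
      by move/addrI => ->.
    rewrite fC2//; have [v|nv] := pselect (varies p j f' (q y)); last by rewrite (f''c y z).
    by rewrite !f''1 -?yz// fC'2.
  - move=> y' _.
    have [gv|ngv] := pselect (exists y z, [/\ q y = y', q z = y' & g y <> g z]).
      have [f [fy fg]] := extend_near_fibre gv.
      have [cV oV] := compact_open_varies_Cc f.
      exists (varies p j f); first exact: open_nbhs_nbhs.
      exists (varies p j f), f; split=> //; first exact: compact_closed.
      move=> y z yz; split=> [v|nv]; last exact: (variesN M).
      by rewrite !fg ?subrr// -yz.
    have : \forall z' \near y', forall y z, q y = z' -> q z = z' -> g y = g z.
      have [_ sq _] := pq; have [y0 qy0] := sq y'.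
      have : \forall z' \near y', fibre q z' `<=` [set z | g z = g y0].
        apply: perfect_fibre_near => // z qz.
        have <- : g z = g y0.
          by apply: contrapT => gz; apply: ngv; exists z, y0.
        exact: Cc_locally_constant.
      by apply: filterS => z' zg y z /zg/= -> /zg/= ->.
    move=> /bY'[C [[cC oC] Cy CN]].
    exists C; first exact: open_nbhs_nbhs.
    exists C, 0; split=> //; first exact: compact_closed.
    move=> y z yz; split=> [/CN gc|_]; last by rewrite Cc0E.
    by rewrite (gc y z) ?Cc0E.
move=> [C [f [oC cC KC fC]]]; exists f => y z yz.
have [fC1 fC2] := fC y z yz.
have [/fC1//|nC] := pselect (C (q y)).
(* [C] contains the image of the support of [g], so off [C] there is nothing to represent. *)
have g0 x : q x = q y -> g x = 0.
  move=> xy; apply: contrapT => /eqP /gK Kx; apply: nC; apply: KC.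
  by exists x.
by rewrite fC2// !g0.
Qed.

End Surjectivity.

End ReductionRelation.

(** * Direct images along local homeomorphisms *)

Section Push.
Variables (Y : choiceType) (A : zmodType).
Implicit Types f g : Y -> A.

(** The sum may be taken over any set between the support within the fibre and the fibre itself, in
    particular over a finite one. *)
Lemma push_widen (X : Type) (phi : Y -> X) f x (D : set Y) :
  (forall y, D y -> phi y = x) ->
  (forall y, phi y = x -> f y != 0 -> D y) ->
  push phi f x = \sum_(y \in D) f y.
Proof.
move=> Dx fD; rewrite /push; apply/esym/fsbig_widen; first by move=> y /Dx.
move=> y [/= px nDy]; apply: contrapT => /eqP fy; apply: nDy; exact: fD.
Qed.

Lemma push1 (X : Type) (phi : Y -> X) f y :
  (forall z, phi z = phi y -> f z != 0 -> z = y) -> push phi f (phi y) = f y.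
Proof.
move=> fy; rewrite (@push_widen _ _ _ _ [set y]) ?fsbig_set1//.
by move=> z ->.
Qed.

Lemma push0 (X : Type) (phi : Y -> X) f x :
  (forall z, phi z = x -> f z = 0) -> push phi f x = 0.
Proof. by move=> f0; rewrite /push fsbig1. Qed.

(** Finiteness excludes the default value 0 that a sum with infinite support takes. *)
Lemma pushB (X : Type) (phi : Y -> X) f g x :
  finite_set [set y | phi y = x /\ f y != 0] ->
  finite_set [set y | phi y = x /\ g y != 0] ->
  push phi (fun y => f y - g y) x = push phi f x - push phi g x.
Proof.
move=> ff fg; pose D := [set y | phi y = x /\ f y != 0] `|` [set y | phi y = x /\ g y != 0].
have fD : finite_set D by rewrite finite_setU.
have Dx y : D y -> phi y = x by move=> [[]|[]].
rewrite !(@push_widen _ _ _ _ D)//.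
- rewrite !fsbig_finite//= -sumrB; exact: eq_bigr.
- by move=> y yx gy; right.
- by move=> y yx fy; left.
move=> y yx fgy; have [f0|f0] := eqVneq (f y) 0; last by left.
by right; split=> //; apply: contra_neq fgy => ->; rewrite f0 subr0.
Qed.

End Push.

Lemma push_comp (Y X Z : choiceType) (A : zmodType) (phi : Y -> X) (psi : X -> Z)
    (f : Y -> A) z :
  finite_set [set y | psi (phi y) = z /\ f y != 0] ->
  push psi (push phi f) z = push (psi \o phi) f z.
Proof.
set D := [set y | _] => fD.
have fE : finite_set (phi @` D) by exact: finite_image.
rewrite [RHS](@push_widen _ _ _ _ _ _ D)//; last by move=> y [].
rewrite (@push_widen _ _ _ _ _ _ (phi @` D)); last 2 first.
- by move=> _ [y [yz _] <-].
- move=> x xz; apply: contra_neqP => nDx; apply: push0 => y yx.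
  by apply: contrapT => /eqP fy; apply: nDx; exists y; rewrite // /D/= yx.
transitivity (\sum_(x \in phi @` D) \sum_(y \in D) (if phi y == x then f y else 0)).
  apply: eq_fsbigr => x /set_mem Ex.
  rewrite (@push_widen _ _ _ _ _ _ [set y | D y /\ phi y = x]); last 2 first.
  - by move=> y [].
  - move=> y yx fy; split=> //; split=> //; rewrite yx.
    by case: Ex => y' [<- _] <-.
  rewrite -(fsbig_widen [set y | D y /\ phi y = x] D); last 2 first.
  - by move=> y [].
  - by move=> y [/= Dy nxy]; case: eqP => // yx; case: nxy.
  by apply: eq_fsbigr => y /set_mem[_ ->]; rewrite eqxx.
rewrite exchange_fsbig//; apply: eq_fsbigr => y /set_mem Dy.
rewrite -(fsbig_widen [set phi y] (phi @` D)) ?fsbig_set1 ?eqxx//.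
- by move=> x ->; exists y.
- by move=> x [_ /= nxy]; case: eqP => // yx; case: nxy.
Qed.

(* Equivalent to [local_homeomorphism]. *)
Definition etale_map (Y X : topologicalType) (phi : Y -> X) : Prop :=
  [/\ continuous phi,
   forall (y : Y) V, nbhs y V -> nbhs (phi y) (phi @` V) &
   forall y : Y, exists2 U, nbhs y U &
     forall a b, U a -> U b -> phi a = phi b -> a = b].

Lemma etale_map_comp (Y X Z : topologicalType) (phi : Y -> X) (psi : X -> Z) :
  etale_map phi -> etale_map psi -> etale_map (psi \o phi).
Proof.
move=> [cf of_ lf] [cg og lg]; split.
- by move=> y; apply: continuous_comp; [exact: cf|exact: cg].
- by move=> y V /of_ /og; rewrite image_comp.
- move=> y; have [U yU fU] := lf y; have [V yV gV] := lg (phi y).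
  exists (U `&` phi @^-1` V); first by apply: filterI => //; exact: cf.
  by move=> a b [Ua Va] [Ub Vb] /(gV _ _ Va Vb) /(fU _ _ Ua Ub).
Qed.

Section PushCc.
Variables (Y X : topologicalType) (phi : Y -> X) (A : zmodType).
Hypotheses (ephi : etale_map phi) (hY : hausdorff_space Y).
Hypotheses (hX : hausdorff_space X) (bY : compact_open_basis Y).

(** [phi] is a homeomorphism from [C] onto a compact open set, and the direct image is [f]
    transported along it and extended by 0. *)
Lemma push_Cc_local (C : set Y) (f : Cc Y A) : compact_open C ->
  (forall a b, C a -> C b -> phi a = phi b -> a = b) ->
  (forall y, f y != 0 -> C y) ->
  (forall x, finite_set [set y | phi y = x /\ f y != 0]) /\
  push phi f \in @Cc_pred X A.
Proof.
move=> [cC oC] injC fC; have [cphi ophi _] := ephi.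
have pC y : C y -> push phi f (phi y) = f y.
  by move=> Cy; apply: push1 => z zy /fC Cz; exact: injC.
have p0 x : ~ (phi @` C) x -> push phi f x = 0.
  move=> nx; apply: push0 => z zx; apply: contrapT => /eqP/fC Cz.
  by apply: nx; exists z.
have cphiC : compact (phi @` C).
  by apply: continuous_compact => //; exact: continuous_subspaceT.
split.
  move=> x; have [[y Cy yx]|nx] := pselect ((phi @` C) x).
    apply: (sub_finite_set (B := [set y])); last exact: finite_set1.
    by move=> z [zx /fC Cz]; apply: injC => //; rewrite zx.
  apply: (sub_finite_set (B := set0)); last exact: finite_set0.
  by move=> z [zx /fC Cz]; apply: nx; exists z.
apply/CcP; split.
  move=> x; have [[y Cy yx]|nx] := pselect ((phi @` C) x).
    rewrite -yx; have : nbhs y (C `&` [set z | f z = f y]).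
      apply: filterI; first exact: open_nbhs_nbhs.
      exact: Cc_locally_constant.
    by move/ophi; apply: filterS => _ [z [Cz fz] <-]; rewrite !pC.
  have : nbhs x (~` (phi @` C)).
    apply: open_nbhs_nbhs; split=> //; apply: closed_openC.
    exact: compact_closed.
  by apply: filterS => x' nx'; rewrite !p0.
exists (phi @` C) => // x px; apply: contrapT => /p0 p0x.
by rewrite p0x eqxx in px.
Qed.

(** Compact induction on a set containing the support. The claim concerns all functions supported in
    [C], so on a union a function splits into its restriction to [C] and a remainder supported in
    [C']. *)
Lemma push_Cc (f : Cc Y A) :
  (forall x, finite_set [set y | phi y = x /\ f y != 0]) /\
  push phi f \in @Cc_pred X A.
Proof.
have [K cK fK] := Cc_supp f.
suff [C [coC KC CP]] : exists C, [/\ compact_open C, K `<=` C &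
    forall f : Cc Y A, (forall y, f y != 0 -> C y) ->
    (forall x, finite_set [set y | phi y = x /\ f y != 0]) /\
    push phi f \in @Cc_pred X A].
  by apply: CP => y /fK /KC.
move: K cK {f fK} => K cK; apply: (compact_ind (P := fun K => exists C,
    [/\ compact_open C, K `<=` C &
    forall f : Cc Y A, (forall y, f y != 0 -> C y) ->
    (forall x, finite_set [set y | phi y = x /\ f y != 0]) /\
    push phi f \in @Cc_pred X A]) cK).
- exists set0; split=> //.
    by split; [exact: compact0|exact: open0].
  move=> f f0; apply: (@push_Cc_local set0) => //.
  by split; [exact: compact0|exact: open0].
- by move=> S S' SS' [C [coC S'C CP]]; exists C; split=> // x /SS' /S'C.
- move=> S S' [C [[cC oC] SC CP]] [C' [[cC' oC'] SC' CP']].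
  exists (C `|` C'); split.
  + by split; [exact: compactU|exact: openU].
  + by move=> x [/SC|/SC']; [left|right].
  move=> f fCC; have clC := compact_closed hY cC.
  pose f1 := to_Cc (fun y => if y \in C then f y else (0 : Cc Y A) y).
  have f1E y : f1 y = if y \in C then f y else 0.
    by rewrite to_CcE; [rewrite Cc0E|exact: Cc_if].
  clearbody f1; have [|fin1 p1] := CP f1.
    by move=> y; rewrite f1E; case: ifP => [/set_mem//|]; rewrite eqxx.
  have [|fin2 p2] := CP' (f1 - f).
    move=> y; rewrite CcBE f1E; case: ifPn => [_|/negP nC].
      by rewrite subrr eqxx.
    rewrite sub0r oppr_eq0 => /fCC[/mem_set//|//].
  have fE : (f : Y -> A) = fun y => f1 y - (f1 - f) y.
    by apply/funext => y; rewrite CcBE opprB addrC subrK.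
  split=> [x|].
    apply: (sub_finite_set (B := [set y | phi y = x /\ f1 y != 0] `|`
      [set y | phi y = x /\ (f1 - f) y != 0])); last by rewrite finite_setU.
    move=> y [yx fy]; have [f10|] := eqVneq (f1 y) 0; last by left.
    by right; split=> //; rewrite CcBE f10 sub0r oppr_eq0.
  rewrite (_ : push phi f = to_Cc (push phi f1) - to_Cc (push phi (f1 - f))).
    exact: (valP (to_Cc (push phi f1) - to_Cc (push phi (f1 - f)))).
  by apply/funext => x; rewrite CcBE !to_CcE// {1}fE pushB.
- move=> y _; have [_ _ /(_ y)[U yU injU]] := ephi.
  have [C [coC Cy CU]] := bY yU.
  exists C; first by apply: open_nbhs_nbhs; case: coC.
  exists C; split=> // f fC; apply: push_Cc_local coC _ fC.
  by move=> a b /CU Ua /CU Ub; exact: injU.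
Qed.

End PushCc.

(** * Cartesian squares *)

(* A cartesian square: [phi] induces bijections from the fibres of [pY] onto the
   fibres of [pX], equivalently [pY] from the fibres of [phi] onto those of [psi]. *)
Record cartesian (Y X Y' X' : Type) (phi : Y -> X) (psi : Y' -> X')
    (pY : Y -> Y') (pX : X -> X') : Prop := Cartesian {
  cart_comm : forall y, pX (phi y) = psi (pY y);
  cart_lift : forall x y', psi y' = pX x -> exists2 y, phi y = x & pY y = y';
  cart_inj : forall a b, phi a = phi b -> pY a = pY b -> a = b
}.

Lemma cart_multi (Y X Y' X' : topologicalType) (phi : Y -> X) (psi : Y' -> X')
    (pY : Y -> Y') (pX : X -> X') (y' : Y') :
  cartesian phi psi pY pX -> multi' pY y' <-> multi' pX (psi y').
Proof.
move=> C; split=> [[a [b [/= ay by_ ab]]]|[a [b [/= ay by_ ab]]]].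
  exists (phi a), (phi b); rewrite /fibre/= !(cart_comm C) ay by_.
  by split=> // e; apply: ab; apply: (cart_inj C) => //; rewrite ay by_.
have [u ua uy] := cart_lift C (esym ay); have [v vb vy] := cart_lift C (esym by_).
exists u, v; split=> // uv; apply: ab.
by rewrite -ua -vb uv.
Qed.

(** Base change: the fibres of [phi] and [psi] over corresponding points are in bijection. *)
Lemma push_cart (Y X Y' X' : choiceType) (phi : Y -> X) (psi : Y' -> X')
    (pY : Y -> Y') (pX : X -> X') (A : zmodType) (f : Y' -> A) x :
  cartesian phi psi pY pX -> push phi (f \o pY) x = push psi f (pX x).
Proof.
move=> C; rewrite /push; apply/esym/reindex_fsbig; split.
- by move=> y /= <-; rewrite (cart_comm C).
- move=> a b /set_mem/= ax /set_mem/= bx; apply: (cart_inj C).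
  by rewrite ax bx.
- by move=> y' /= /(cart_lift C)[y yx yy']; exists y.
Qed.

Section CartesianTransfer.
Variables (Y X Y' X' : topologicalType) (phi : Y -> X) (psi : Y' -> X').
Variables (pY : Y -> Y') (pX : X -> X').
Hypotheses (C : cartesian phi psi pY pX) (pp : perfect_map pY).
Hypothesis hX : hausdorff_space X.
Hypothesis cphi : continuous phi.

(** The topology of [Y] is induced from [X] and [Y']: an ultrafilter along which [phi] and [pY] tend
    to their values at [b] converges, [pY] being perfect, to a point with the same two images, which
    is [b]. *)
Lemma cart_near (b : Y) (U : set Y) : nbhs b U ->
  exists2 V, nbhs (phi b) V &
    \forall y' \near pY b, forall w, pY w = y' -> V (phi w) -> U w.
Proof.
move=> bU.
pose F : set_system Y := [set S | exists V W, [/\ nbhs (phi b) V, nbhs (pY b) W &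
  forall w, W (pY w) -> V (phi w) -> S w]].
have FF : Filter F.
  split.
  - by exists setT, setT; split=> //; exact: filterT.
  - move=> S S' [V [W [bV bW VW]]] [V' [W' [bV' bW' VW']]].
    exists (V `&` V'), (W `&` W'); split; [exact: filterI|exact: filterI|].
    by move=> w [? ?] [? ?]; split; [exact: VW|exact: VW'].
  - by move=> S S' SS' [V [W [bV bW VW]]]; exists V, W; split=> // w Ww /(VW _ Ww)/SS'.
suff [V [W [bV bW VW]]] : F U.
  by exists V => //; apply: filterS bW => y' Wy' w wy'; apply: VW; rewrite wy'.
apply: filter_ultraP => G UG FG.
have phiG : phi @ G --> phi b.
  move=> V bV; apply: (FG (phi @^-1` V)); exists V, setT; split=> //.
  exact: filterT.
have pG : pY @ G --> pY b.
  move=> W bW; apply: (FG (pY @^-1` W)); exists setT, W; split=> //.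
  exact: filterT.
have [_ _ up] := pp; have [c cb Gc] := up G (pY b) UG pG.
have UphiG := fmap_ultra phi UG.
have phiG' : phi @ G --> phi c by move=> V cV; exact: (Gc _ (cphi cV)).
have cb' : phi c = phi b by exact: (hausdorff_cvg_unique hX _ phiG' phiG).
by apply: Gc; rewrite (cart_inj C cb' cb).
Qed.

Lemma cart_ultra_regular : continuous psi -> ultra_regular pX -> ultra_regular pY.
Proof.
move=> cpsi pr F y' UF Fy'.
have psiF : psi @ F --> psi y' by apply: cvg_trans (cpsi y'); exact: cvg_app.
have [Fx|[a ax Fa]] := pr _ (psi y') (fmap_ultra psi UF) psiF.
  left=> b V bV yV; have [V0 phiV0 near_b] := cart_near yV.
  rewrite bV in near_b; have := Fx (phi b) V0; rewrite (cart_comm C) bV.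
  move=> /(_ erefl phiV0) FV0.
  have := Fy' _ near_b; apply: (@filterS2 _ F) FV0 => u' [x /= V0x xu] uV.
  have [w wx wu] := cart_lift C (esym xu).
  by exists w => //; apply: uV => //; rewrite wx.
right; have [b bx by_] := cart_lift C (esym ax).
exists b => // V /cart_near[V0]; rewrite bx by_ => aV0 near_b.
have := Fy' _ near_b; apply: (@filterS2 _ F) (Fa _ aV0) => u' uV0 uV w wu.
by apply: uV => //; apply: uV0; rewrite /fibre/= (cart_comm C) wu.
Qed.

End CartesianTransfer.

(** * Étale maps and direct images between reductions *)

Section ModelTransfer.
Variables (X1 X1' X2 X2' : topologicalType) (p1 : X1 -> X1') (p2 : X2 -> X2').
Variables (Y1 Y1' Y2 Y2' : topologicalType).
Variables (i1 : Y1 -> X1) (j1 : Y1' -> X1') (q1 : Y1 -> Y1').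
Variables (i2 : Y2 -> X2) (j2 : Y2' -> X2') (q2 : Y2 -> Y2').
Variables (phi : X1 -> X2) (phi' : X1' -> X2') (psi : Y1 -> Y2) (psi' : Y1' -> Y2').
Hypotheses (M1 : reduction_model p1 i1 j1 q1) (M2 : reduction_model p2 i2 j2 q2).
Hypothesis pp1 : perfect_map p1.
Hypothesis C : cartesian phi phi' p1 p2.
Hypotheses (i_psi : forall y, i2 (psi y) = phi (i1 y)).
Hypotheses (j_psi : forall y, j2 (psi' y) = phi' (j1 y)).

Let q_psi y : q2 (psi y) = psi' (q1 y).
Proof.
apply: (model_inj' M2).
by rewrite -(model_comm M2) i_psi (cart_comm C) (model_comm M1) j_psi.
Qed.

(** Corresponding fibres have the same cardinality, so a point that [phi] sends into the reduced
    part was already in the reduced part. *)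
Lemma model_lift_face x y : phi x = i2 y -> exists2 z, i1 z = x & psi z = y.
Proof.
move=> xy.
have : multi' p1 (p1 x).
  apply/(cart_multi _ C); rewrite -(cart_comm C) xy (model_comm M2).
  by apply/(model_multi M2); exists (q2 y).
move=> /(model_multi M1)[y' /esym xy']; have [z zx _] := model_lift M1 xy'.
by exists z => //; apply: (model_inj M2); rewrite i_psi zx.
Qed.

Lemma model_lift_face' x y : phi' x = j2 y -> exists2 z, j1 z = x & psi' z = y.
Proof.
move=> xy.
have : multi' p1 x.
  by apply/(cart_multi _ C); rewrite xy; apply/(model_multi M2); exists y.
move=> /(model_multi M1)[z zx].
by exists z => //; apply: (model_inj' M2); rewrite j_psi zx.
Qed.

Lemma model_cartesian : cartesian psi psi' q1 q2.
Proof.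
split=> [y|x y' yx|a b ab qab]; first exact: q_psi.
  have [|x1 x1x x1y] := @cart_lift _ _ _ _ _ _ _ _ C (i2 x) (j1 y').
    by rewrite -j_psi yx -(model_comm M2).
  have [z zx1 zy] := model_lift_face x1x; exists z => //.
  by apply: (model_inj' M1); rewrite -(model_comm M1) zx1.
apply: (model_inj M1); apply: (cart_inj C); first by rewrite -!i_psi ab.
by rewrite !(model_comm M1) qab.
Qed.

Hypotheses (ephi : etale_map phi) (ephi' : etale_map phi').

(** Openness follows from a local section that converges to [y']. Its convergence is tested on the
    fibre of [y'] through the openness of [phi]; the local injectivity of [phi'] ensures that all
    points of the fibre are served by the same section. *)
Lemma model_etale' : etale_map psi'.
Proof.
have [cphi ophi _] := ephi; have [_ _ lphi'] := ephi'; split.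
- move=> y'; apply/(model_cvg' M2) => x2 V x2y x2V.
  have [x1 x12 x1y] : exists2 x1, phi x1 = x2 & p1 x1 = j1 y'.
    by apply: (cart_lift C); rewrite x2y j_psi.
  have : nbhs x1 (phi @^-1` V) by apply: cphi; rewrite x12.
  move=> /(model_near M1 x1y); apply: filterS => z' [x /= Vx xz].
  by exists (phi x) => //; rewrite j_psi (cart_comm C) xz.
- move=> y' V y'V; have [O yO injO] := lphi' (j1 y').
  have /choice[s sP] : forall z', exists w',
      (exists w', psi' w' = z' /\ O (j1 w')) -> psi' w' = z' /\ O (j1 w').
    move=> z'; have [[w' ?]|nw] := pselect (exists w', psi' w' = z' /\ O (j1 w')).
      by exists w'.
    by exists y'.
  have key x W : p1 x = j1 y' -> nbhs x W -> \forall z' \near psi' y',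
      [/\ psi' (s z') = z', O (j1 (s z')) & (p1 @` W) (j1 (s z'))].
    move=> xy xW; have : nbhs x (W `&` p1 @^-1` O).
      by apply: filterI => //; apply: (perfect_continuous pp1); rewrite xy.
    move=> /ophi; have : p2 (phi x) = j2 (psi' y') by rewrite (cart_comm C) xy j_psi.
    move=> /(model_near M2) h /h; apply: filterS => z' [_ [w [Ww Ow] <-]].
    rewrite (cart_comm C) => /[dup] wz /model_lift_face'[w' w'w w'z].
    have [|sz Os] := sP z'; first by exists w'; rewrite w'w.
    split=> //; exists w => //; apply: injO => //.
    by rewrite wz -j_psi sz.
  have sy : s @ nbhs (psi' y') --> y'.
    apply/(model_cvg' M1) => x W xy xW.
    by apply: filterS (key x W xy xW) => z' [_ _].
  have [_ /(_ (j1 y'))[x xy] _] := pp1.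
  have sV : nbhs (psi' y') (s @^-1` V) := sy _ y'V.
  apply: filterS2 sV (key x setT xy filterT) => z' Vs [sz _ _].
  by exists (s z').
- move=> y'; have [O yO injO] := lphi' (j1 y'); exists (j1 @^-1` O).
    exact: (model_continuous' M1 pp1).
  move=> a b Oa Ob ab; apply: (model_inj' M1); apply: injO => //.
  by rewrite -!j_psi ab.
Qed.

(** Again a local section converges. Convergence in [Y1] has two parts: the one in [X1] comes from
    [phi], the one in [Y1'] from the openness of [psi'] in [model_etale']. *)
Lemma model_etale : etale_map psi.
Proof.
have [cphi ophi lphi] := ephi; have [_ _ lphi'] := ephi'.
have [cpsi' opsi' _] := model_etale'; split.
- move=> y; apply/(model_cvg M2); split.
    change (i2 \o psi @ nbhs y --> i2 (psi y)).
    have -> : i2 \o psi = phi \o i1 by apply/funext => z /=.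
    rewrite i_psi; move=> V V1; exact: (model_continuous M1 (cphi _ _ V1)).
  change (q2 \o psi @ nbhs y --> q2 (psi y)).
  have -> : q2 \o psi = psi' \o q1 by apply/funext => z /=.
  rewrite q_psi; move=> V V1; exact: (model_q_continuous M1 (cpsi' _ _ V1)).
- move=> y V yV; have [O yO injO] := lphi (i1 y).
  have [O' yO' injO'] := lphi' (j1 (q1 y)).
  have /choice[s sP] : forall z, exists w,
      (exists w, psi w = z /\ O (i1 w)) -> psi w = z /\ O (i1 w).
    move=> z; have [[w ?]|nw] := pselect (exists w, psi w = z /\ O (i1 w)).
      by exists w.
    by exists y.
  have key U : nbhs (i1 y) U -> \forall z \near psi y, psi (s z) = z /\ U (i1 (s z)).
    move=> yU; have : nbhs (i1 y) (U `&` O) by exact: filterI.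
    move=> /ophi; rewrite -i_psi => phiU.
    have : nbhs (psi y) (i2 @^-1` (phi @` (U `&` O))) := model_continuous M2 phiU.
    apply: filterS => z [x [Ux Ox]] /[dup] xz /model_lift_face[w wx wz].
    have [|sz Os] := sP z; first by exists w; rewrite wx.
    split=> //; by rewrite (injO (i1 (s z)) x)// -i_psi sz.
  have sy : s @ nbhs (psi y) --> y.
    apply/(model_cvg M1); split=> [U yU|W yW].
      by apply: filterS (key U yU) => z [_].
    have : nbhs (q1 y) (W `&` j1 @^-1` O').
      by apply: filterI => //; exact: (model_continuous' M1 pp1).
    move=> /opsi'; rewrite -q_psi => psiW.
    have qW : nbhs (psi y) (q2 @^-1` (psi' @` (W `&` j1 @^-1` O'))) :=
      model_q_continuous M2 psiW.
    have : nbhs (i1 y) (p1 @^-1` O').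
      by apply: (perfect_continuous pp1); rewrite (model_comm M1).
    move=> /key; apply: (@filterS2 _ (nbhs (psi y))) qW => z [w' [Ww Ow] w'z] [sz /= Osz].
    rewrite (model_comm M1) in Osz.
    suff -> : q1 (s z) = w' by [].
    apply: (model_inj' M1); apply: injO' => //.
    by rewrite -!j_psi -q_psi sz w'z.
  have sV : nbhs (psi y) (s @^-1` V) := sy _ yV.
  apply: filterS2 sV (key _ yO) => z Vs [sz _].
  by exists (s z).
- move=> y; have [O yO injO] := lphi (i1 y); exists (i1 @^-1` O).
    exact: (model_continuous M1).
  move=> a b Oa Ob ab; apply: (model_inj M1); apply: injO => //.
  by rewrite -!i_psi ab.
Qed.

Lemma push_model (A : zmodType) (f : X1 -> A) y :
  push phi f (i2 y) = push psi (f \o i1) y.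
Proof.
rewrite /push; apply: reindex_fsbig; split.
- by move=> z /= <-; rewrite i_psi.
- by move=> a b _ _ /(model_inj M1).
- by move=> x /= /model_lift_face[z zx zy]; exists z.
Qed.

(** The difference of [f] and [g] on [Y1] is the pullback of a function [k] on [Y1']; by base change
    its direct image is the pullback of the direct image of [k]. *)
Lemma push_reduces (A : zmodType) (f : X1 -> A) (g : Y1 -> A) :
  (forall x, finite_set [set y | phi y = x /\ f y != 0]) ->
  (forall x, finite_set [set y | psi y = x /\ g y != 0]) ->
  reduces i1 q1 f g -> reduces i2 q2 (push phi f) (push psi g).
Proof.
move=> ff fg rfg y z yz.
have [_ sq _] := model_perfect M1 pp1; have /choice[s sK] := sq.
pose k y' := f (i1 (s y')) - g (s y').
have kE x : push phi f (i2 x) - push psi g x = push psi' k (q2 x).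
  rewrite -(push_cart _ _ model_cartesian) push_model -pushB//.
    by congr push; apply/funext => w /=; rewrite /k; apply: rfg; rewrite sK.
  apply: (@sub_finite_set _ _ (i1 @^-1` [set w | phi w = i2 x /\ f w != 0])).
    by move=> w [<- fw] /=; rewrite i_psi.
  by apply: finite_preimage => // a b _ _; exact: (model_inj M1).
by rewrite !kE yz.
Qed.

End ModelTransfer.

(** * Hausdorff distances and total disconnectedness *)

Record distance_for (R : realType) (X : topologicalType) (d : X -> X -> R) : Prop :=
  DistanceFor {
    dist_ge0 : forall x y, 0 <= d x y;
    dist_sym : forall x y, d x y = d y x;
    dist_tri : forall x y z, d x z <= d x y + d y z;
    dist_nbhs : forall x U, nbhs x U <-> exists2 e, 0 < e & [set y | d x y < e] `<=` U
  }.

Lemma dist_topology_openE (R : realType) (T : choiceType) (d : T -> T -> R)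
  (U : set (dist_topology d)) : open U = dist_open U.
Proof. by []. Qed.

Section DistanceModel.
Variables (R : realType) (X X' : topologicalType) (d : X -> X -> R) (p : X -> X').
Hypotheses (D : distance_for d) (pp : perfect_map p).

Lemma dist_ball_nbhs x (e : R) : 0 < e -> nbhs x [set y | d x y < e].
Proof. by move=> e0; apply/(dist_nbhs D); exists e. Qed.

Lemma compact_dist_bounded (K : set X) x0 : compact K ->
  exists B, forall x, K x -> d x0 x <= B.
Proof.
move=> cK; apply: (compact_ind (P := fun K => exists B, forall x, K x -> d x0 x <= B) cK).
- by exists 0.
- by move=> S S' SS' [B SB]; exists B => x /SS' /SB.
- move=> S S' [B SB] [B' SB']; exists (Num.max B B') => x [/SB|/SB'] h.
    by rewrite le_max h.
  by rewrite le_max h orbT.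
- move=> x _; exists [set y | d x y < 1]; first exact: dist_ball_nbhs.
  exists (d x0 x + 1) => y /= xy.
  by apply: le_trans (dist_tri D x0 x y) _; rewrite lerD2l ltW.
Qed.

(** Compactness of [K] bounds the set of distances, so that its [sup] is a genuine supremum and not
    the default value. *)
Lemma hausdorff_dist_lt (K L : set X) (e : R) z : compact K -> L !=set0 ->
  hausdorff_dist d K L < e -> K z -> exists2 y, L y & d z y < e.
Proof.
move=> cK [l Ll]; rewrite /hausdorff_dist gt_max => /andP[+ _] Kz.
set S := [set _ | x in K] => supS.
have infle x : inf [set d x y | y in L] <= d x l.
  apply: ge_inf; last by exists l.
  by exists 0 => _ [y _ <-]; exact: dist_ge0.
have : inf [set d z y | y in L] < e.
  apply: le_lt_trans supS; apply: ub_le_sup; last by exists z.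
  have [B KB] := compact_dist_bounded l cK; exists B => _ [x Kx <-].
  by apply: le_trans (infle x) _; rewrite (dist_sym D) KB.
move=> /inf_lt[]; first by exists (d z l), l.
by move=> _ [y Ly <-] zy; exists y.
Qed.

Lemma hausdorff_dist_le (K L : set X) (e : R) : K !=set0 -> L !=set0 ->
  (forall x, K x -> exists2 y, L y & d x y < e) ->
  (forall y, L y -> exists2 x, K x & d x y < e) -> hausdorff_dist d K L <= e.
Proof.
move=> [k Kk] [l Ll] KL LK; rewrite /hausdorff_dist ge_max; apply/andP; split.
  apply: ge_sup; first by eexists; exists k.
  move=> _ [x Kx <-]; have [y Ly xy] := KL _ Kx.
  apply: le_trans (ltW xy); apply: ge_inf; last by exists y.
  by exists 0 => _ [? _ <-]; exact: dist_ge0.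
apply: ge_sup; first by eexists; exists l.
move=> _ [y Ly <-]; have [x Kx xy] := LK _ Ly.
apply: le_trans (ltW xy); apply: ge_inf; last by exists x.
by exists 0 => _ [? _ <-]; exact: dist_ge0.
Qed.

Lemma hausdorff_dist_ge0 (K L : set X) : 0 <= hausdorff_dist d K L.
Proof.
rewrite /hausdorff_dist le_max; apply/orP; left.
set S := [set _ | x in K].
have S0 a : S a -> 0 <= a.
  move=> [x _ <-]; have [->|/set0P[y Ly]] := eqVneq L set0; first by rewrite image_set0 inf0.
  apply: lb_le_inf; first by exists (d x y), y.
  by move=> _ [z _ <-]; exact: dist_ge0.
have [hS|/sup_out->//] := pselect (has_sup S).
have [a Sa] := hS.1; apply: le_trans (S0 _ Sa) _.
by apply: ub_le_sup => //; exact: hS.2.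
Qed.

Lemma diam_lt (K : set X) (e : R) x y : compact K -> diam d K < e ->
  K x -> K y -> d x y < e.
Proof.
move=> cK + Kx Ky; apply: le_lt_trans; apply: ub_le_sup; last by exists (x, y).
have [B KB] := compact_dist_bounded x cK; exists (B + B) => _ [[a b] [/= Ka Kb] <-].
by apply: le_trans (dist_tri D a x b) _; rewrite (dist_sym D a) lerD ?KB.
Qed.

Lemma fibre_compact x' : compact (fibre p x').
Proof. by apply: perfect_compact => //; exact: compact_set1. Qed.

Lemma fibre_nonempty x' : fibre p x' !=set0.
Proof. by have [_ /(_ x')[x px] _] := pp; exists x. Qed.

(** If some neighborhood [W] of a point of the limit fibre is missed by almost all fibres, small
    Hausdorff distance is impossible, so the diameters tend to 0; a section then converges to the
    point to which the fibres shrink. *)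
Lemma regular_ultra_regular : regular_map d p -> ultra_regular p.
Proof.
move=> pr F x' UF Fx'.
have [|nF] := pselect (forall x V, p x = x' -> nbhs x V -> F (p @` V)); first by left.
right; have [_ sp up] := pp; have /choice[s sK] := sp.
have [|a pa Fa] := up (s @ F) x' (fmap_ultra s UF).
  by move=> U /Fx'; apply: filterS => y' /=; rewrite sK.
exists a => // V /(dist_nbhs D)[e e0 eV].
have [x [W [px xW nFW]]] : exists x W, [/\ p x = x', nbhs x W & ~ F (p @` W)].
  apply: contrapT => h; apply: nF => x W px xW; apply: contrapT => nFW.
  by apply: h; exists x, W.
have [e' e'0 e'W] := (dist_nbhs D x W).1 xW.
have := ultraN UF nFW.
(* The bound [e'] rules out the Hausdorff alternative, since a fibre that close would meet [W];
   [e / 2] leaves room for the distance from [a] to the section. *)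
have m0 : 0 < Num.min (e / 2) e' by rewrite lt_min e'0 divr_gt0.
have [U' [oU' U'x U'P]] := pr x' _ m0.
have FU' : F U' by apply: Fx'; exact: open_nbhs_nbhs.
have Fs : F (s @^-1` [set y | d a y < e / 2]).
  by apply: (Fa [set y | d a y < e / 2]); apply: dist_ball_nbhs; rewrite divr_gt0.
apply: filterS3 FU' Fs => y' /U'P yP /= asy nWy.
case: yP => [/hausdorff_dist_lt|].
  move=> /(_ _ (@fibre_compact _) (@fibre_nonempty _) px)[y yy'].
  by rewrite lt_min => /andP[_ /e'W Wy]; case: nWy; exists y.
move=> dy y yy'; apply: eV => /=.
have := diam_lt (@fibre_compact y') dy (sK y') yy'.
rewrite lt_min => /andP[sy _]; rewrite (splitr e).
by apply: le_lt_trans (dist_tri D a (s y') y) _; rewrite ltrD.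
Qed.

Let j (y' : red' d p) : X' := val (y' : set_type (multi' p)).

Lemma red'_open_image (V : set X) : open V ->
  open ([set y' | (p @` V) (j y')] : set (red' d p)).
Proof.
rewrite dist_topology_openE => oV y' [x Vx xy].
have [e e0 eV] := (dist_nbhs D x V).1 (open_nbhs_nbhs (conj oV Vx)).
exists e => // z' /= yz.
have [y yz' xye] := hausdorff_dist_lt (@fibre_compact _) (fibre_nonempty _) yz xy.
by exists y => //; exact: eV.
Qed.

Lemma red'_near (x : X) (V : set X) (y' : red' d p) : p x = j y' -> nbhs x V ->
  nbhs y' [set y' | (p @` V) (j y')].
Proof.
move=> xy; rewrite nbhsE => -[U [oU Ux] UV].
apply: (@filterS _ _ _ [set y' | (p @` U) (j y')]).
  by move=> z' [u /UV Vu uz]; exists u.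
by apply: open_nbhs_nbhs; split; [exact: red'_open_image|exists x].
Qed.

(** One half of the Hausdorff distance is small because the compact fibre of [y'] is covered by
    finitely many small balls that nearby fibres meet, the other by upper semicontinuity. *)
Lemma red'_ball (F : set_system (red' d p)) (y' : red' d p) (e : R) : Filter F ->
  (forall x V, p x = j y' -> nbhs x V -> F (j @^-1` (p @` V))) -> 0 < e ->
  F [set z' | dist_multi' d y' z' < e].
Proof.
move=> FF Fy e0.
have e40 : 0 < e / 2 / 2 by rewrite !divr_gt0.
have FK : F [set z' | forall x, fibre p (j y') x ->
    exists2 z, fibre p (j z') z & d x z < e / 2].
  apply: (compact_ind (P := fun S => F [set z' | forall x, S x ->
    exists2 z, fibre p (j z') z & d x z < e / 2]) (@fibre_compact (j y'))).
  - by apply: filterE => z' x.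
  - by move=> S S' SS'; apply: filterS => z' zP x /SS' /zP.
  - by move=> S S'; apply: filterS2 => z' zP zP' x [/zP|/zP'].
  - move=> x xy; exists [set z | d x z < e / 2 / 2]; first exact: dist_ball_nbhs.
    have := Fy x _ xy (dist_ball_nbhs x e40); apply: filterS.
    move=> z' [z /= xz zz'] u /= xu; exists z => //; rewrite (splitr (e / 2)).
    by apply: le_lt_trans (dist_tri D u x z) _; rewrite (dist_sym D) ltrD.
have FL : F [set z' | forall z, fibre p (j z') z ->
    exists2 x, fibre p (j y') x & d x z < e / 2].
  have : \forall z' \near j y', fibre p z' `<=`
      [set z | exists2 x, fibre p (j y') x & d x z < e / 2].
    apply: perfect_fibre_near => // x xy.
    apply: filterS (dist_ball_nbhs x (_ : 0 < e / 2)); last by rewrite divr_gt0.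
    by move=> z /= xz; exists x.
  have [x xy] := fibre_nonempty (j y').
  (* The hypothesis on [F] speaks only of fibres meeting a neighborhood of a point; a neighborhood
     of [j y'] is brought to this form by its preimage. *)
  move=> near_y; have : nbhs x (p @^-1` [set z' | fibre p z' `<=`
      [set z | exists2 x, fibre p (j y') x & d x z < e / 2]]).
    by apply: (perfect_continuous pp); rewrite xy.
  move=> /(Fy _ _ xy); apply: filterS => z' [u /= uP uz].
  by rewrite -uz.
apply: filterS2 FK FL => z' zK zL /=.
(* Suprema preserve only weak inequalities, hence the margin. *)
apply: le_lt_trans (_ : _ <= e / 2) _; last first.
  by rewrite {2}(splitr e) ltrDl divr_gt0.
by apply: hausdorff_dist_le => //; exact: fibre_nonempty.
Qed.

Lemma red_model : reduction_model p (@red_val R X X' d p) j (@red_map R X X' d p).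
Proof.
split.
- exact: val_inj.
- exact: val_inj.
- by [].
- move=> x'; split=> [xm|[y' <-]]; last exact: set_valP.
  by exists (exist _ x' (mem_set xm)).
- move=> x y' xy; have xm : multi p x by rewrite /multi/= xy; exact: set_valP.
  by exists (exist _ x (mem_set xm)) => //; apply: val_inj.
- move=> F y FF; split=> [Fy|[iF qF]].
    split.
      move=> U; rewrite nbhsE => -[V [oV Vy] VU]; rewrite /nbhs/=.
      apply: (@filterS _ _ _ (@red_val _ _ _ d p @^-1` V)); first by move=> z /VU.
      apply: Fy; apply: open_nbhs_nbhs; split=> //.
      rewrite dist_topology_openE => z Vz.
      have [e e0 eV] := (dist_nbhs D (red_val z) V).1 (open_nbhs_nbhs (conj oV Vz)).
      exists e => // w zw; apply: eV; apply: le_lt_trans zw.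
      by rewrite /dist_multi lerDl; exact: hausdorff_dist_ge0.
    move=> U; rewrite nbhsE => -[V [oV Vy] VU]; rewrite /nbhs/=.
    apply: (@filterS _ _ _ (@red_map _ _ _ d p @^-1` V)); first by move=> z /VU.
    apply: Fy; apply: open_nbhs_nbhs; split=> //.
    move: oV; rewrite !dist_topology_openE => oV z Vz.
    have [e e0 eV] := oV _ Vz.
    exists e => // w zw; apply: eV; apply: le_lt_trans zw.
    by rewrite /dist_multi lerDr; exact: dist_ge0.
  move=> U; rewrite nbhsE => -[V [+ Vy] VU].
  rewrite dist_topology_openE => oV.
  apply: (@filterS _ _ _ V) => //; have [e e0 eV] := oV _ Vy.
  have e20 : 0 < e / 2 by rewrite divr_gt0.
  have F1 : F [set z | d (red_val y) (red_val z) < e / 2].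
    exact: (iF [set z | d (red_val y) z < e / 2] (dist_ball_nbhs _ e20)).
  have F2 : (@red_map _ _ _ d p @ F) [set z | dist_multi' d (red_map y) z < e / 2].
    apply: red'_ball => // x W xy xW.
    exact: qF (red'_near xy xW).
  have : F [set z | dist_multi' d (red_map y) (red_map z) < e / 2] := F2.
  apply: (@filterS2 _ F) F1 => z /= z1 z2; apply: eV.
  by rewrite /= (splitr e) ltrD.
- move=> F y' FF; split=> [Fy x V xy xV|Fy].
    exact: Fy _ (red'_near xy xV).
  move=> U; rewrite nbhsE => -[V [+ Vy] VU].
  rewrite dist_topology_openE => oV.
  apply: (@filterS _ _ _ V) => //; have [e e0 eV] := oV _ Vy.
  by apply: filterS eV _; exact: red'_ball.
Qed.

End DistanceModel.

(** * Compact open bases of totally disconnected locally compact spaces *)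

Section TotallyDisconnected.
Variable T : topologicalType.
Hypothesis hT : hausdorff_space T.

Lemma closed_filter_limit (F : set_system T) (D : set T) y :
  ProperFilter F -> closed D -> F D -> F --> y -> D y.
Proof.
move=> PF cD FD Fy; apply: contrapT => nDy.
have : nbhs y (~` D) by apply: open_nbhs_nbhs; split=> //; exact: closed_openC.
by move=> /Fy /(filterI FD); rewrite setICr => /filter_not_empty.
Qed.

Lemma set_nbhs_ultra (K : set T) (G : set_system T) : compact K ->
  UltraFilter G -> set_nbhs K `<=` G -> exists2 x, K x & G --> x.
Proof.
move=> cK UG KG; apply: contrapT => nx.
have [U [oU KU GU]] : exists U, [/\ open U, K `<=` U & G (~` U)].
  apply: (compact_ind (P := fun K => exists U, [/\ open U, K `<=` U & G (~` U)]) cK).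
  - by exists set0; split; [exact: open0| |rewrite setC0; exact: filterT].
  - by move=> A B AB [U [oU BU GU]]; exists U; split=> // x /AB /BU.
  - move=> A B [U [oU AU GU]] [V [oV BV GV]]; exists (U `|` V); split.
    + exact: openU.
    + by move=> x [/AU|/BV]; [left|right].
    + by rewrite setCU; exact: filterI.
  - move=> x Kx; have [U xU nGU] : exists2 U, nbhs x U & ~ G U.
      apply: contrapT => h; apply: nx; exists x => // U xU.
      by apply: contrapT => nGU; apply: h; exists U.
    have [V [oV Vx] VU] : exists2 V, open_nbhs x V & V `<=` U by rewrite nbhsE in xU.
    exists V.
      exact: (open_nbhs_nbhs (conj oV Vx)).
    exists V; split=> //; apply: ultraN => GV; apply: nGU.
    exact: filterS VU GV.
have : G U by apply: KG => x /KU Ux; exact: open_nbhs_nbhs.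
by move=> /(filterI GU); rewrite setICl => /filter_not_empty.
Qed.

(** An ultrafilter containing all neighborhoods of [K] and of [L] would converge to a point of each,
    hence to a common point. *)
Lemma compact_separation (K L : set T) : compact K -> compact L ->
  K `&` L = set0 ->
  exists U V, [/\ open U, open V, K `<=` U, L `<=` V & U `&` V = set0].
Proof.
move=> cK cL KL0.
pose F : set_system T := [set S | exists U V,
  [/\ set_nbhs K U, set_nbhs L V & U `&` V `<=` S]].
have FF : Filter F.
  split.
  - by exists setT, setT; split=> //; exact: filterT.
  - move=> A B [U [V [KU LV UV]]] [U' [V' [KU' LV' UV']]].
    exists (U `&` U'), (V `&` V'); split.
    + by move=> x Kx; apply: filterI; [exact: KU|exact: KU'].
    + by move=> x Lx; apply: filterI; [exact: LV|exact: LV'].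
    by move=> x [[? ?] [? ?]]; split; [exact: UV|exact: UV'].
  - by move=> A B AB [U [V [KU LV UV]]]; exists U, V; split=> // x /UV /AB.
suff [U [V [/set_nbhsP[U' [oU' KU' U'U]] /set_nbhsP[V' [oV' LV' V'V]] UV0]]] : F set0.
  exists U', V'; split=> //; apply/seteqP; split=> // x [/U'U Ux /V'V Vx].
  exact: UV0.
apply: filter_ultraP => G UG FG.
have [x Kx Gx] : exists2 x, K x & G --> x.
  apply: set_nbhs_ultra => // U KU; apply: FG; exists U, setT.
  by split=> // y _; exact: filterT.
have [y Ly Gy] : exists2 x, L x & G --> x.
  apply: set_nbhs_ultra => // V LV; apply: FG; exists setT, V.
  by split=> // y _; exact: filterT.
have xy : x = y by exact: (hausdorff_cvg_unique hT _ Gx Gy).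
by have : (K `&` L) x; [split=> //; rewrite xy|rewrite KL0].
Qed.

(* In a compact set the quasi-component of a point is connected; here it is
   therefore reduced to that point. *)
Lemma totally_disconnected_basis : locally_compact [set: T] ->
  totally_disconnected [set: T] -> compact_open_basis T.
Proof.
move=> lT tT x N xN.
have [C xC [cC clC]] := lT x I; rewrite withinET in xC.
(* The relatively clopen subsets of the compact neighborhood [C] that contain [x]; their
   intersection [Q] is the quasi-component of [x] in [C]. *)
pose DD (D : set T) := [/\ closed D, D x & exists2 O, open O & D = C `&` O].
pose Q := [set y | forall D, DD D -> D y].
have DDC : DD C.
  split=> //; first exact: nbhs_singleton.
  by exists setT; [exact: openT|rewrite setIT].
pose F : set_system T := [set S | exists2 D, DD D & D `<=` S].
have FF : Filter F.
  split.
  - by exists C.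
  - move=> A B [D [cD Dx [O oO DO]] DA] [D' [cD' Dx' [O' oO' DO']] DB].
    exists (D `&` D').
      split; [exact: closedI|by split|exists (O `&` O'); first exact: openI].
      by rewrite DO DO' setIACA setIid.
    by move=> y [/DA ? /DB].
  - by move=> A B AB [D DD_ DA]; exists D => // y /DA /AB.
(* By compactness of [C], some relatively clopen set already lies in a given open set around [Q]. *)
have small W : open W -> Q `<=` W -> F W.
  move=> oW QW; apply: filter_ultraP => G UG FG.
  have GC : G C by apply: FG; exists C.
  have [y Cy Gy] := (compact_ultraP C).1 cC G UG GC.
  apply: (Gy); apply: open_nbhs_nbhs; split=> //; apply: QW => D DD_.
  have GD : G D by apply: FG; exists D.
  by apply: (closed_filter_limit _ _ GD Gy); case: DD_.
have Qx : Q x by move=> D [].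
have clQ : closed Q.
  have -> : Q = \bigcap_(D in DD) D by apply/seteqP; split=> y h D; exact: h.
  by apply: closed_bigI => D [].
have cQ : compact Q by apply: (subclosed_compact clQ cC) => y; exact.
have split_Q U V : open U -> open V -> U `&` V = set0 -> Q `<=` U `|` V ->
    U x -> Q `<=` U.
  move=> oU oV UV0 QUV Ux; have [D [cD Dx [O oO DO]] DUV] := small _ (openU oU oV) QUV.
  have DDU : DD (D `&` U).
    split=> //; last by exists (O `&` U); [exact: openI|rewrite DO setIA].
    have -> : D `&` U = D `&` ~` V.
      apply/seteqP; split=> y [Dy].
        by move=> Uy; split=> // Vy; have : (U `&` V) y by []; rewrite UV0.
      by have [//|] := DUV _ Dy.
    by apply: closedI => //; exact: open_closedC.
  by move=> y /(_ _ DDU)[].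
have connQ : connected Q.
  move=> B [b Bb] [O oO BO] [K clK BK].
  have cB : compact B by rewrite BK; exact: compact_closedI.
  have cB' : compact (Q `&` ~` O) by apply: compact_closedI => //; exact: open_closedC.
  have [|U [V [oU oV BU BV UV0]]] := compact_separation cB cB'.
    by apply/seteqP; split=> // y []; rewrite BO => -[_ Oy] [].
  have QUV : Q `<=` U `|` V.
    move=> y Qy; have [Oy|nOy] := pselect (O y); last by right; exact: BV.
    by left; apply: BU; rewrite BO.
  have [Ux|Vx] := QUV _ Qx.
    have QU := split_Q U V oU oV UV0 QUV Ux.
    apply/seteqP; split=> y; first by rewrite BO => -[].
    move=> Qy; rewrite BO; split=> //; apply: contrapT => nOy.
    have : (U `&` V) y by split; [exact: QU|exact: BV].
    by rewrite UV0.
  have QV : Q `<=` V.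
    by apply: (split_Q V U) => //; [rewrite setIC|rewrite setUC].
  have Qb : Q b by move: Bb; rewrite BO => -[].
  by have : (U `&` V) b; [split; [exact: BU|exact: QV]|rewrite UV0].
have QE : Q = [set x].
  apply/seteqP; split; last by move=> y ->.
  by rewrite -(tT x I); exact: connected_component_max.
(* A relatively clopen subset of [C] contained in the interior of [C] is open in the whole space. *)
have [||D [cD Dx [O oO DO]] DW] := small (C° `&` N°).
- by apply: openI; exact: open_interior.
- by rewrite QE => y ->; split; [exact: xC|exact: xN].
exists D; split=> //; last by move=> y /DW[_ /interior_subset].
split; first by rewrite DO -DO; apply: (subclosed_compact cD cC); rewrite DO => y [].
have -> : D = C° `&` N° `&` O.
  apply/seteqP; split=> y; first by move=> Dy; split; [exact: DW|move: Dy; rewrite DO => -[]].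
  by move=> [[/interior_subset Cy _] Oy]; rewrite DO.
by apply: openI => //; apply: openI; exact: open_interior.
Qed.

End TotallyDisconnected.

Section Quotients.
Local Open Scope quotient_scope.

Lemma quot_eqP (V : zmodType) (S : zmodClosed V) (x y : V) :
  \pi_(Quotient.quot S) x = \pi_(Quotient.quot S) y <-> x - y \in S.
Proof.
split=> [xy|xy]; first by rewrite Quotient.idealrBE; apply/eqP.
by apply/eqP; rewrite -Quotient.idealrBE.
Qed.

End Quotients.

(** * The class defined by [reduction] *)

Section ReductionClass.
Variables (R : realType) (X X' : topologicalType) (d : X -> X -> R) (p : X -> X').
Hypotheses (D : distance_for d) (pp : perfect_map p).
Hypotheses (hX' : hausdorff_space X') (pr : ultra_regular p).
Variable A : zmodType.

(** The set where [f] varies is a valid threshold: all cutoffs beyond it represent the reduction of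
    [f], so they differ by functions constant on fibres, and the choice in [reduction] is not the
    default. *)
Lemma reduction_reduces (f : Cc X A) : exists g : Cc (red d p) A,
  reduction d p f = Cc_proj (@red_map _ _ _ d p) g /\
  reduces (@red_val _ _ _ d p) (@red_map _ _ _ d p) f g.
Proof.
have M := red_model D pp.
have cutE (K : set (red' d p)) : compact_open K ->
    (to_Cc (cutoff f K) : red d p -> A) = cutoff f K.
  by move=> coK; rewrite to_CcE//; exact: (Cc_cutoff M pp hX').
have cV := compact_open_varies_Cc M pp pr f.
rewrite /reduction; case: xgetP => [q _ [K0 [[cK0 oK0] K0q]]|noq].
  pose K := K0 `|` varies p (fun y' : red' d p => val (y' : set_type (multi' p))) f.
  have coK : compact_open K by case: cV => ? ?; split; [exact: compactU|exact: openU].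
  exists (to_Cc (cutoff f K)); split; first by rewrite (K0q K)//; exact: subsetUl.
  by rewrite cutE//; apply: (reduces_cutoff M); exact: subsetUr.
exfalso; set V := varies _ _ f in cV.
apply: (noq (Cc_proj (@red_map _ _ _ d p) (to_Cc (cutoff f V)))).
exists V; split=> // K coK VK; apply/quot_eqP.
by apply: (reduces_descend M pp (f := f)); rewrite cutE//; exact: (reduces_cutoff M).
Qed.

End ReductionClass.

(** * Nerves of groupoids *)

Section NerveFaces.
Variables (T : topologicalType) (G : groupoid T).

(** Natural indices make index computations linear arithmetic; an index out of range is read as
    0. *)
Definition entry n (t : nerve G n) (k : nat) : T := nerve_val t (inord k).

Arguments entry : simpl never.

Lemma nerve_val_entry n (t : nerve G n) i : nerve_val t i = entry t i.
Proof. by rewrite /entry inord_val. Qed.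

Lemma entry_comp n (t : nerve G n.+1) k : (k < n)%N ->
  gsrc G (entry t k) = grng G (entry t k.+1).
Proof.
by move=> kn; apply: (set_valP (t : set_type (nerve_set G n.+1))); rewrite !inordK//; lia.
Qed.

Lemma entry_unit (t : nerve G 0) : grng G (entry t 0) = entry t 0.
Proof.
have [g _ e] : gunits G (nerve_val t ord0) := set_valP (t : set_type (nerve_set G 0)).
by rewrite /entry (ord1 (inord 0)) -e grng_rng.
Qed.

Lemma grng_src g : grng G (gsrc G g) = gsrc G g.
Proof. by rewrite -grngV grng_rng. Qed.

Lemma gsrc_eq_rng g : grng G g = g -> gsrc G g = g.
Proof. by move=> <-; rewrite gsrc_rng. Qed.

Lemma nerve_eqP n (t u : nerve G n) :
  (forall k, (k < n.-1.+1)%N -> entry t k = entry u k) -> t = u.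
Proof.
move=> tu; apply: val_inj; apply/funext => i.
by rewrite -[LHS]/(nerve_val t i) -[RHS]/(nerve_val u i) !nerve_val_entry tu.
Qed.

Lemma nerve_exists0 (g : T) : grng G g = g -> exists t : nerve G 0, entry t 0 = g.
Proof.
move=> gg; have gP : nerve_set G 0 (fun=> g) by exists g.
by exists (exist _ (fun=> g) (mem_set gP)).
Qed.

Lemma nerve_existsS n (v : nat -> T) :
  (forall k, (k < n)%N -> gsrc G (v k) = grng G (v k.+1)) ->
  exists t : nerve G n.+1, forall k, (k <= n)%N -> entry t k = v k.
Proof.
move=> vc.
have vP : nerve_set G n.+1 (fun i => v i).
  by move=> i j /= ij; rewrite ij; apply: vc; have := ltn_ord j; rewrite ij.
exists (exist _ (fun i : 'I_n.+1 => v i) (mem_set vP)) => k kn.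
by rewrite /entry /nerve_val /= inordK.
Qed.

Definition face_entry (i : nat) (v : nat -> T) (k : nat) : T :=
  if (k.+1 < i)%N then v k
  else if k.+1 == i then gmul G (v k) (v k.+1) else v k.+1.

Lemma faceE n (i : 'I_n.+3) (t : nerve G n.+2) (k : 'I_n.+1) :
  face i t k = face_entry i (entry t) k.
Proof. by []. Qed.

Lemma face_entry_src i v k : (k.+1 = i -> gsrc G (v k) = grng G (v k.+1)) ->
  gsrc G (face_entry i v k) = if (k.+1 < i)%N then gsrc G (v k) else gsrc G (v k.+1).
Proof.
move=> vk; rewrite /face_entry; case: ifP => // _.
by case: eqP => [/vk|//]; exact: gsrcM.
Qed.

Lemma face_entry_rng i v k : (k.+1 = i -> gsrc G (v k) = grng G (v k.+1)) ->
  grng G (face_entry i v k) = if (k < i)%N then grng G (v k) else grng G (v k.+1).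
Proof.
move=> vk; rewrite /face_entry; case: ltngtP => [ki|ki|ki].
- by [].
- by [].
- by rewrite grngM//; exact: vk.
Qed.

Lemma face_nerve n (i : 'I_n.+2) (t : nerve G n.+1) : nerve_set G n (face i t).
Proof.
case: n i t => [|n] i t.
  rewrite /nerve_set/= /face/=; case: ifP => _; first exact: gsrc_unit.
  by exists (nerve_val t ord0).
move=> k l kl; rewrite !faceE; simpl in k, l, kl.
have tc := @entry_comp _ t; have /= ln := ltn_ord l.
rewrite face_entry_src => [|_]; last by apply: tc; lia.
rewrite face_entry_rng => [|_]; last by apply: tc; lia.
rewrite kl; case: ifP => ki; apply: tc; lia.
Qed.

Definition nerve_face n (i : 'I_n.+2) (t : nerve G n.+1) : nerve G n :=
  exist _ (face i t) (mem_set (face_nerve i t)).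

Lemma nerve_face0E (i : 'I_2) (t : nerve G 1) :
  entry (nerve_face i t) 0 =
  if i == 0 :> nat then gsrc G (entry t 0) else grng G (entry t 0).
Proof.
by rewrite /entry /nerve_val /= /face /= (ord1 (inord 0)).
Qed.

Lemma nerve_faceSE n (i : 'I_n.+3) (t : nerve G n.+2) k : (k <= n)%N ->
  entry (nerve_face i t) k = face_entry i (entry t) k.
Proof. by move=> kn; rewrite -[LHS]/(face i t (inord k)) faceE inordK. Qed.

(* A tuple is determined by its [i]-th face and its [i]-th key, the arrow from
   one of the neighbors of the [i]-th vertex to that vertex; the keys that extend
   a given tuple are the arrows with a prescribed range, the [i]-th base. *)
Definition face_key n (i : nat) (t : nerve G n.+1) : T :=
  if i == 0 then ginv G (entry t 0) else entry t i.-1.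

Definition face_base n (i : nat) (x : nerve G n) : T :=
  if i == n.+1 then gsrc G (entry x n.-1) else grng G (entry x i.-1).

(** The tuple with [i]-th face [x] and key [g]. An inner face is undone by splitting entry [i.-1] of
    [x] into [g] and [g^-1] times that entry; an outer one by adjoining [g] at the end or its
    inverse at the beginning. For the last face the branch [k == i] lies beyond the tuple. *)
Definition face_rec (i : nat) (x : nat -> T) (g : T) (k : nat) : T :=
  if i == 0 then if k == 0 then ginv G g else x k.-1
  else if (k < i.-1)%N then x k
  else if k == i.-1 then g
  else if k == i then gmul G (ginv G g) (x i.-1) else x k.-1.

Lemma face_base_unit n i (x : nerve G n) : gunits G (face_base i x).
Proof.
rewrite /face_base; case: ifP => _; first exact: gsrc_unit.
by exists (entry x i.-1).
Qed.

Lemma face_key_rng n (i : 'I_n.+2) (t : nerve G n.+1) :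
  grng G (face_key i t) = face_base i (nerve_face i t).
Proof.
rewrite /face_key /face_base; have tc := @entry_comp _ t; have ln := ltn_ord i.
case: n i t tc ln => [|n] i t tc ln.
  case: eqP => [i0|i0].
    by rewrite ifF ?i0//= nerve_face0E i0/= grngV grng_src.
  have i1 : i = 1 :> nat by lia.
  by rewrite i1/= nerve_face0E i1/= gsrc_rng.
case: eqP => [i0|i0].
  rewrite ifF; last by lia.
  by rewrite i0 grngV nerve_faceSE// face_entry_rng ?i0//= tc.
have [im|im] := eqVneq (i : nat) n.+2.
  rewrite im /= nerve_faceSE// face_entry_src ?ifT; [|lia|lia].
  by rewrite tc.
rewrite nerve_faceSE; last lia.
rewrite face_entry_rng; last by move=> _; apply: tc; lia.
by rewrite ifT//; lia.
Qed.

Lemma face_recK n (i : 'I_n.+2) (t : nerve G n.+1) k : (k <= n)%N ->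
  entry t k = face_rec i (entry (nerve_face i t)) (face_key i t) k.
Proof.
move=> kn; rewrite /face_key /face_rec; have tc := @entry_comp _ t.
case: n i t tc kn => [|n] i t tc kn; have ln := ltn_ord i.
  have -> : k = 0 by lia.
  case: eqP => i0 /=; first by rewrite ginvK.
  by have -> : i = 1 :> nat by lia.
case: eqP => [i0|i0].
  case: eqP => [->|k0]; first by rewrite ginvK.
  rewrite nerve_faceSE; last lia.
  by rewrite /face_entry i0/= prednK//; lia.
case: ltnP => ki.
  by rewrite nerve_faceSE /face_entry ?ifT//; lia.
case: eqP => [->//|ki1]; case: eqP => [ki2|ki2].
  rewrite nerve_faceSE; last lia.
  rewrite /face_entry ifF ?ifT; [|lia|lia].
  rewrite gmulKl; first by rewrite prednK ?ki2//; lia.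
  by apply: tc; lia.
rewrite nerve_faceSE; last lia.
rewrite /face_entry ifF ?ifF; [|lia|lia].
by rewrite prednK//; lia.
Qed.

Lemma face_inj n (i : 'I_n.+2) (t u : nerve G n.+1) :
  nerve_face i t = nerve_face i u -> face_key i t = face_key i u -> t = u.
Proof.
by move=> d k; apply: nerve_eqP => l ln; rewrite (face_recK i)// d k -face_recK.
Qed.

Lemma face_exists n (i : 'I_n.+2) (x : nerve G n) (g : T) :
  grng G g = face_base i x ->
  exists t, nerve_face i t = x /\ face_key i t = g.
Proof.
have ln := ltn_ord i.
case: n i x ln => [|n] i x ln gi.
  have [t tg] := @nerve_existsS 0 (fun=> if i == 0 :> nat then ginv G g else g) (ltac:(by [])).
  have {tg} := tg 0 (leqnn 0) => tg.
  exists t; split.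
    apply: nerve_eqP => k k1; have -> : k = 0 by lia.
    rewrite nerve_face0E tg; have [i0|i0] := eqVneq (i : nat) 0.
      by rewrite gsrcV gi /face_base i0 /= entry_unit.
    have i1 : i = 1 :> nat by lia.
    by rewrite gi /face_base i1/= (gsrc_eq_rng (entry_unit x)).
  rewrite /face_key; case: eqP tg => [i0|i0] tg; first by rewrite tg ginvK.
  by rewrite -tg; congr entry; lia.
have xc := @entry_comp _ x.
have [k kn|t tv] := @nerve_existsS n.+1 (face_rec i (entry x) g).
  rewrite /face_rec; have [i0|i0] := eqVneq (i : nat) 0.
    have gi0 : grng G g = grng G (entry x 0) by rewrite gi /face_base i0.
    case: k kn => [|k] kn /=; first by rewrite gsrcV gi0.
    by apply: xc; lia.
  case: (ltnP k.+1 i.-1) => ki.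
    by rewrite ifT; [apply: xc; lia|lia].
  have [ki1|ki1] := eqVneq k.+1 i.-1.
    rewrite ifT; last by lia.
    rewrite gi /face_base; have [im|im] := eqVneq (i : nat) n.+2.
      by congr (gsrc _ (entry _ _)); lia.
    by rewrite -ki1; apply: xc; lia.
  have gi' : (i <= n.+1)%N -> grng G g = grng G (entry x i.-1).
    by move=> im; rewrite gi /face_base ifF//; lia.
  rewrite ifF; last by lia.
  have [ki2|ki2] := eqVneq k i.-1.
    rewrite ifT; last by lia.
    by rewrite grngM ?grngV// gsrcV gi'//; lia.
  have [ki3|ki3] := eqVneq k (i : nat).
    rewrite ifF; last by lia.
    rewrite gsrcM; last by rewrite gsrcV gi'//; lia.
    rewrite xc; last by lia.
    by congr (grng _ (entry _ _)); lia.
  rewrite ifF; last by lia.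
  rewrite xc; last by lia.
  by congr (grng _ (entry _ _)); lia.
exists t; split; last first.
  rewrite /face_key /face_rec; case: eqP => [i0|i0].
    by rewrite tv// /face_rec i0/= ginvK.
  rewrite tv; last by lia.
  by rewrite /face_rec ltnn eqxx ifF//; lia.
apply: nerve_eqP => k kn; rewrite nerve_faceSE//= /face_entry.
case: ltnP => [ki|ki].
  rewrite tv; last by lia.
  by rewrite /face_rec ifF ?ifT//; lia.
case: eqP => [ki1|ki1]; last first.
  rewrite tv; last by lia.
  rewrite /face_rec; have [//|i0] := eqVneq (i : nat) 0.
  by rewrite !ifF//; lia.
have -> : entry t k = g.
  rewrite tv; last by lia.
  have -> : k = i.-1 by lia.
  by rewrite /face_rec ltnn eqxx ifF//; lia.
have -> : entry t k.+1 = gmul G (ginv G g) (entry x k).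
  rewrite tv ki1; last by lia.
  rewrite /face_rec ifF; last by lia.
  rewrite ifF; last by lia.
  rewrite ifF ?eqxx; last by lia.
  by congr (gmul _ _ (entry _ _)); lia.
move: gi; rewrite /face_base ifF => [gi|]; last by lia.
rewrite -{1}(ginvK G g) gmulKl// gsrcV gi.
by congr (grng _ (entry _ _)); lia.
Qed.

End NerveFaces.

Ltac ifs := repeat first [rewrite ifT; [|lia] | rewrite ifF; [|lia]].

(** * Simplicial identities *)

Section Simplicial.
Variables (T : topologicalType) (G : groupoid T).

Lemma eq_face_entry i (v w : nat -> T) k : v k = w k -> v k.+1 = w k.+1 ->
  face_entry G i v k = face_entry G i w k.
Proof. by rewrite /face_entry => -> ->. Qed.

Lemma face_entryC i j (v : nat -> T) k : (i <= j)%N ->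
  gsrc G (v k) = grng G (v k.+1) -> gsrc G (v k.+1) = grng G (v k.+2) ->
  face_entry G i (face_entry G j.+1 v) k = face_entry G j (face_entry G i v) k.
Proof.
move=> ij v1 v2.
have [[ki kj]|[[ki kj]|[[ki kj]|[[ki kj]|[[ki kj]|ki]]]]] :
    ((k.+1 < i /\ k.+1 < j) \/ (k.+1 = i /\ k.+1 < j) \/ (k.+1 = i /\ k.+1 = j)
    \/ (i < k.+1 /\ k.+1 < j) \/ (i < k.+1 /\ k.+1 = j) \/ (j < k.+1))%N by lia.
all: rewrite /face_entry; ifs => //.
(* The remaining case is [k.+1 = i = j], where three consecutive arrows are multiplied. *)
by have [_ _ ->] := gmulA v1 v2.
Qed.

Lemma nerve_faceC n (i j : 'I_n.+2) (i' j' : 'I_n.+3) (t : nerve G n.+2) :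
  (i <= j)%N -> i' = i :> nat -> j' = j.+1 :> nat ->
  nerve_face i (nerve_face j' t) = nerve_face j (nerve_face i' t).
Proof.
move=> ij i'i j'j; have tc := @entry_comp _ _ _ t.
apply: nerve_eqP => k kn; case: n i j i' j' t tc ij i'i j'j kn => [|n] i j i' j' t tc ij i'i j'j kn.
  have -> : k = 0 by lia.
  have li := ltn_ord i; have lj := ltn_ord j.
  rewrite !nerve_face0E !nerve_faceSE// /face_entry i'i j'j.
  have [[-> ->]|[[-> ->]|[-> ->]]] : (i = 0 :> nat /\ j = 0 :> nat) \/
    (i = 0 :> nat /\ j = 1 :> nat) \/ (i = 1 :> nat /\ j = 1 :> nat) by lia.
  - by rewrite /= gsrcM// tc.
  - by rewrite /= tc.
  - by rewrite /= grngM// tc.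
rewrite !nerve_faceSE; [|lia|lia].
rewrite (@eq_face_entry i _ (face_entry G j' (entry t))); [|by rewrite nerve_faceSE//; lia..].
rewrite (@eq_face_entry j _ (face_entry G i' (entry t))); [|by rewrite nerve_faceSE//; lia..].
by rewrite i'i j'j; apply: face_entryC => //; apply: tc; lia.
Qed.

End Simplicial.

Section NerveHom.
Variables (T T' : topologicalType) (G : groupoid T) (G' : groupoid T').
Variable p : groupoid_hom G G'.

Lemma nerve_map_entry n (t : nerve G n) k : entry (nerve_map p n t) k = p (entry t k).
Proof. by []. Qed.

Lemma nerve_map_face n (i : 'I_n.+2) (t : nerve G n.+1) :
  nerve_map p n (nerve_face i t) = nerve_face i (nerve_map p n.+1 t).
Proof.
apply: nerve_eqP => k kn; rewrite nerve_map_entry.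
case: n i t kn => [|n] i t kn.
  have -> : k = 0 by lia.
  rewrite !nerve_face0E nerve_map_entry.
  by case: ifP => _; [exact: hom_src|exact: hom_rng].
rewrite !nerve_faceSE; [|lia|lia].
rewrite /face_entry !nerve_map_entry; case: ifP => // ki; case: eqP => // ki1.
by apply: homM; apply: entry_comp; lia.
Qed.

Lemma nerve_map_key n i (t : nerve G n.+1) :
  face_key i (nerve_map p n.+1 t) = p (face_key i t).
Proof. by rewrite /face_key !nerve_map_entry; case: ifP => // _; rewrite homV. Qed.

Lemma nerve_map_base n i (x : nerve G n) :
  face_base i (nerve_map p n x) = p (face_base i x).
Proof.
rewrite /face_base !nerve_map_entry.
by case: ifP => _; rewrite ?hom_src ?hom_rng.
Qed.

Lemma nerve_lift_incl n (x : nerve G' n) : injective p ->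
  (forall k, (k < n.-1.+1)%N -> exists g, p g = entry x k) ->
  exists t, nerve_map p n t = x.
Proof.
move=> pinj lift; case: n x lift => [|n] x lift.
  have [g gx] := lift 0 isT.
  have [|t tg] := @nerve_exists0 _ G g.
    by apply: pinj; rewrite hom_rng gx entry_unit.
  exists t; apply: nerve_eqP => k kn; have -> : k = 0 by lia.
  by rewrite nerve_map_entry tg.
have /choice[v vx] : forall k, exists g, (k <= n)%N -> p g = entry x k.
  move=> k; have [kn|kn] := leqP k n; first by have [g] := lift k kn; exists g.
  by have [g _] := lift 0 isT; exists g.
have [k kn|t tv] := @nerve_existsS _ G n v.
  apply: pinj; rewrite hom_src hom_rng !vx; [|lia|lia].
  exact: entry_comp.
exists t; apply: nerve_eqP => k kn.
by rewrite nerve_map_entry tv// vx.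
Qed.

Hypothesis pb : fibrewise_bijective p.

Lemma face_cartesian n (i : 'I_n.+2) :
  cartesian (@nerve_face _ G n i) (@nerve_face _ G' n i)
    (nerve_map p n.+1) (nerve_map p n).
Proof.
split.
- by move=> t; exact: nerve_map_face.
- move=> x y' xy; have [_ _ /(_ (face_key i y'))] := pb (face_base_unit i x).
  case=> [|g /= gx gy].
    by rewrite /= face_key_rng xy nerve_map_base.
  have [t [tx tg]] := face_exists gx; exists t => //.
  apply: (@face_inj _ _ _ i); first by rewrite -nerve_map_face tx.
  by rewrite nerve_map_key tg.
- move=> t u tu ptu; apply: (face_inj tu).
  apply: (fibrewise_inj pb); first by rewrite !face_key_rng tu.
  by rewrite -!nerve_map_key ptu.
Qed.

(** A tuple is determined by one of its arrows and its image: the other arrows are lifted one after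
    another. This reduces statements on [nerve_map p n] to statements on [p]. *)
Lemma entry_cartesian n k : (k < n.-1.+1)%N ->
  cartesian (fun t : nerve G n => entry t k) (fun t : nerve G' n => entry t k)
    (nerve_map p n) p.
Proof.
case: n k => [|n] k kn.
  have -> : k = 0 by lia.
  split=> // [g t' tg|t u tu _].
    have [|t tg'] := @nerve_exists0 _ G g.
      apply: (fibrewise_inj pb); first by rewrite grng_rng.
      by rewrite hom_rng -tg entry_unit.
    exists t => //; apply: nerve_eqP => l ln; have -> : l = 0 by lia.
    by rewrite nerve_map_entry tg' tg.
  by apply: nerve_eqP => l ln; have -> : l = 0 by lia.
elim: n k kn => [|n IH] k kn.
  have -> : k = 0 by lia.
  split=> // [g t' tg|t u tu _].
    have [//|t tg'] := @nerve_existsS _ G 0 (fun=> g).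
    exists t => //; first exact: tg'.
    apply: nerve_eqP => l ln; have -> : l = 0 by lia.
    by rewrite nerve_map_entry tg' ?tg.
  by apply: nerve_eqP => l ln; have -> : l = 0 by lia.
(* A face that keeps entry [k]: the last one if [k] is not the last index, otherwise the first one,
   which shifts the index down by 1. *)
have [i [l [ln ik]]] : exists (i : 'I_n.+3) l, (l < n.+1)%N /\
    forall (S : topologicalType) (H : groupoid S) (t : nerve H n.+2),
    entry (nerve_face i t) l = entry t k.
  have [kn'|kn'] := ltnP k n.+1.
    exists ord_max, k; split=> // S H t; rewrite nerve_faceSE//.
    by rewrite /face_entry ifT//=; lia.
  exists ord0, n; split=> // S H t; rewrite nerve_faceSE//.
  by rewrite /face_entry /=; congr entry; lia.
have C := IH l ln; have D := face_cartesian i.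
split=> // [g t' tg|t u tu ptu].
  have [|x xg xt] := cart_lift C (x := g) (y' := nerve_face i t').
    by rewrite ik.
  have [|t tx tt] := cart_lift D (x := x) (y' := t'); first by rewrite xt.
  by exists t => //; rewrite -ik tx.
apply: (cart_inj D) => //; apply: (cart_inj C); first by rewrite !ik.
by rewrite !nerve_map_face ptu.
Qed.

End NerveHom.

Lemma initial_cvgP (S : choiceType) (T : topologicalType) (f : S -> T)
    (F : set_system S) (s : S) : Filter F ->
  F --> (s : initial_topology f) <-> f @ F --> f s.
Proof.
move=> FF; split=> [Fs U sU|Fs U].
  by apply: (Fs (f @^-1` U)); exact: (@initial_continuous S T f s U sU).
rewrite nbhsE => -[V [[W oW <-] /= Ws] WU].
by apply: filterS WU _; apply: (Fs W); exact: open_nbhs_nbhs.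
Qed.

Lemma eq_fun_cvg I (T : topologicalType) (f g : I -> T) (F : set_system I) (l : T) :
  f =1 g -> g @ F --> l -> f @ F --> l.
Proof. by move=> /funext ->. Qed.

Lemma nerve_cvgP (T : topologicalType) (G : groupoid T) n
    (F : set_system (nerve G n)) (t : nerve G n) : Filter F ->
  F --> t <-> forall k, (k < n.-1.+1)%N -> (fun u => entry u k) @ F --> entry t k.
Proof.
move=> FF; split=> [|Ft].
  move/(@initial_cvgP _ _ (@nerve_val T G n) F t FF) => Ft k kn.
  move/cvg_sup/(_ (inord k))/initial_cvgP : Ft; exact.
apply/(@initial_cvgP _ _ (@nerve_val T G n) F t FF).
apply/cvg_sup => k; apply/initial_cvgP; have := Ft k (ltn_ord k).
by rewrite /entry inord_val.
Qed.

(** * Topology of the nerves of an étale groupoid *)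

Section EtaleFacts.
Variables (T : topologicalType) (G : groupoid T).
Hypothesis eG : etale_groupoid G.

Let hT : hausdorff_space T := etale_hausdorff eG.

Lemma ginv_cvg I (F : set_system I) (a : I -> T) g : Filter F ->
  a @ F --> g -> (fun i => ginv G (a i)) @ F --> ginv G g.
Proof.
by move=> FF Fa U gU; exact: (Fa _ (etale_inv_continuous eG gU)).
Qed.

(** Continuity of the product is known within the composable pairs only, so the pairs along the
    filter must be composable. *)
Lemma gmul_cvg I (F : set_system I) (a b : I -> T) g h : Filter F ->
  a @ F --> g -> b @ F --> h -> gsrc G g = grng G h ->
  (forall i, gsrc G (a i) = grng G (b i)) ->
  (fun i => gmul G (a i) (b i)) @ F --> gmul G g h.
Proof.
move=> FF Fa Fb gh ab U ghU.
pose S := [set gh : T * T | gsrc G gh.1 = grng G gh.2].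
have /subspace_continuousP/(_ (g, h) gh _ ghU) := etale_mul_continuous eG.
move=> [[V W] /= [gV hW] VW].
have FV : F (a @^-1` V) := Fa _ gV; have FW : F (b @^-1` W) := Fb _ hW.
change (F [set i | U (gmul G (a i) (b i))]).
by apply: filterS2 FV FW => i Vi Wi; exact: (VW (a i, b i) (conj Vi Wi) (ab i)).
Qed.

Lemma grng_continuous : continuous (grng G).
Proof.
move=> g; apply: (@gmul_cvg _ _ id (ginv G)).
- exact: cvg_id.
- exact: (etale_inv_continuous eG).
- by rewrite grngV.
- by move=> i; rewrite grngV.
Qed.

Lemma gsrc_continuous : continuous (gsrc G).
Proof.
move=> g U gU; have gU' : nbhs (grng G (ginv G g)) U by rewrite grngV.
have : nbhs g [set h | U (grng G (ginv G h))] :=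
  etale_inv_continuous eG (grng_continuous gU').
by apply: filterS => h; rewrite /= grngV.
Qed.

Lemma grng_local_inj (g : T) : exists2 U, nbhs g U &
  forall a b, U a -> U b -> grng G a = grng G b -> a = b.
Proof.
have [_ /(_ g)[U [oU Ug injU _]]] := etale_rng_local_homeomorphism eG.
exists U; first exact: open_nbhs_nbhs.
move=> a b Ua Ub ab; apply: injU; rewrite ?inE//.
exact: val_inj.
Qed.

Lemma grng_local_surj (g : T) V : nbhs g V -> exists2 W, nbhs (grng G g) W &
  forall e, gunits G e -> W e -> exists2 h, V h & grng G h = e.
Proof.
have [_ /(_ g)[U [oU Ug injU imU]]] := etale_rng_local_homeomorphism eG.
move=> gV; have [|W oW WE] := imU (U `&` V°) _ (@subIsetl _ _ _).
  by apply: openI => //; exact: open_interior.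
exists W.
  apply: open_nbhs_nbhs; split=> //.
  have : (grng_unit G @` (U `&` V°)) (grng_unit G g) by exists g.
  by rewrite -WE.
move=> e ue We.
have : (set_val @^-1` W) (exist _ e (mem_set ue) : gunits G) by [].
rewrite WE => -[h [_ /interior_subset Vh] he]; exists h => //.
exact: (congr1 val he).
Qed.

Lemma nerve_limit n (F : set_system (nerve G n)) (a : nat -> T) : ProperFilter F ->
  (forall k, (k < n.-1.+1)%N -> (fun u => entry u k) @ F --> a k) ->
  exists2 t : nerve G n, F --> t & forall k, (k < n.-1.+1)%N -> entry t k = a k.
Proof.
move=> PF Fa.
suff [t ta] : exists t : nerve G n, forall k, (k < n.-1.+1)%N -> entry t k = a k.
  by exists t => //; apply/nerve_cvgP => k kn; rewrite ta//; exact: Fa.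
case: n F PF Fa => [|n] F PF Fa.
  have [|t ta] := @nerve_exists0 _ G (a 0).
    have F0 := Fa 0 isT.
    apply: (hausdorff_cvg_unique hT (F := (fun u => entry u 0) @ F)) => //.
    move=> U aU; change (F [set u | U (entry u 0)]).
    have : F [set u | U (grng G (entry u 0))] := F0 _ (grng_continuous aU).
    by apply: filterS => u; rewrite /= entry_unit.
  by exists t => k kn; have -> : k = 0 by lia.
have [k kn|t ta] := @nerve_existsS _ G n a.
  have Fk := Fa k (ltnW kn); have Fk1 := Fa k.+1 kn.
  apply: (hausdorff_cvg_unique hT (F := (fun u => gsrc G (entry u k)) @ F)).
    by move=> U aU; exact: (Fk _ (gsrc_continuous aU)).
  move=> U aU; change (F [set u | U (gsrc G (entry u k))]).
  have : F [set u | U (grng G (entry u k.+1))] := Fk1 _ (grng_continuous aU).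
  by apply: filterS => u; rewrite /= entry_comp.
by exists t.
Qed.

Lemma entry_continuous n k : (k < n.-1.+1)%N ->
  continuous (fun t : nerve G n => entry t k).
Proof. by move=> kn t; apply: (nerve_cvgP t (nbhs_filter t)).1. Qed.

Lemma nerve_hausdorff n : hausdorff_space (nerve G n).
Proof.
move=> t u tu; apply: nerve_eqP => k kn; apply: hT => U V tU uV.
have [w [Uw Vw]] := tu _ _ (entry_continuous kn tU) (entry_continuous kn uV).
by exists (entry w k).
Qed.

Lemma nerve_near n (t : nerve G n) (C : nat -> set T) :
  (forall k, (k < n.-1.+1)%N -> nbhs (entry t k) (C k)) ->
  nbhs t [set u | forall k, (k < n.-1.+1)%N -> C k (entry u k)].
Proof.
move=> tC.
have : \forall u \near t, forall k : 'I_n.-1.+1, C k (entry u k).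
  apply: (@filter_forall _ _
    (fun k : 'I_n.-1.+1 => [set u : nerve G n | C k (entry u k)])
    (nbhs t) (nbhs_filter t)) => k.
  exact: (entry_continuous (ltn_ord k) (tC k (ltn_ord k))).
by apply: filterS => u uC k kn; exact: (uC (Ordinal kn)).
Qed.

Lemma nerve_nbhs n (t : nerve G n) (U : set (nerve G n)) : nbhs t U ->
  exists2 C : nat -> set T, forall k, nbhs (entry t k) (C k) &
    [set u | forall k, (k < n.-1.+1)%N -> C k (entry u k)] `<=` U.
Proof.
pose F : set_system (nerve G n) := [set S | exists2 C : nat -> set T,
  forall k, nbhs (entry t k) (C k) &
  [set u | forall k, (k < n.-1.+1)%N -> C k (entry u k)] `<=` S].
have FF : Filter F.
  split.
  - by exists (fun=> setT) => // k; exact: filterT.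
  - move=> A B [C tC CA] [D tD DB]; exists (fun k => C k `&` D k).
      by move=> k; exact: filterI.
    by move=> u CD; split; [apply: CA|apply: DB] => k /CD[].
  - by move=> A B AB [C tC CA]; exists C => // u /CA /AB.
have Ft : F --> t.
  apply/nerve_cvgP => k kn V tV; exists (fun l => if l == k then V else setT).
    by move=> l; case: eqP => [->//|_]; exact: filterT.
  by move=> u /(_ k kn); rewrite eqxx.
exact: Ft.
Qed.

(** Boxes of compact open sets: they are compact because limits of composable tuples are composable,
    by [nerve_limit]. *)
Lemma nerve_compact_open_basis n : compact_open_basis T ->
  compact_open_basis (nerve G n).
Proof.
move=> bT t U /nerve_nbhs[C tC CU].
have /choice[D DP] : forall k, exists D, [/\ compact_open D, D (entry t k) & D `<=` C k].
  by move=> k; exact: bT.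
exists [set u | forall k, (k < n.-1.+1)%N -> D k (entry u k)]; split.
- split.
    apply/compact_ultraP => F UF FD.
    have /choice[a aP] : forall k, exists a, (k < n.-1.+1)%N ->
        D k a /\ (fun u => entry u k) @ F --> a.
      move=> k; have [kn|kn] := ltnP k n.-1.+1; last by exists (entry t k).
      have [[cD _] _ _] := DP k.
      have [|a Da Fa] := (compact_ultraP (D k)).1 cD _ (fmap_ultra (fun u => entry u k) UF).
        by change (F [set u | D k (entry u k)]); apply: filterS FD => u /(_ k kn).
      by exists a.
    have [|u Fu ua] := @nerve_limit n F a _; first by move=> k kn; have [] := aP k kn.
    exists u => // k kn; rewrite ua//; by have [] := aP k kn.
  rewrite openE => u Du; apply: nerve_near => k kn.
  by have [[_ oD] _ _] := DP k; apply: open_nbhs_nbhs; split=> //; exact: Du.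
- by move=> k _; have [] := DP k.
- by move=> u Du; apply: CU => k kn; have [_ _] := DP k; apply; exact: Du.
Qed.

Section Faces.
Variables (n : nat) (i : 'I_n.+2).

Lemma face_continuous : continuous (@nerve_face _ G n i).
Proof.
move=> t; have Ff := fmap_filter (@nerve_face _ G n i) (nbhs_filter t).
apply/nerve_cvgP => k kn {Ff}.
have cE l (ln : (l < n.+1)%N) := @entry_continuous n.+1 l ln t.
have tc := @entry_comp _ _ _ t.
case: n i t k kn cE tc => [|m] j t k kn cE tc.
  have -> : k = 0 by lia.
  change ((fun u => entry (nerve_face j u) 0) @ nbhs t --> entry (nerve_face j t) 0).
  apply: eq_fun_cvg (fun u => nerve_face0E j u) _; rewrite nerve_face0E.
  case: ifP => _ U tU.
    exact: (cE 0 isT _ (gsrc_continuous tU)).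
  exact: (cE 0 isT _ (grng_continuous tU)).
change ((fun u => entry (nerve_face j u) k) @ nbhs t --> entry (nerve_face j t) k).
apply: eq_fun_cvg (fun u => nerve_faceSE j u kn) _; rewrite nerve_faceSE//.
rewrite /face_entry; case: ifP => kj.
  by apply: cE; lia.
case: eqP => kj'; last by apply: cE; lia.
apply: (@gmul_cvg _ _ (fun u : nerve G m.+2 => entry u k) (fun u => entry u k.+1)).
- by apply: cE; lia.
- by apply: cE; lia.
- by apply: tc; lia.
- by move=> u; apply: entry_comp; lia.
Qed.

Lemma face_key_continuous : continuous (fun t : nerve G n.+1 => face_key i t).
Proof.
move=> t; rewrite /face_key; have [i0|i0] := eqVneq (i : nat) 0.
  exact: ginv_cvg (@entry_continuous n.+1 0 isT t).
by apply: (@entry_continuous n.+1); have := ltn_ord i; lia.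
Qed.

Lemma face_base_continuous : continuous (fun x : nerve G n => face_base i x).
Proof.
move=> x U; rewrite /face_base; have li := ltn_ord i.
have [i0|i0] := eqVneq (i : nat) n.+1 => xU.
  have ln : (n.-1 < n.-1.+1)%N by [].
  exact: (entry_continuous ln (gsrc_continuous xU)).
have ln : (i.-1 < n.-1.+1)%N by lia.
exact: (entry_continuous ln (grng_continuous xU)).
Qed.

(** The reconstruction of a tuple from its face and key is continuous. *)
Lemma face_cvg I (F : set_system I) (a : I -> nerve G n.+1) (t : nerve G n.+1) :
  Filter F -> (fun j => nerve_face i (a j)) @ F --> nerve_face i t ->
  (fun j => face_key i (a j)) @ F --> face_key i t -> a @ F --> t.
Proof.
move=> FF Fd Fk; apply/nerve_cvgP => k kn.
have li := ltn_ord i.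
have Fe l : (l < n.-1.+1)%N ->
    (fun j => entry (nerve_face i (a j)) l) @ F --> entry (nerve_face i t) l.
  by move=> ln; exact: ((nerve_cvgP _ (fmap_filter _ FF)).1 Fd l ln).
change ((fun j => entry (a j) k) @ F --> entry t k).
apply: eq_fun_cvg (fun j => face_recK i (a j) kn) _; rewrite (face_recK i)//.
rewrite /face_rec; have [i0|i0] := eqVneq (i : nat) 0.
  have [k0|k0] := eqVneq k 0; first exact: ginv_cvg.
  by apply: Fe; lia.
case: (ltnP k i.-1) => ki; first by apply: Fe; lia.
have [ki1//|ki1] := eqVneq k i.-1.
have [ki2|ki2] := eqVneq k (i : nat); last by apply: Fe; lia.
have base (x : nerve G n) : face_base i x = grng G (entry x i.-1).
  rewrite /face_base ifF//; apply/eqP => im.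
  by move: kn; rewrite ki2 im /= ltnn.
apply: gmul_cvg.
- exact: ginv_cvg.
- by apply: Fe; lia.
- by rewrite gsrcV face_key_rng base.
- by move=> j; rewrite gsrcV face_key_rng base.
Qed.

(** The range map being open onto the units, each tuple near the given face has an extending key
    near the given key; the range map being locally injective, this key is unique. So the extended
    tuples form a convergent local section. *)
Lemma face_etale : etale_map (@nerve_face _ G n i).
Proof.
split; first exact: face_continuous.
- move=> t V tV; have [U gU injU] := grng_local_inj (face_key i t).
  pose P (x : nerve G n) (v : nerve G n.+1) := nerve_face i v = x /\ U (face_key i v).
  have /choice[s sP] : forall x, exists v, (exists v, P x v) -> P x v.
    move=> x; have [[v Pv]|nP] := pselect (exists v, P x v); first by exists v.
    by exists t.
  have key W : nbhs (face_key i t) W ->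
      \forall x \near nerve_face i t, P x (s x) /\ W (face_key i (s x)).
    move=> tW; have [O gO OP] := grng_local_surj (filterI tW gU).
    rewrite face_key_rng in gO.
    have : nbhs (nerve_face i t) [set x | O (face_base i x)] := face_base_continuous gO.
    apply: filterS => x Ox; have [g [Wg Ug] gx] := OP _ (face_base_unit i x) Ox.
    have [v [vx vg]] := face_exists gx.
    have Ps : P x (s x) by apply: sP; exists v; rewrite /P vx vg.
    split=> //; suff -> : face_key i (s x) = g by [].
    by case: Ps => sx Us; apply: injU => //; rewrite face_key_rng sx gx.
  have st : s @ nbhs (nerve_face i t) --> t.
    apply: face_cvg.
      move=> W tW; have keyT := key setT (@filterT _ _ (nbhs_filter _)).
      change (nbhs (nerve_face i t) [set x | W (nerve_face i (s x))]).
      by apply: filterS2 tW keyT => x Wx [[/= -> _] _].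
    move=> W /key keyW; change (nbhs (nerve_face i t) [set x | W (face_key i (s x))]).
    by apply: filterS keyW => x [].
  have sV : nbhs (nerve_face i t) (s @^-1` V) := st _ tV.
  by apply: filterS2 sV (key setT (@filterT _ _ (nbhs_filter _))) => x Vs [[sx _] _]; exists (s x).
- move=> t; have [U gU injU] := grng_local_inj (face_key i t).
  exists [set v | U (face_key i v)]; first exact: face_key_continuous.
  move=> a b Ua Ub ab; apply: (face_inj ab); apply: injU => //.
  by rewrite !face_key_rng ab.
Qed.

End Faces.

End EtaleFacts.

Section NerveDistance.
Variables (R : realType) (T : metricType R) (G : groupoid T).

Lemma metric_distance_for : distance_for (@mdist R T).
Proof.
split; [exact: mdist_ge0|exact: metric_sym|exact: metric_triangle|].
move=> x U; split.
  move=> /nbhs_ballP[e e0 eU]; exists e => //.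
  by rewrite -ballEmdist.
by move=> [e e0 eU]; apply/nbhs_ballP; exists e => //; rewrite ballEmdist.
Qed.

Lemma nerve_distance_for n : distance_for (nerve_dist (@mdist R T) G n).
Proof.
pose D := metric_distance_for.
split.
- by move=> t u; apply: sumr_ge0 => i _; exact: mdist_ge0.
- by move=> t u; apply: eq_bigr => i _; exact: metric_sym.
- move=> t u v; rewrite /nerve_dist -big_split/=; apply: ler_sum => i _.
  exact: metric_triangle.
move=> t U; split=> [tU|[e e0 eU]].
  pose F : set_system (nerve G n) :=
    [set S | exists2 e : R, 0 < e & [set u | nerve_dist (@mdist R T) G n t u < e] `<=` S].
  have FF : Filter F.
    split.
    - by exists 1.
    - move=> A B [e e0 eA] [e' e'0 eB]; exists (Num.min e e'); first by rewrite lt_min e0.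
      by move=> u /=; rewrite lt_min => /andP[? ?]; split; [exact: eA|exact: eB].
    - by move=> A B AB [e e0 eA]; exists e => // u /eA /AB.
  suff Ft : F --> t by exact: Ft.
  apply/nerve_cvgP => k kn V /(dist_nbhs D)[e e0 eV]; exists e => // u /= tu.
  apply: eV => /=; apply: le_lt_trans tu.
  rewrite /nerve_dist (bigD1 (inord k))//= lerDl; apply: sumr_ge0 => i _.
  exact: mdist_ge0.
(* The tolerance [e] is divided equally among the [n.-1.+1] entries. *)
have n0 : 0 < n.-1.+1%:R :> R by rewrite ltr0n.
apply: filterS (nerve_near (t := t) (C := fun k => [set y | mdist (entry t k) y < e / n.-1.+1%:R]) _).
  move=> u ud; apply: eU => /=; rewrite /nerve_dist.
  have -> : e = \sum_(i < n.-1.+1) e / n.-1.+1%:R.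
    by rewrite sumr_const card_ord -[RHS]mulr_natr mulfVK// lt0r_neq0.
  apply: ltr_sum => [|i _]; last by rewrite !nerve_val_entry; exact: ud.
  by apply/hasP; exists ord0; rewrite ?mem_index_enum.
by move=> k kn; apply: (dist_ball_nbhs D); rewrite divr_gt0.
Qed.

End NerveDistance.

Section NerveMap.
Variables (T T' : topologicalType) (G : groupoid T) (G' : groupoid T').
Variable p : groupoid_hom G G'.
Hypotheses (eG : etale_groupoid G) (pb : fibrewise_bijective p) (pp : perfect_map p).

Lemma nerve_map_perfect n : perfect_map (nerve_map p n).
Proof.
have [cp sp up] := pp; split.
- move=> t; have Ff := fmap_filter (nerve_map p n) (nbhs_filter t).
  apply/nerve_cvgP => k kn {Ff}.
  change ((fun u => p (entry u k)) @ nbhs t --> p (entry t k)).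
  by move=> U tU; exact: (entry_continuous kn (cp _ _ tU)).
- move=> t'; have [g gt] := sp (entry t' 0).
  by have [|t _ tt'] := cart_lift (@entry_cartesian _ _ _ _ _ pb n 0 isT) (x := g) (y' := t'); [|exists t].
- move=> F t' UF Ft'; have Up := fmap_ultra (nerve_map p n) UF.
  have /choice[a aP] : forall k, exists a, (k < n.-1.+1)%N ->
      p a = entry t' k /\ (fun u => entry u k) @ F --> a.
    move=> k; have [kn|kn] := ltnP k n.-1.+1; last by have [g _] := sp (entry t' 0); exists g.
    have [|a pa Fa] := up ((fun u => entry u k) @ F) (entry t' k) (fmap_ultra _ UF).
      have := (nerve_cvgP _ _).1 Ft' k kn; exact.
    by exists a.
  have [|t Ft ta] := @nerve_limit _ _ eG n F a _; first by move=> k /aP[].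
  exists t => //; apply: nerve_eqP => k kn.
  by rewrite nerve_map_entry ta//; have [] := aP k kn.
Qed.

Lemma nerve_map_ultra_regular n : ultra_regular p -> ultra_regular (nerve_map p n).
Proof.
apply: (cart_ultra_regular (@entry_cartesian _ _ _ _ _ pb n 0 isT)).
- exact: nerve_map_perfect.
- exact: etale_hausdorff eG.
- exact: entry_continuous.
- exact: entry_continuous.
Qed.

End NerveMap.

(** * Nerves of the reduced groupoids as reduction models *)

Section NerveModel.
Variables (R : realType) (T T' : topologicalType) (d : T -> T -> R).
Variables (G : groupoid T) (G' : groupoid T') (p : groupoid_hom G G').
Hypotheses (eG : etale_groupoid G) (pb : fibrewise_bijective p).
Hypotheses (pp : perfect_map p) (D : distance_for d).

Definition red_val' (y : red' d p) : T' := val (y : set_type (multi' p)).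

Lemma red_comp'P (g h : red' d p) :
  gsrc (red_groupoid' d pb) g = grng (red_groupoid' d pb) h ->
  gsrc G' (red_val' g) = grng G' (red_val' h).
Proof. by move=> gh; exact/(sub_compP (multi'_closed pb) g h). Qed.

Lemma red_val'M (g h : red' d p) :
  gsrc (red_groupoid' d pb) g = grng (red_groupoid' d pb) h ->
  red_val' (gmul (red_groupoid' d pb) g h) = gmul G' (red_val' g) (red_val' h).
Proof. by move=> /red_comp'P gh; exact: (val_sub_mul (multi'_closed pb)). Qed.

Definition red_incl' : groupoid_hom (red_groupoid' d pb) G' :=
  GroupoidHom red_comp'P red_val'M.

Let M : reduction_model p (@red_val _ _ _ d p) red_val' (@red_map _ _ _ d p) :=
  red_model D pp.

(** All conditions are checked entrywise. For the convergence of fibres, nearby points in the fibres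
    of [p] have to be lifted to whole tuples: they are lifted from entry 0, and [cart_near] shows
    that a tuple is near [b] once its entry 0 and its image are near those of [b]. *)
Lemma nerve_model n : reduction_model (nerve_map p n)
  (nerve_map (red_incl d pb) n) (nerve_map red_incl' n) (nerve_map (red_hom d pb) n).
Proof.
have C k kn := @entry_cartesian _ _ _ _ _ pb n k kn.
have pn := nerve_map_perfect eG pb pp n.
split.
- move=> t u tu; apply: nerve_eqP => k kn; apply: (model_inj M).
  exact: (congr1 (fun t => entry t k) tu).
- move=> t u tu; apply: nerve_eqP => k kn; apply: (model_inj' M).
  exact: (congr1 (fun t => entry t k) tu).
- by move=> y; exact: nerve_eqP.
- move=> x'; split=> [xm|[y' <-]].
    apply: nerve_lift_incl; first exact: (model_inj' M).
    move=> k kn; apply/(model_multi M); exact/(cart_multi x' (C k kn)).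
  apply/(cart_multi _ (C 0 isT)); apply/(model_multi M).
  by exists (entry y' 0).
- move=> x y' xy.
  have [|y yx] := @nerve_lift_incl _ _ _ _ (red_incl d pb) n x (model_inj M).
    move=> k kn; have [|y yx _] := model_lift M (x := entry x k) (y' := entry y' k).
      exact: (congr1 (fun t => entry t k) xy).
    by exists y.
  exists y => //; apply: nerve_eqP => k kn; apply: (model_inj' M).
  by have := congr1 (fun t => entry t k) xy; rewrite -yx.
- move=> F t FF; split=> [Ft|[iF qF]].
    have Ftk k (kn : (k < n.-1.+1)%N) :=
      (model_cvg M _ (fmap_filter _ FF)).1 ((nerve_cvgP t FF).1 Ft k kn).
    split; apply/(nerve_cvgP _ (fmap_filter _ FF)) => k kn.
      exact: (Ftk k kn).1.
    exact: (Ftk k kn).2.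
  apply/nerve_cvgP => k kn; apply/(model_cvg M); split.
    exact: ((nerve_cvgP _ (fmap_filter _ FF)).1 iF k kn).
  exact: ((nerve_cvgP _ (fmap_filter _ FF)).1 qF k kn).
- move=> F t' FF; split=> [Ft b V bt bV|FV].
    have Ftk k (kn : (k < n.-1.+1)%N) := (nerve_cvgP t' FF).1 Ft k kn.
    have jF : nerve_map red_incl' n @ F --> nerve_map red_incl' n t'.
      apply/(nerve_cvgP _ (fmap_filter _ FF)) => k kn.
      exact: (model_cvgW' M pp (fmap_filter _ FF) (Ftk k kn)).
    have [V0 bV0] := cart_near (C 0 isT) pn (etale_hausdorff eG)
      (entry_continuous (isT : (0 < n.-1.+1)%N)) bV.
    rewrite bt => /jF near_b.
    have F1 : F [set u | forall w, nerve_map p n w = nerve_map red_incl' n u ->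
      V0 (entry w 0) -> V w] := near_b.
    have F2 : F [set u | (p @` V0) (red_val' (entry u 0))].
      apply: ((model_cvg' M _ (fmap_filter _ FF)).1 (Ftk 0 isT) (entry b 0) V0 _ bV0).
      exact: (congr1 (fun t => entry t 0) bt).
    apply: filterS2 F1 F2 => u uV [x V0x xu].
    have [|w wx wu] := cart_lift (C 0 isT) (x := x) (y' := nerve_map red_incl' n u).
      by rewrite xu.
    by exists w => //; apply: uV; rewrite ?wx.
  apply/nerve_cvgP => k kn; apply/(model_cvg' M) => x V xt xV.
  have [|b bx bt] := cart_lift (C k kn) (x := x) (y' := nerve_map red_incl' n t').
    by rewrite xt.
  have bV : nbhs b [set t | V (entry t k)].
    by apply: (entry_continuous kn); rewrite bx.
  change (F [set u | (p @` V) (red_val' (entry u k))]).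
  have : F [set u | (nerve_map p n @` [set t | V (entry t k)]) (nerve_map red_incl' n u)] :=
    FV b _ bt bV.
  apply: filterS => u [w Vw wu]; exists (entry w k) => //.
  exact: (congr1 (fun t => entry t k) wu).
Qed.

End NerveModel.

(** * Chain complexes *)

Section AlternatingSum.
Variables (V : zmodType) (m : nat) (F : nat -> nat -> V).
Hypothesis FC : forall i j, (i <= j)%N -> (j < m)%N -> F i j.+1 = F j i.

(** The signed terms satisfy [H i j.+1 = - H j i] for [i <= j], so the half with [j <= i] cancels
    the other half. *)
Lemma alternating_sum0 :
  \sum_(i < m) (\sum_(j < m.+1) F i j *~ (-1) ^+ j) *~ (-1) ^+ i = 0.
Proof.
pose H i j := F i j *~ (-1) ^+ (i + j).
have HC i j : (i <= j)%N -> (j < m)%N -> H i j.+1 = - H j i.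
  by move=> ij jm; rewrite /H FC// addnS exprS mulN1r mulrNz addnC.
transitivity (\sum_(i < m) ((\sum_(j < m) if (j <= i)%N then H i j else 0) +
    \sum_(j < m) if (i <= j)%N then H i j.+1 else 0)).
  apply: eq_bigr => i _.
  transitivity (\sum_(j < m.+1) ((if (j <= i)%N then H i j else 0) +
      (if (i < j)%N then H i j else 0))).
    rewrite mulrz_suml; apply: eq_bigr => j _.
    rewrite -mulrzA -exprD addnC -/(H i j).
    by case: ltnP => _; rewrite ?addr0 ?add0r.
  rewrite big_split/=; congr (_ + _).
    by rewrite big_ord_recr/= leqNgt ltn_ord addr0.
  by rewrite big_ord_recl/= add0r.
rewrite big_split/= [X in _ + X]exchange_big/= -big_split/= big1// => i _.
rewrite -big_split/= big1// => j _.
by case: ifP => ij; rewrite ?addr0// HC// subrr.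
Qed.

End AlternatingSum.

(** The input of the chain complex; the reduced groupoids acquire it by transfer through models. *)
Record ample_nerve (T : topologicalType) (G : groupoid T) : Prop := AmpleNerve {
  ample_hausdorff : forall n, hausdorff_space (nerve G n);
  ample_basis : forall n, compact_open_basis (nerve G n);
  ample_face : forall n (i : 'I_n.+2), etale_map (@nerve_face T G n i)
}.

Section CcSums.
Variables (X : topologicalType) (A : zmodType).

Lemma Cc_sumE I (r : seq I) (F : I -> Cc X A) x :
  (\sum_(i <- r) F i) x = \sum_(i <- r) F i x.
Proof.
by apply: (big_morph (fun f : Cc X A => f x)) => [f g|]; rewrite ?CcDE ?Cc0E.
Qed.

Lemma CcMzE (f : Cc X A) (z : int) x : (f *~ z) x = f x *~ z.
Proof.
have nat_case n : (f *~ Posz n) x = f x *~ Posz n.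
  rewrite -!pmulrn; elim: n => [|n IH]; first by rewrite !mulr0n Cc0E.
  by rewrite !mulrS CcDE IH.
case: z => n; first exact: nat_case.
by rewrite NegzE !mulrNz -nat_case -[in LHS]sub0r CcBE Cc0E sub0r.
Qed.

End CcSums.

Section GroupoidChain.
Variables (T : topologicalType) (G : groupoid T) (A : zmodType).
Hypothesis aG : ample_nerve G.

Lemma push_Cc_face n (i : 'I_n.+2) (f : Cc (nerve G n.+1) A) :
  (forall x, finite_set [set y | nerve_face i y = x /\ f y != 0]) /\
  push (nerve_face i) f \in @Cc_pred (nerve G n) A.
Proof.
apply: push_Cc; [exact: ample_face|exact: ample_hausdorff|exact: ample_hausdorff|].
exact: ample_basis.
Qed.

Definition face_push n (i : 'I_n.+2) (f : Cc (nerve G n.+1) A) : Cc (nerve G n) A :=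
  to_Cc (push (nerve_face i) f).

Lemma face_pushE n (i : 'I_n.+2) (f : Cc (nerve G n.+1) A) :
  (face_push i f : _ -> A) = push (nerve_face i) f.
Proof. by rewrite to_CcE//; have [] := push_Cc_face i f. Qed.

(** Writing the boundary as a sum inside [Cc] shows that [to_Cc] does not fall back to 0. *)
Lemma boundary_funE n (f : Cc (nerve G n.+1) A) :
  boundary_fun f = (\sum_(i < n.+2) face_push i f *~ (-1) ^+ i : Cc _ A).
Proof.
apply/funext => y; rewrite Cc_sumE /boundary_fun; apply: eq_bigr => i _.
rewrite CcMzE face_pushE; congr (_ *~ _).
(* [face] has values in all tuples, [nerve_face] in composable ones; over a composable tuple their
   fibres coincide. *)
apply: eq_fsbigl; apply/seteqP; split=> t /= ty; first exact: val_inj.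
exact: (congr1 (@nerve_val _ _ _) ty).
Qed.

Lemma boundaryE n (f : Cc (nerve G n.+1) A) :
  boundary f = \sum_(i < n.+2) face_push i f *~ (-1) ^+ i.
Proof.
apply: Cc_eqP => y; rewrite /boundary boundary_funE to_CcE//.
exact: (valP (\sum_(i < n.+2) face_push i f *~ (-1) ^+ i)).
Qed.

Lemma ample_boundary_defined n (f : Cc (nerve G n.+1) A) :
  (boundary f : _ -> A) = boundary_fun f.
Proof. by rewrite boundaryE boundary_funE. Qed.

Lemma face_pushB n (i : 'I_n.+2) : zmod_morphism (@face_push n i).
Proof.
move=> f g; apply: Cc_eqP => y; rewrite CcBE !face_pushE.
rewrite -pushB; [|exact: (push_Cc_face i f).1|exact: (push_Cc_face i g).1].
by congr push; apply/funext => t; rewrite CcBE.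
Qed.

Lemma boundaryB n : zmod_morphism (@boundary T G A n).
Proof.
move=> f g; rewrite !boundaryE -sumrB; apply: eq_bigr => i _.
by rewrite face_pushB mulrzBl.
Qed.

Lemma face_push_comp n (i : 'I_n.+2) (j : 'I_n.+3) (f : Cc (nerve G n.+2) A) :
  (face_push i (face_push j f) : _ -> A) = push (nerve_face i \o nerve_face j) f.
Proof.
apply/funext => y; rewrite !face_pushE push_comp//.
apply: (push_Cc _ _ _ _ f).1; [|exact: ample_hausdorff| exact: ample_hausdorff|].
  by apply: etale_map_comp; exact: ample_face.
exact: ample_basis.
Qed.

Lemma boundary_boundary n (f : Cc (nerve G n.+2) A) : boundary (boundary f) = 0.
Proof.
have face_push_Mz i (g : Cc (nerve G n.+1) A) z :
    face_push i (g *~ z) = face_push i g *~ z.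
  pose fp := GRing.isZmodMorphism.Build _ _ (@face_push n i) (@face_pushB n i).
  pose FP : {additive Cc (nerve G n.+1) A -> Cc (nerve G n) A} := HB.pack (@face_push n i) fp.
  exact: (raddfMz FP).
have face_push_sum i I (r : seq I) (g : I -> Cc (nerve G n.+1) A) :
    face_push i (\sum_(j <- r) g j) = \sum_(j <- r) face_push i (g j).
  pose fp := GRing.isZmodMorphism.Build _ _ (@face_push n i) (@face_pushB n i).
  pose FP : {additive Cc (nerve G n.+1) A -> Cc (nerve G n) A} := HB.pack (@face_push n i) fp.
  exact: (raddf_sum FP).
rewrite !boundaryE.
(* [inord] extends the family to natural indices; only indices in range enter the sums. *)
pose F i j := face_push (inord i : 'I_n.+2) (face_push (inord j : 'I_n.+3) f).
transitivity (\sum_(i < n.+2) (\sum_(j < n.+3) F i j *~ (-1) ^+ j) *~ (-1) ^+ i).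
  apply: eq_bigr => i _; congr (_ *~ _); rewrite face_push_sum.
  by apply: eq_bigr => j _; rewrite face_push_Mz /F !inord_val.
apply: alternating_sum0 => i j ij jn; apply/val_inj.
rewrite /F [LHS]face_push_comp [RHS]face_push_comp.
congr push; apply/funext => t /=.
by apply: nerve_faceC; rewrite !inordK//; lia.
Qed.

Lemma ample_complex : is_complex (groupoid_chain G A).
Proof. by split; [exact: boundaryB|exact: boundary_boundary]. Qed.

End GroupoidChain.

Section QuotientMaps.
Local Open Scope quotient_scope.
Variables (U V : zmodType) (I : zmodClosed U) (J : zmodClosed V) (F : U -> V).
Hypotheses (FB : zmod_morphism F) (FI : forall x, x \in I -> F x \in J).

Lemma quot_mapE x : quot_map F (\pi_(Quotient.quot I) x) = \pi_(Quotient.quot J) (F x).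
Proof.
apply/quot_eqP; rewrite -FB; apply: FI; apply/quot_eqP.
exact: reprK.
Qed.

Lemma quot_map_morph : zmod_morphism (quot_map F : Quotient.quot I -> Quotient.quot J).
Proof.
move=> x y; rewrite -[x]reprK -[y]reprK -raddfB !quot_mapE FB.
exact: raddfB.
Qed.

Lemma quot_eq0P (x : U) : \pi_(Quotient.quot I) x = 0 <-> x \in I.
Proof. by have := quot_eqP I x 0; rewrite subr0 raddf0. Qed.

End QuotientMaps.

Section ChainPullback.
Variables (T T' : topologicalType) (G : groupoid T) (G' : groupoid T').
Variables (p : groupoid_hom G G') (A : zmodType).
Hypotheses (aG : ample_nerve G) (aG' : ample_nerve G').
Hypothesis pp : forall n, perfect_map (nerve_map p n).
Hypothesis cp : forall n (i : 'I_n.+2), cartesian (@nerve_face _ G n i)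
  (@nerve_face _ G' n i) (nerve_map p n.+1) (nerve_map p n).

Local Notation proj := (@quot_chain_proj _ _ _ _ p A).

Lemma pullbackE n (f : Cc (nerve G' n) A) x :
  pullback (nerve_map p n) f x = f (nerve_map p n x).
Proof. by rewrite (perfect_pullback_defined (pp n)). Qed.

Lemma pullbackB n : zmod_morphism (@pullback _ _ (nerve_map p n) A).
Proof. by move=> f g; apply: Cc_eqP => x; rewrite !(CcBE, pullbackE). Qed.

(** Base change for each face. *)
Lemma boundary_pullback n (f : Cc (nerve G' n.+1) A) :
  boundary (pullback (nerve_map p n.+1) f) = pullback (nerve_map p n) (boundary f).
Proof.
apply: Cc_eqP => x; rewrite pullbackE !boundaryE// !Cc_sumE.
apply: eq_bigr => i _; rewrite !CcMzE !face_pushE//; congr (_ *~ _).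
rewrite -(push_cart _ _ (cp i)); congr push.
exact: (perfect_pullback_defined (pp n.+1)).
Qed.

Lemma pullback_subE n (f : Cc (nerve G n) A) :
  f \in @pullback_sub _ _ (nerve_map p n) A <-> exists g, f = pullback (nerve_map p n) g.
Proof.
split=> [/asboolP[g fg]|[g ->]].
  by exists g; apply: Cc_eqP => x; rewrite pullbackE fg.
by apply/asboolP; exists g; rewrite (perfect_pullback_defined (pp n)).
Qed.

Lemma boundary_sub n (f : Cc (nerve G n.+1) A) :
  f \in @pullback_sub _ _ (nerve_map p n.+1) A ->
  boundary f \in @pullback_sub _ _ (nerve_map p n) A.
Proof.
move=> /pullback_subE[g ->]; apply/pullback_subE; exists (boundary g).
exact: boundary_pullback.
Qed.

Lemma quot_chain_bdE n (f : Cc (nerve G n.+1) A) :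
  @chain_bd (quot_chain p A) n (proj f) = proj (boundary f).
Proof. by apply: quot_mapE; [exact: boundaryB|exact: boundary_sub]. Qed.

Lemma projB n : zmod_morphism (@quot_chain_proj _ _ _ _ p A n).
Proof. exact: raddfB. Qed.

Lemma proj_surj n (q : quot_chain p A n) : exists f, proj f = q.
Proof. by exists (Cc_repr q); exact: reprK. Qed.

Lemma quot_complex : is_complex (quot_chain p A).
Proof.
split=> n.
  by apply: quot_map_morph; [exact: boundaryB|exact: boundary_sub].
move=> x; have [f <-] := proj_surj x; rewrite !quot_chain_bdE.
by rewrite boundary_boundary//; exact: raddf0.
Qed.

Lemma quot_short_exact :
  short_exact (pullback_chain p (A := A)) (quot_chain_proj p (A := A)).
Proof.
split.
- by split=> n; [exact: pullbackB|move=> f; rewrite /pullback_chain/= boundary_pullback].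
- by split=> n; [exact: projB|move=> f; rewrite quot_chain_bdE].
move=> n; split.
- move=> f g fg; apply: Cc_eqP => x'; have [_ /(_ x')[x <-] _] := pp n.
  by rewrite -!pullbackE -[pullback _ f]/(pullback_chain p f) fg.
- have proj0 (f : Cc (nerve G n) A) :
      proj f = 0 <-> f \in @pullback_sub _ _ (nerve_map p n) A.
    exact: quot_eq0P.
  apply/seteqP; split=> [_ [g _ <-]|f /= /proj0 /pullback_subE[g ->]].
    by apply/proj0/pullback_subE; exists g.
  by exists g.
- by move=> q _; have [f fq] := proj_surj q; exists f.
Qed.

End ChainPullback.

Section ModelComparison.
Variables (X X' Y1 Y1' Y2 Y2' : topologicalType) (p : X -> X').
Variables (i1 : Y1 -> X) (j1 : Y1' -> X') (q1 : Y1 -> Y1').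
Variables (i2 : Y2 -> X) (j2 : Y2' -> X') (q2 : Y2 -> Y2').
Hypotheses (M1 : reduction_model p i1 j1 q1) (M2 : reduction_model p i2 j2 q2).
Variable h : Y1 -> Y2.
Hypothesis ih : forall y, i2 (h y) = i1 y.

Lemma comparison_base y : j2 (q2 (h y)) = j1 (q1 y).
Proof. by rewrite -(model_comm M2) ih (model_comm M1). Qed.

(** In any model convergence is expressed through [X] and [p] alone, so [h] is an embedding. It is
    applied to [nerve_red], along which the values of [reduction] are transported. *)
Lemma comparison_cvg (F : set_system Y1) (y : Y1) : Filter F ->
  F --> y <-> h @ F --> h y.
Proof.
move=> FF.
have Fi : i2 @ (h @ F) = i1 @ F.
  by change ((i2 \o h) @ F = i1 @ F); congr (_ @ F); apply/funext => z; exact: ih.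
have Fj : j2 @ (q2 @ (h @ F)) = j1 @ (q1 @ F).
  change ((fun z => j2 (q2 (h z))) @ F = (fun z => j1 (q1 z)) @ F).
  by congr (_ @ F); apply/funext => z; exact: comparison_base.
split=> [/(model_cvg M1)|/(model_cvg M2)] [iF qF].
  apply/(model_cvg M2); split; first by rewrite Fi ih.
  apply/(model_cvg' M2) => x V xy xV.
  rewrite comparison_base in xy.
  have := (model_cvg' M1 _ (fmap_filter _ FF)).1 qF x V xy xV.
  rewrite -[X in X -> _]/((j1 @ (q1 @ F)) (p @` V)) -Fj; exact.
apply/(model_cvg M1); split; first by rewrite -Fi -ih.
apply/(model_cvg' M1) => x V xy xV.
rewrite -comparison_base in xy.
have := (model_cvg' M2 _ (fmap_filter _ (fmap_filter _ FF))).1 qF x V xy xV.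
rewrite -[X in X -> _]/((j2 @ (q2 @ (h @ F))) (p @` V)) Fj; exact.
Qed.

Lemma comparison_surj y2 : exists y1, h y1 = y2.
Proof.
have : multi' p (p (i2 y2)).
  by apply/(model_multi M2); exists (q2 y2); rewrite (model_comm M2).
move=> /(model_multi M1)[y' jy'].
have [y1 y1y _] := model_lift M1 (esym jy').
by exists y1; apply: (model_inj M2); rewrite ih.
Qed.

Lemma comparison_perfect : perfect_map h.
Proof.
split; [|exact: comparison_surj|].
  by move=> y; apply/comparison_cvg; exact: cvg_id.
move=> F y2 UF; have [y1 <-] := comparison_surj y2.
by exists y1 => //; exact/comparison_cvg.
Qed.

End ModelComparison.

(** * The reduction maps as an isomorphism of complexes *)

Section ReductionComplex.
Variables (R : realType) (T : metricType R) (T' : topologicalType).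
Variables (G : groupoid T) (G' : groupoid T') (p : groupoid_hom G G').
Hypotheses (eG : etale_groupoid G) (eG' : etale_groupoid G').
Hypotheses (bT : compact_open_basis T) (bT' : compact_open_basis T').
Hypotheses (pp : perfect_map p) (pb : fibrewise_bijective p).
Hypothesis pr : ultra_regular p.
Variable A : zmodType.

Local Notation d := (@mdist R T).
Local Notation Gp := (red_groupoid d pb).
Local Notation Gp' := (red_groupoid' d pb).
Local Notation ppi := (red_hom d pb).

Lemma etale_ample (S : topologicalType) (H : groupoid S) : etale_groupoid H ->
  compact_open_basis S -> ample_nerve H.
Proof.
move=> eH bS; split=> n; first exact: nerve_hausdorff.
  exact: nerve_compact_open_basis.
exact: face_etale.
Qed.

Let D : distance_for d := metric_distance_for T.
Let aG : ample_nerve G := etale_ample eG bT.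
Let aG' : ample_nerve G' := etale_ample eG' bT'.
Let np n : perfect_map (nerve_map p n) := nerve_map_perfect eG pb pp n.
Let nr n : ultra_regular (nerve_map p n) := nerve_map_ultra_regular eG pb pp pr.
Let M n := nerve_model eG pb pp D n.
Let C n (i : 'I_n.+2) := face_cartesian pb i.

Lemma red_ample : ample_nerve Gp.
Proof.
split=> n.
- apply: (model_hausdorff (M n)); exact: ample_hausdorff.
- apply: (model_basis (M n) (np n)) => //.
  + exact: ample_hausdorff.
  + exact: ample_hausdorff.
  + exact: ample_basis.
  + exact: ample_basis.
- move=> i; apply: (model_etale (M n.+1) (M n) (np n.+1) (C i) (psi' := @nerve_face _ Gp' n i)).
  + exact: nerve_map_face.
  + exact: nerve_map_face.
  + exact: ample_face.
  + exact: ample_face.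
Qed.

Lemma red_ample' : ample_nerve Gp'.
Proof.
split=> n.
- apply: (model_hausdorff' (M n) (np n)); exact: ample_hausdorff.
- apply: (model_basis' (M n) (np n)) => //.
  + exact: ample_hausdorff.
  + exact: ample_hausdorff.
  + exact: ample_basis.
  + exact: ample_basis.
- move=> i; apply: (model_etale' (M n.+1) (M n) (np n.+1) (C i)).
  + exact: nerve_map_face.
  + exact: ample_face.
  + exact: ample_face.
Qed.

Lemma red_cartesian n (i : 'I_n.+2) : cartesian (@nerve_face _ Gp n i)
  (@nerve_face _ Gp' n i) (nerve_map ppi n.+1) (nerve_map ppi n).
Proof. by apply: (model_cartesian (M n.+1) (M n) (C i)); exact: nerve_map_face. Qed.

Lemma red_perfect n : perfect_map (nerve_map ppi n).
Proof. exact: model_perfect (M n) (np n). Qed.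

Local Notation reds := (reduces (nerve_map (red_incl d pb) _) (nerve_map ppi _)).

(** Representing the reduction of [f] is a condition that survives the change of model and
    determines the class, so any [g] satisfying it computes [groupoid_reduction]. *)
Lemma groupoid_reductionE n (f : Cc (nerve G n) A) (g : Cc (nerve Gp n) A) :
  reds f g -> groupoid_reduction pb f = quot_chain_proj ppi g.
Proof.
move=> fg; have Dn := nerve_distance_for G n.
have [g2 [fg2 rfg2]] := reduction_reduces Dn (np n)
  (@ample_hausdorff _ _ aG' n) (@nr n) f.
pose M2 := red_model Dn (np n).
rewrite /groupoid_reduction fg2 /quot_map.
set r := repr _.
(* The representative chosen by [quot_map] differs from [g2] by a pullback, hence still represents
   the reduction of [f]. *)
have rg2 : r - g2 \in @pullback_sub _ _ (@red_map _ _ _ (nerve_dist d G n) (nerve_map p n)) A.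
  by apply/quot_eqP; exact: reprK.
have fr : reduces (@red_val _ _ _ (nerve_dist d G n) (nerve_map p n)) (@red_map _ _ _ _ _) f r.
  move=> y z yz; have /(pullback_subP (model_perfect M2 (np n)))/(_ _ _ yz) := rg2.
  rewrite !CcBE => e; have := rfg2 y z yz.
  have E (a b c : A) : a - b = (a - c) - (b - c) by rewrite opprB addrA subrK.
  by rewrite (E _ (r y) (g2 y)) (E _ (r z) (g2 z)) e => ->.
have hp : perfect_map (nerve_red d pb n) by apply: (comparison_perfect (M n) M2).
apply/quot_eqP; apply: (reduces_descend (M n) (np n) (f := f)) => //.
rewrite (perfect_pullback_defined hp) => y z yz.
apply: (fr (nerve_red d pb n y) (nerve_red d pb n z)).
apply: (model_inj' M2); rewrite -!(model_comm M2).
rewrite -[LHS]/(nerve_map p n (nerve_map (red_incl d pb) n y)).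
rewrite -[RHS]/(nerve_map p n (nerve_map (red_incl d pb) n z)).
by rewrite !(model_comm (M n)) yz.
Qed.

Lemma reduces_exists n (f : Cc (nerve G n) A) : exists g : Cc (nerve Gp n) A, reds f g.
Proof.
have cV := compact_open_varies_Cc (M n) (np n) (@nr n) f.
exists (to_Cc (fun y => if nerve_map ppi n y \in
    varies (nerve_map p n) (nerve_map (red_incl' d pb) n) f
  then f (nerve_map (red_incl d pb) n y) else 0)).
rewrite to_CcE; first exact: (reduces_cutoff (M n)).
exact: (Cc_cutoff (M n) (np n) (@ample_hausdorff _ _ aG' n)).
Qed.

Local Notation Pi n := (groupoid_reduction_quot pb (A := A) (n := n)).

Lemma PiE n (f : Cc (nerve G n) A) (g : Cc (nerve Gp n) A) :
  reds f g -> Pi n (quot_chain_proj p f) = quot_chain_proj ppi g.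
Proof.
move=> fg; apply: groupoid_reductionE.
set r := Cc_repr _.
have rf : r - f \in @pullback_sub _ _ (nerve_map p n) A by apply/quot_eqP; exact: reprK.
move=> y z yz; rewrite -[r](subrK f) !CcDE -![_ + f _ - _]addrA (fg y z yz).
congr (_ + _); apply: (pullback_subP (np n) _).1 rf _ _ _.
by rewrite !(model_comm (M n)) yz.
Qed.

Lemma Pi_reduction n (f : Cc (nerve G n) A) :
  Pi n (quot_chain_proj p f) = groupoid_reduction pb f.
Proof.
have [g fg] := reduces_exists f.
by rewrite (PiE fg) (groupoid_reductionE fg).
Qed.

Lemma PiB n : zmod_morphism (Pi n).
Proof.
move=> x y; have [f <-] := proj_surj x; have [f' <-] := proj_surj y.
have [g fg] := reduces_exists f; have [g' fg'] := reduces_exists f'.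
by rewrite -projB (PiE fg) (PiE fg') (PiE (reducesB fg fg')) projB.
Qed.

(** Injectivity: if [g - g'] is constant on fibres, then so is [f - f']. Surjectivity is
    [reduces_surj]. *)
Lemma Pi_bijective n : bijective (Pi n).
Proof.
have inj : injective (Pi n).
  move=> x y; have [f <-] := proj_surj x; have [f' <-] := proj_surj y.
  have [g fg] := reduces_exists f; have [g' fg'] := reduces_exists f'.
  rewrite (PiE fg) (PiE fg') => /quot_eqP gg'; apply/quot_eqP.
  apply: (reduces0 (M n) (np n)) => y1 z1 yz; rewrite Cc0E !subr0.
  have := reducesB fg fg' yz.
  have -> : (g - g') y1 = (g - g') z1.
    exact: (pullback_subP (red_perfect n) _).1 gg' _ _ yz.
  by move/addIr.
have surj q : exists x, Pi n x = q.
  have [g <-] := proj_surj q.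
  have [f fg] := reduces_surj (M n) (np n) (@ample_hausdorff _ _ aG n)
    (@ample_hausdorff _ _ aG' n) (@ample_basis _ _ aG n) (@ample_basis _ _ aG' n) (@nr n) g.
  by exists (quot_chain_proj p f); exact: PiE.
have /choice[s sK] := surj.
by exists s => // x; apply: inj; rewrite sK.
Qed.

Lemma reduces_boundary n (f : Cc (nerve G n.+1) A) (g : Cc (nerve Gp n.+1) A) :
  reds f g -> reds (boundary f) (boundary g).
Proof.
move=> fg y z yz; rewrite !(boundaryE aG) !(boundaryE red_ample) !Cc_sumE -!sumrB.
apply: eq_bigr => i _; rewrite !CcMzE -!mulrzBl; congr (_ *~ _).
rewrite !face_pushE//; last exact: red_ample.
apply: (push_reduces (M n.+1) (M n) (np n.+1) (C i)) fg _ _ yz.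
- exact: nerve_map_face.
- exact: nerve_map_face.
- exact: (push_Cc_face aG i f).1.
- exact: (push_Cc_face red_ample i g).1.
Qed.

Lemma Pi_boundary n (x : quot_chain p A n.+1) :
  Pi n (chain_bd x) = chain_bd (Pi n.+1 x).
Proof.
have [f <-] := proj_surj x; have [g fg] := reduces_exists f.
rewrite (PiE fg) (quot_chain_bdE aG aG' np C).
rewrite (quot_chain_bdE red_ample red_ample' red_perfect red_cartesian).
exact: PiE (reduces_boundary fg).
Qed.

End ReductionComplex.

Theorem proposition4p19 (R : realType)
  (T : metricType R) (T' : topologicalType)
  (G : groupoid T) (G' : groupoid T')
  (etaleG : etale_groupoid G) (etaleG' : etale_groupoid G')
  (tdG : totally_disconnected [set: T]) (tdG' : totally_disconnected [set: T'])
  (p : groupoid_hom G G')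
  (p_continuous : continuous p) (p_surj : set_surj [set: T] [set: T'] p)
  (p_proper : proper_map p) (pb : fibrewise_bijective p)
  (p_regular : regular_map (@mdist R T) p)
  (A : zmodType) :
  let Gp := red_groupoid (@mdist R T) pb in
  let Gp' := red_groupoid' (@mdist R T) pb in
  let pp := red_hom (@mdist R T) pb in
  let Pi := groupoid_reduction_quot pb (A := A) in
  (forall n,
    [/\ forall f : groupoid_chain G A n,
          Pi n (quot_chain_proj p f) = groupoid_reduction pb f,
        zmod_morphism (Pi n) & bijective (Pi n)]) /\
  [/\ boundary_defined G A /\ boundary_defined G' A,
      boundary_defined Gp A /\ boundary_defined Gp' A
    & forall n, pullback_defined (nerve_map p n) A /\
                pullback_defined (nerve_map pp n) A] /\
  [/\ is_complex (groupoid_chain G' A), is_complex (groupoid_chain G A)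
    & is_complex (quot_chain p A)] /\
  [/\ is_complex (groupoid_chain Gp' A), is_complex (groupoid_chain Gp A)
    & is_complex (quot_chain pp A)] /\
  chain_iso Pi /\
  short_exact (pullback_chain p (A := A)) (quot_chain_proj p (A := A)) /\
  short_exact (pullback_chain pp (A := A)) (quot_chain_proj pp (A := A)).
Proof.
move=> Gp Gp' pp Pi.
(* This and the next three facts put properness, total disconnectedness and metric regularity into
   the forms used above. *)
have pP : perfect_map p.
  apply: proper_perfect => //; first exact: etale_hausdorff etaleG'.
  - exact: etale_locally_compact etaleG'.
  - by move=> x'; have [x _ px] := p_surj x' I; exists x.
have bT : compact_open_basis T.
  apply: totally_disconnected_basis => //; first exact: etale_hausdorff etaleG.
  exact: etale_locally_compact etaleG.
have bT' : compact_open_basis T'.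
  apply: totally_disconnected_basis => //; first exact: etale_hausdorff etaleG'.
  exact: etale_locally_compact etaleG'.
have pr : ultra_regular p.
  exact: regular_ultra_regular (metric_distance_for T) pP p_regular.
have aG := etale_ample etaleG bT; have aG' := etale_ample etaleG' bT'.
have aGp := red_ample etaleG etaleG' bT bT' pP pb pr.
have aGp' := red_ample' etaleG etaleG' bT bT' pP pb pr.
have np n := nerve_map_perfect etaleG pb pP n.
have npp n := red_perfect etaleG pP pb n.
have C n (i : 'I_n.+2) := face_cartesian pb i.
have Cp n (i : 'I_n.+2) := red_cartesian etaleG pP pb i.
have PiB n : zmod_morphism (Pi n) by exact: PiB.
have Pi_bij n : bijective (Pi n) by exact: Pi_bijective.
split; [|split; [|split; [|split; [|split; [|split]]]]].
- by move=> n; split; [move=> f; exact: Pi_reduction| |].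
- split.
  + by split=> n f; exact: ample_boundary_defined.
  + by split=> n f; exact: ample_boundary_defined.
  + by move=> n; split; exact: perfect_pullback_defined.
- split; [exact: ample_complex|exact: ample_complex|exact: quot_complex].
- split; [exact: ample_complex|exact: ample_complex|exact: quot_complex].
- by split=> //; split=> // n x; exact: Pi_boundary.
- exact: quot_short_exact.
- exact: quot_short_exact.
Qed.
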